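(* There is a bijection between split Poisson $[2]$-manifolds and self-dual $2$-representations.
   Context: **Split $[2]$-manifold.** Let $Q$ and $B$ be smooth vector bundles over a smooth manifold $M$. The split $[2]$-manifold $Q[-1]\oplus B^*[-2]$ is the graded manifold over $M$ whose sheaf of functions is the sheaf of $\mathbb N$-graded commutative algebras generated over $C^\infty(M)$ by $\Gamma(Q^* )$ in degree $1$ and $\Gamma(B)$ in degree $2$. Its functions of degree $0,1,2$ are therefore $C^\infty(M)$, $\Gamma(Q^* )$ and $\Gamma(B\oplus\wedge^2Q^* )$, respectively. **Split Poisson $[2]$-manifold.** A split $[2]$-manifold endowed with a Poisson bracket of degree $-2$, i.e. an $\mathbb R$-bilinear map $\{\cdot,\cdot\}$ on the graded sheaf of functions such that, for homogeneous functions, $|\{\xi,\eta\}|=|\xi|+|\eta|-2$, $\{\xi,\eta\}=-(-1)^{|\xi||\eta|}\{\eta,\xi\}$, $\{\xi_1,\xi_2\xi_3\}=\{\xi_1,\xi_2\}\xi_3+(-1)^{|\xi_1||\xi_2|}\xi_2\{\xi_1,\xi_3\}$ and $\{\xi_1,\{\xi_2,\xi_3\}\}=\{\{\xi_1,\xi_2\},\xi_3\}+(-1)^{|\xi_1||\xi_2|}\{\xi_2,\{\xi_1,\xi_3\}\}$. **$2$-representation.** Let $(A\to M,\rho,[\cdot,\cdot])$ be a Lie algebroid. A $2$-representation (short for $2$-term representation up to homotopy) of $A$ on a complex $\partial:E_0\to E_1$ of vector bundles over $M$ consists of the vector bundle map $\partial$, $A$-connections $\nabla^0,\nabla^1$ on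 $E_0,E_1$ with $\partial\circ\nabla^0=\nabla^1\circ\partial$, and an element $R\in\Omega^2(A,\mathrm{Hom}(E_1,E_0))$ with $R_{\nabla^0}=R\circ\partial$, $R_{\nabla^1}=\partial\circ R$ and $\mathbf d_{\nabla^{\mathrm{Hom}}}R=0$. Here $R_{\nabla^i}$ is the curvature of $\nabla^i$, $\nabla^{\mathrm{Hom}}$ is the connection induced by $\nabla^0$ and $\nabla^1$ on $\mathrm{Hom}(E_1,E_0)$, and $\mathbf d_{\nabla^{\mathrm{Hom}}}$ is the operator on $\mathrm{Hom}(E_1,E_0)$-valued Lie algebroid forms defined from $\nabla^{\mathrm{Hom}}$ and the bracket of $A$ by the Koszul formula. **Self-dual.** A $2$-representation $(\nabla^Q,\nabla^{Q^*},R)$ of a Lie algebroid $A$ on a complex $\partial_Q:Q^*\to Q$ (so $E_0=Q^*$, $E_1=Q$) is self-dual if it equals its dual, i.e. if $\partial_Q=\partial_Q^*$, the connections $\nabla^Q$ and $\nabla^{Q^*}$ are dual to each other, and $R^*=-R\in\Omega^2(A,\mathrm{Hom}(Q,Q^* ))$. *)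

(* Defs.v *)
From HB Require Import structures.
From mathcomp Require Import all_boot all_order all_algebra.
From mathcomp Require Import all_classical all_reals all_analysis.

Set Implicit Arguments.
Unset Strict Implicit.
Unset Printing Implicit Defensive.

Import Order.TTheory GRing.Theory Num.Theory.
Import numFieldNormedType.Exports.

Local Open Scope classical_set_scope.
Local Open Scope ring_scope.

Section EuclideanSmoothness.
Variables (R : realType) (n : nat).
Implicit Types (U V : set 'rV[R]_n) (f g : 'rV[R]_n -> R).

Fixpoint Cr (k : nat) U f : Prop :=
  (forall x, U x -> {for x, continuous f}) /\
  if k is k'.+1 then
    forall i : 'I_n, (forall x, U x -> derivable f x 'e_i) /\
                     Cr k' U (fun x => 'D_('e_i) f x)
  else True.

Definition smooth_on U f := forall k, Cr k U f.

Lemma CrW k U f : Cr k.+1 U f -> Cr k U f.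
Proof.
elim: k f => [f [? _]//|k IH f [cf df]]; split => // i.
by have [df1 df2] := df i; split => //; exact: IH.
Qed.

Lemma Cr_local k U f :
  (forall x, U x -> exists V, [/\ open V, V x & Cr k V f]) -> Cr k U f.
Proof.
elim: k f => [|k IH] f H.
  by split=> // x /H [V [_ Vx [cf _]]]; exact: cf.
split=> [x /H [V [_ Vx [cf _]]]|i]; first exact: cf.
split=> [x /H [V [_ Vx [_ /(_ i)[df _]]]]|]; first exact: df.
by apply: IH => x /H [V [oV Vx [_ /(_ i)[_ df]]]]; exists V.
Qed.

Lemma Cr_sub k U V f : V `<=` U -> Cr k U f -> Cr k V f.
Proof.
move=> VU; elim: k f => [|k IH] f [cf df]; split => //.
- by move=> x /VU; exact: cf.
- by move=> x /VU; exact: cf.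
- move=> i; have [df1 df2] := df i.
  by split; [move=> x /VU; exact: df1|exact: IH].
Qed.

Lemma Cr_ext k U f g : open U -> (forall x, U x -> f x = g x) ->
  Cr k U f -> Cr k U g.
Proof.
move=> oU.
have nr f' g' x : (forall x, U x -> f' x = g' x) -> U x -> {near x, f' =1 g'}.
  by move=> fg Ux; apply: filterS (open_nbhs_nbhs (conj oU Ux)) => y /fg.
have cg f' g' : (forall x, U x -> f' x = g' x) ->
    (forall x, U x -> {for x, continuous f'}) ->
    forall x, U x -> {for x, continuous g'}.
  move=> fg cf x Ux; rewrite /prop_for /continuous_at -(fg x Ux).
  have H : {near x, f' =1 g'} by exact: nr Ux.
  exact: cvg_trans (near_eq_cvg H) (cf x Ux).
elim: k f g => [|k IH] f g fg [cf df]; split => //; [exact: cg cf|exact: cg cf|].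
move=> i; have [df1 df2] := df i; split=> [x Ux|].
  by apply: near_eq_derivable (df1 x Ux); exact: (nr _ _ _ fg Ux).
by apply: IH df2 => x Ux; apply: near_eq_derive; exact: (nr _ _ _ fg Ux).
Qed.

Lemma Cr_cst k U (a : R) : Cr k U (fun=> a).
Proof.
elim: k a => [|k IH] a; split => //.
- by move=> x _; exact: cst_continuous.
- by move=> x _; exact: cst_continuous.
move=> i; split=> [x _|]; first exact: derivable_cst.
have -> : (fun x => 'D_('e_i) (fun=> a) x) = (fun=> 0 : R) :> ('rV[R]_n -> R).
  by apply: funext => x; exact: derive_cst.
exact: IH.
Qed.

Lemma CrD k U f g : open U -> Cr k U f -> Cr k U g ->
  Cr k U (fun x => f x + g x).
Proof.
move=> oU; elim: k f g => [|k IH] f g [cf df] [cg dg].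
  by split => // x Ux; exact: cvgD (cf x Ux) (cg x Ux).
split => [x Ux|i]; first by exact: cvgD (cf x Ux) (cg x Ux).
have [[df1 df2] [dg1 dg2]] := (df i, dg i).
split=> [x Ux|]; first by apply: derivableD; [exact: df1|exact: dg1].
apply: (Cr_ext oU) (IH _ _ df2 dg2) => x Ux.
by rewrite -(deriveD (df1 x Ux) (dg1 x Ux)).
Qed.

Lemma CrM k U f g : open U -> Cr k U f -> Cr k U g ->
  Cr k U (fun x => f x * g x).
Proof.
move=> oU; elim: k f g => [|k IH] f g Hf Hg;
  have [cf df] := Hf; have [cg dg] := Hg.
  by split => // x Ux; exact: cvgM (cf x Ux) (cg x Ux).
split => [x Ux|i]; first by exact: cvgM (cf x Ux) (cg x Ux).
have [[df1 df2] [dg1 dg2]] := (df i, dg i).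
split=> [x Ux|]; first by apply: derivableM; [exact: df1|exact: dg1].
have := CrD oU (IH _ _ (CrW Hf) dg2) (IH _ _ (CrW Hg) df2).
apply: (Cr_ext oU) => x Ux.
by rewrite -[RHS]/('D_('e_i) (f * g) x) (deriveM (df1 x Ux) (dg1 x Ux)).
Qed.

End EuclideanSmoothness.

Record chart (R : realType) (M : topologicalType) (n : nat) := Chart {
  cdom : set M;
  crange : set 'rV[R]_n;
  cmap : M -> 'rV[R]_n;
  cinv : 'rV[R]_n -> M;
  cdom_open : open cdom;
  crange_open : open crange;
  cmap_range : forall x, cdom x -> crange (cmap x);
  cinv_dom : forall y, crange y -> cdom (cinv y);
  cmapK : forall x, cdom x -> cinv (cmap x) = x;
  cinvK : forall y, crange y -> cmap (cinv y) = y;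
  cmap_continuous : forall x, cdom x -> {for x, continuous cmap};
  cinv_continuous : forall y, crange y -> {for y, continuous cinv}
}.

Record manifold (R : realType) := Manifold {
  points :> topologicalType;
  points_hausdorff : hausdorff_space points;
  points_second_countable : @second_countable points;
  mdim : nat;
  atlas : set (chart R points mdim);
  atlas_cover : forall x, exists2 c, atlas c & cdom c x;
  atlas_compat : forall c c', atlas c -> atlas c' -> forall j,
    smooth_on (crange c `&` cinv c @^-1` cdom c')
              (fun y => cmap c' (cinv c y) 0 j)
}.

Arguments atlas {R} m.

Section SmoothFunctions.
Variables (R : realType) (M : manifold R).
Implicit Types (U V : set M) (f g : M -> R).

Definition smoothM U f := forall c, atlas M c ->
  smooth_on (crange c `&` cinv c @^-1` U) (f \o cinv c).

Lemma chart_open (c : chart R M (mdim M)) U : open U ->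
  open (crange c `&` cinv c @^-1` U).
Proof.
move=> oU; rewrite openE => y [ry Uy]; apply: filterI.
  exact: open_nbhs_nbhs (conj (@crange_open _ _ _ c) ry).
exact: (cinv_continuous ry) (open_nbhs_nbhs (conj oU Uy)).
Qed.

Lemma smoothM_sub U V f : V `<=` U -> smoothM U f -> smoothM V f.
Proof.
by move=> VU sf c ac k; apply: Cr_sub (sf c ac k) => y [ry /VU].
Qed.

Lemma smoothM_local U f :
  (forall x, U x -> exists V, [/\ open V, V x & smoothM V f]) -> smoothM U f.
Proof.
move=> H c ac k; apply: Cr_local => y [ry /H [V [oV Vy sf]]].
by exists (crange c `&` cinv c @^-1` V); split; [exact: chart_open|split|exact: sf].
Qed.

Lemma smoothM_ext U f g : open U -> (forall x, U x -> f x = g x) ->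
  smoothM U f -> smoothM U g.
Proof.
move=> oU fg sf c ac k; apply: Cr_ext (sf c ac k); first exact: chart_open.
by move=> y [_ Uy] /=; exact: fg.
Qed.

Lemma smoothM_cst U (a : R) : smoothM U (fun=> a).
Proof. by move=> c ac k; exact: Cr_cst. Qed.

Lemma smoothMD U f g : open U -> smoothM U f -> smoothM U g ->
  smoothM U (fun x => f x + g x).
Proof.
by move=> oU sf sg c ac k; apply: CrD (sf c ac k) (sg c ac k); exact: chart_open.
Qed.

Lemma smoothMM U f g : open U -> smoothM U f -> smoothM U g ->
  smoothM U (fun x => f x * g x).
Proof.
by move=> oU sf sg c ac k; apply: CrM (sf c ac k) (sg c ac k); exact: chart_open.
Qed.

Lemma smoothM_sum U (I : Type) (s : seq I) (F : I -> M -> R) : open U ->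
  (forall i, smoothM U (F i)) -> smoothM U (fun x => \sum_(i <- s) F i x).
Proof.
move=> oU sF; elim: s => [|i s IH].
  by apply: smoothM_ext (smoothM_cst U 0) => // x _; rewrite big_nil.
apply: smoothM_ext (smoothMD oU (sF i) IH) => // x _.
by rewrite big_cons.
Qed.

Definition smooth_fun : {pred M -> R} := [pred f | `[< smoothM setT f >]].

Lemma smooth_funP f : reflect (smoothM setT f) (f \in smooth_fun).
Proof. exact: asboolP. Qed.

Fact smooth_fun_subring : subring_closed smooth_fun.
Proof.
split=> [|f g /smooth_funP sf /smooth_funP sg|f g /smooth_funP sf /smooth_funP sg];
  apply/smooth_funP.
- exact: smoothM_cst.
- have := smoothMD openT sf (smoothMM openT (smoothM_cst setT (- 1)) sg).
  by apply: smoothM_ext => [|x _]; [exact: openT|rewrite mulN1r].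
- exact: smoothMM openT sf sg.
Qed.
HB.instance Definition _ :=
  GRing.isSubringClosed.Build (M -> R) smooth_fun smooth_fun_subring.

End SmoothFunctions.

Record Cinf (R : realType) (M : manifold R) := SmoothFun {
  Cinf_val :> M -> R;
  Cinf_smooth : Cinf_val \in @smooth_fun R M
}.
HB.instance Definition _ (R : realType) (M : manifold R) :=
  [isSub for @Cinf_val R M].
HB.instance Definition _ (R : realType) (M : manifold R) :=
  [Choice of Cinf M by <:].
HB.instance Definition _ (R : realType) (M : manifold R) :=
  GRing.SubChoice_isSubComPzRing.Build (M -> R) (@smooth_fun R M) (Cinf M)
    (subringClosedP _).

Definition Cinf_cst (R : realType) (M : manifold R) (a : R) : Cinf M :=
  SmoothFun (introT (smooth_funP _) (smoothM_cst (M:=M) setT a)).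

(* Dependent functions as a module; the library has only the non-dependent case. *)
Definition dfun (I : Type) (R : pzRingType) (E : I -> lmodType R) : Type :=
  forall i, E i.

Section DependentFunctions.
Variables (I : Type) (R : pzRingType) (E : I -> lmodType R).
Local Notation F := (dfun E).

HB.instance Definition _ := gen_eqMixin F.
HB.instance Definition _ := gen_choiceMixin F.

Fact dfun_addA : associative (fun s t : F => (fun i => s i + t i) : F).
Proof. by move=> s t u; apply: functional_extensionality_dep => i; rewrite addrA. Qed.
Fact dfun_addC : commutative (fun s t : F => (fun i => s i + t i) : F).
Proof. by move=> s t; apply: functional_extensionality_dep => i; rewrite addrC. Qed.
Fact dfun_add0 :
  left_id ((fun i => 0) : F) (fun s t : F => (fun i => s i + t i) : F).
Proof. by move=> s; apply: functional_extensionality_dep => i; rewrite add0r. Qed.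
Fact dfun_addN : left_inverse ((fun i => 0) : F) (fun s : F => (fun i => - s i) : F)
  (fun s t : F => (fun i => s i + t i) : F).
Proof. by move=> s; apply: functional_extensionality_dep => i; rewrite addNr. Qed.
HB.instance Definition _ :=
  GRing.isZmodule.Build F dfun_addA dfun_addC dfun_add0 dfun_addN.

Definition dfun_scale (a : R) (s : F) : F := fun i => a *: s i.
Fact dfun_scaleA a b s : dfun_scale a (dfun_scale b s) = dfun_scale (a * b) s.
Proof. by apply: functional_extensionality_dep => i; rewrite /dfun_scale scalerA. Qed.
Fact dfun_scale1 : left_id 1 dfun_scale.
Proof. by move=> s; apply: functional_extensionality_dep => i; rewrite /dfun_scale scale1r. Qed.
Fact dfun_scaleDr : right_distributive dfun_scale +%R.
Proof. by move=> a s t; apply: functional_extensionality_dep => i; exact: scalerDr. Qed.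
Fact dfun_scaleDl s : {morph dfun_scale^~ s : a b / a + b}.
Proof. by move=> a b; apply: functional_extensionality_dep => i; exact: scalerDl. Qed.
HB.instance Definition _ := GRing.Zmodule_isLmodule.Build R F
  dfun_scaleA dfun_scale1 dfun_scaleDr dfun_scaleDl.

End DependentFunctions.

Record trivialization (R : realType) (M : manifold R) (E : M -> vectType R)
    (r : nat) := Trivialization {
  tdom : set M;
  tmap : forall x, 'Hom(E x, 'rV[R]_r);
  tinv : forall x, 'Hom('rV[R]_r, E x);
  tdom_open : open tdom;
  tmapK : forall x, tdom x -> cancel (tmap x) (tinv x);
  tinvK : forall x, tdom x -> cancel (tinv x) (tmap x)
}.

(* The topology and smooth structure of the total space are those induced by
   the trivializations. *)
Record vbundle (R : realType) (M : manifold R) := VBundle {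
  fib :> M -> vectType R;
  vrank : nat;
  trivs : set (trivialization fib vrank);
  trivs_cover : forall x, exists2 t, trivs t & tdom t x;
  trivs_compat : forall t t', trivs t -> trivs t' -> forall i j,
    smoothM (tdom t `&` tdom t')
            (fun x => tmap t' x (tinv t x 'e_i) 0 j)
}.

Arguments trivs {R M} v.
Arguments trivs_cover {R M} v.

Section Sections.
Variables (R : realType) (M : manifold R) (E : vbundle M).
Implicit Types s : dfun (fib E).

Definition smooth_sec : {pred dfun (fib E)} := [pred s | `[<
  forall t, trivs E t -> forall i,
    smoothM (tdom t) (fun x => tmap t x (s x) 0 i) >]].

Lemma smooth_secP s : reflect
  (forall t, trivs E t -> forall i,
    smoothM (tdom t) (fun x => tmap t x (s x) 0 i)) (s \in smooth_sec).
Proof. exact: asboolP. Qed.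

Lemma smooth_sec_comb (f : M -> R) s s' : smoothM setT f ->
  s \in smooth_sec -> s' \in smooth_sec ->
  ((fun x => f x *: s x + s' x) : dfun (fib E)) \in smooth_sec.
Proof.
move=> sf /smooth_secP ss /smooth_secP ss'; apply/smooth_secP => t tt i.
have sft := smoothM_sub (@subsetT _ (tdom t)) sf.
have := smoothMD (@tdom_open _ _ _ _ t)
  (smoothMM (@tdom_open _ _ _ _ t) sft (ss t tt i)) (ss' t tt i).
apply: smoothM_ext; first exact: tdom_open.
by move=> x _ /=; rewrite linearP !mxE.
Qed.

Lemma smooth_sec0 : (0 : dfun (fib E)) \in smooth_sec.
Proof.
apply/smooth_secP => t tt i; apply: smoothM_ext (smoothM_cst _ 0).
  exact: tdom_open.
by move=> x _; rewrite -[(0 : dfun _) x]/0 linear0 mxE.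
Qed.

Fact smooth_sec_zmod : zmod_closed smooth_sec.
Proof.
split=> [|s t ss st]; first exact: smooth_sec0.
have -> : s - t = (fun x => - 1 *: t x + s x) :> dfun (fib E).
  by apply: functional_extensionality_dep => x; rewrite scaleN1r addrC.
by apply: smooth_sec_comb => //; exact: smoothM_cst.
Qed.
HB.instance Definition _ :=
  GRing.isZmodClosed.Build (dfun (fib E)) smooth_sec smooth_sec_zmod.

End Sections.
Arguments smooth_sec {R M} E.

Record Gamma (R : realType) (M : manifold R) (E : vbundle M) := Sec {
  sec_val : dfun (fib E);
  sec_smooth : sec_val \in smooth_sec E
}.

Section SectionModule.
Variables (R : realType) (M : manifold R) (E : vbundle M).

Definition sec_at (s : Gamma E) (x : M) : E x := sec_val s x.
Coercion sec_at : Gamma >-> Funclass.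

HB.instance Definition _ := [isSub for @sec_val R M E].
HB.instance Definition _ := [Choice of Gamma E by <:].
HB.instance Definition _ := [SubChoice_isSubZmodule of Gamma E by <:].

Lemma sec_ext (s t : Gamma E) : (forall x, s x = t x) -> s = t.
Proof. by move=> st; apply/val_inj/functional_extensionality_dep. Qed.

Fact sec_scale_subproof (f : Cinf M) (s : Gamma E) :
  ((fun x => f x *: s x) : dfun (fib E)) \in smooth_sec E.
Proof.
have -> : ((fun x => f x *: s x) : dfun (fib E)) =
    (fun x => f x *: s x + (0 : dfun (fib E)) x).
  by apply: functional_extensionality_dep => x; rewrite [X in _ + X]/(0) addr0.
apply: smooth_sec_comb (sec_smooth s) (smooth_sec0 E).
exact: (elimT (smooth_funP _) (Cinf_smooth f)).
Qed.
Definition sec_scale f s : Gamma E := Sec (sec_scale_subproof f s).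

Fact sec_scaleA f g s : sec_scale f (sec_scale g s) = sec_scale (f * g) s.
Proof. by apply: sec_ext => x; exact: scalerA. Qed.
Fact sec_scale1 : left_id 1 sec_scale.
Proof. by move=> s; apply: sec_ext => x; exact: scale1r. Qed.
Fact sec_scaleDr : right_distributive sec_scale +%R.
Proof. by move=> f s t; apply: sec_ext => x; exact: scalerDr. Qed.
Fact sec_scaleDl s : {morph sec_scale^~ s : f g / f + g}.
Proof. by move=> f g; apply: sec_ext => x; exact: scalerDl. Qed.
HB.instance Definition _ := GRing.Zmodule_isLmodule.Build (Cinf M) (Gamma E)
  sec_scaleA sec_scale1 sec_scaleDr sec_scaleDl.

End SectionModule.

Section Dual.
Variables (R : realType) (M : manifold R) (E : vbundle M).

Definition dual_fib (x : M) : vectType R := 'Hom(E x, R^o).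


Section DualTrivialization.
Variable t : trivialization (fib E) (vrank E).

Definition dual_coords (x : M) (alpha : dual_fib x) : 'rV[R]_(vrank E) :=
  \row_i (alpha (tinv t x 'e_i) : R).
Fact dual_coords_linear x : linear (@dual_coords x).
Proof. by move=> a u v; apply/rowP => i; rewrite !mxE add_lfunE scale_lfunE. Qed.
HB.instance Definition _ x := GRing.isLinear.Build R _ _ _ (@dual_coords x)
  (@dual_coords_linear x).

Definition of_coords (x : M) (v : 'rV[R]_(vrank E)) (e : E x) : R^o :=
  \sum_i v 0 i * tmap t x e 0 i.
Fact of_coords_linear x v : linear (@of_coords x v).
Proof.
move=> a e e'; rewrite /of_coords [X in _ = X + _]mulr_sumr -big_split /=.
by apply: eq_bigr => i _; rewrite linearP !mxE mulrDr mulrCA.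
Qed.
HB.instance Definition _ x v := GRing.isLinear.Build R _ _ _ (@of_coords x v)
  (@of_coords_linear x v).

Definition dual_of_coords (x : M) (v : 'rV[R]_(vrank E)) : dual_fib x :=
  linfun (@of_coords x v).
Fact dual_of_coords_linear x : linear (@dual_of_coords x).
Proof.
move=> a u v; apply/lfunP => e; rewrite add_lfunE scale_lfunE !lfunE/= /of_coords.
rewrite [X in _ = X + _]mulr_sumr -big_split /=.
by apply: eq_bigr => i _; rewrite !mxE mulrDl mulrA.
Qed.
HB.instance Definition _ x := GRing.isLinear.Build R _ _ _ (@dual_of_coords x)
  (@dual_of_coords_linear x).

Fact pairing_coords x (alpha : dual_fib x) (e : E x) : tdom t x ->
  alpha e = \sum_i dual_coords alpha 0 i * tmap t x e 0 i.
Proof.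
move=> tx; rewrite -{1}(tmapK tx e) {1}(row_sum_delta (tmap t x e)) !linear_sum.
by apply: eq_bigr => i _; rewrite !linearZ mxE mulrC.
Qed.

Fact dual_coordsK x : tdom t x ->
  cancel (linfun (@dual_coords x)) (linfun (@dual_of_coords x)).
Proof.
move=> tx alpha; rewrite !lfunE; apply/lfunP => e.
by rewrite lfunE /= (pairing_coords alpha e tx).
Qed.

Fact dual_of_coordsK x : tdom t x ->
  cancel (linfun (@dual_of_coords x)) (linfun (@dual_coords x)).
Proof.
move=> tx v; rewrite !lfunE; apply/rowP => i.
rewrite mxE lfunE /= /of_coords tinvK // (bigD1 i) //= mxE !eqxx mulr1.
by rewrite big1 ?addr0 // => j ji; rewrite mxE eqxx (negbTE ji) mulr0.
Qed.

Definition dual_triv : trivialization dual_fib (vrank E) :=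
  @Trivialization R M dual_fib (vrank E) (tdom t)
    (fun x => linfun (@dual_coords x)) (fun x => linfun (@dual_of_coords x))
    (@tdom_open _ _ _ _ t) dual_coordsK dual_of_coordsK.

End DualTrivialization.

Fact dual_cover x : exists2 t, (dual_triv @` trivs E) t & tdom t x.
Proof.
have [t tt tx] := trivs_cover E x.
by exists (dual_triv t); [exists t|].
Qed.

Fact dual_compat t t' : (dual_triv @` trivs E) t -> (dual_triv @` trivs E) t' ->
  forall i j, smoothM (tdom t `&` tdom t')
    (fun x => tmap t' x (tinv t x 'e_i) 0 j).
Proof.
move=> [u uE <-] [u' u'E <-] i j /=.
have := trivs_compat u'E uE j i; rewrite setIC.
apply: smoothM_ext => [|x [ux u'x]].
  by apply: openI; exact: tdom_open.
rewrite !lfunE mxE lfunE /= /of_coords (bigD1 i) //= mxE !eqxx mul1r.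
by rewrite big1 ?addr0 // => k ki; rewrite mxE eqxx (negbTE ki) mul0r.
Qed.

Definition dual : vbundle M := VBundle dual_cover dual_compat.

Fact pairing_smooth (tau : Gamma dual) (s : Gamma E) :
  smoothM setT (fun x => tau x (s x)).
Proof.
apply: smoothM_local => x _; have [t tE tx] := trivs_cover E x.
exists (tdom t); split => //; first exact: tdom_open.
have := @smoothM_sum R M (tdom t) _ (index_enum 'I_(vrank E))
  (fun i x => tmap (dual_triv t) x (tau x) 0 i * tmap t x (s x) 0 i)
  (@tdom_open _ _ _ _ t).
move=> /(_ _) H; apply: smoothM_ext (H _); first exact: tdom_open.
  by move=> y ty; rewrite (pairing_coords _ _ ty) /= lfunE.
move=> i; apply: smoothMM; first exact: tdom_open.
  have /smooth_secP ss := sec_smooth tau; apply: (ss (dual_triv t) _ i).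
  by exists t.
by have /smooth_secP ss := sec_smooth s; exact: (ss t tE i).
Qed.

Definition pairing (tau : Gamma dual) (s : Gamma E) : Cinf M :=
  SmoothFun (introT (smooth_funP _) (pairing_smooth tau s)).

End Dual.

(* T_xM as the space of derivations of C^oo(M) at x. *)
Definition tangent (R : realType) (M : manifold R) (x : M) (v : Cinf M -> R) :=
  (forall r f g, v (Cinf_cst M r * f + g) = r * v f + v g) /\
  (forall f g, v (f * g) = v f * g x + f x * v g).

Record anchor_map (R : realType) (M : manifold R) (A : vbundle M) := AnchorMap {
  anchor_at : forall x, A x -> Cinf M -> R;
  anchor_linear : forall x, linear (@anchor_at x);
  anchor_tangent : forall x v, tangent x (@anchor_at x v);
  anchor_smooth : forall (a : Gamma A) f,
    (fun x => anchor_at (a x) f) \in @smooth_fun R M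
}.

(* rho(a) f *)
Definition anchor (R : realType) (M : manifold R) (A : vbundle M)
    (rho : anchor_map A) (a : Gamma A) (f : Cinf M) : Cinf M :=
  SmoothFun (anchor_smooth rho a f).

Record lie_algebroid (R : realType) (M : manifold R) (A : vbundle M) :=
  LieAlgebroid {
  rho : anchor_map A;
  brk : Gamma A -> Gamma A -> Gamma A;
  brk_linear : forall r a b c,
    brk (Cinf_cst M r *: a + b) c = Cinf_cst M r *: brk a c + brk b c;
  brk_skew : forall a b, brk a b = - brk b a;
  brk_jacobi : forall a b c,
    brk a (brk b c) = brk (brk a b) c + brk b (brk a c);
  brk_leibniz : forall a f b,
    brk a (f *: b) = anchor rho a f *: b + f *: brk a b;
  rho_brk : forall a b f,
    anchor rho (brk a b) f =
    anchor rho a (anchor rho b f) - anchor rho b (anchor rho a f)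
}.

Section TwoRepresentations.
Variables (R : realType) (M : manifold R).

Record bundle_map (E F : vbundle M) := BundleMap {
  bmap_at : forall x, 'Hom(E x, F x);
  bmap_smooth : forall s : Gamma E,
    ((fun x => bmap_at x (s x)) : dfun (fib F)) \in smooth_sec F
}.

Definition bmap (E F : vbundle M) (phi : bundle_map E F) (s : Gamma E) :
  Gamma F := Sec (bmap_smooth phi s).

Record connection (A : vbundle M) (L : lie_algebroid A) (E : vbundle M) :=
  Connection {
  nabla :> Gamma A -> Gamma E -> Gamma E;
  nabla_linear_l : forall f a b e,
    nabla (f *: a + b) e = f *: nabla a e + nabla b e;
  nabla_linear_r : forall r a e e',
    nabla a (Cinf_cst M r *: e + e') = Cinf_cst M r *: nabla a e + nabla a e';
  nabla_leibniz : forall a f e,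
    nabla a (f *: e) = anchor (rho L) a f *: e + f *: nabla a e
}.

(* Elements of Omega^2(A, Hom(E, F)). *)
Record hom_form2 (A E F : vbundle M) := HomForm2 {
  form_at : forall x, A x -> A x -> 'Hom(E x, F x);
  form_linear : forall x v, linear (fun u => @form_at x u v);
  form_alt : forall x u v, @form_at x u v = - form_at v u;
  form_smooth : forall (a b : Gamma A) (e : Gamma E),
    ((fun x => form_at (a x) (b x) (e x)) : dfun (fib F)) \in smooth_sec F
}.

Definition form (A E F : vbundle M) (w : hom_form2 A E F) (a b : Gamma A)
  (e : Gamma E) : Gamma F := Sec (form_smooth w a b e).

Section Operators.
Variables (A : vbundle M) (L : lie_algebroid A).

Definition curvature (E : vbundle M) (D : connection L E) (a b : Gamma A)
    (e : Gamma E) : Gamma E :=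
  D a (D b e) - D b (D a e) - D (brk L a b) e.

Definition nabla_hom (E F : vbundle M) (DE : connection L E)
    (DF : connection L F) (a : Gamma A) (phi : Gamma E -> Gamma F) :
    Gamma E -> Gamma F :=
  fun e => DF a (phi e) - phi (DE a e).

Definition d_nabla_hom (E F : vbundle M) (DE : connection L E)
    (DF : connection L F) (w : hom_form2 A E F) (a b c : Gamma A)
    (e : Gamma E) : Gamma F :=
  nabla_hom DE DF a (form w b c) e - nabla_hom DE DF b (form w a c) e
  + nabla_hom DE DF c (form w a b) e
  - form w (brk L a b) c e + form w (brk L a c) b e - form w (brk L b c) a e.

Record two_rep (E0 E1 : vbundle M) := TwoRep {
  del : bundle_map E0 E1;
  nabla0 : connection L E0;
  nabla1 : connection L E1;
  curv : hom_form2 A E1 E0;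
  del_nabla : forall a e, bmap del (nabla0 a e) = nabla1 a (bmap del e);
  curv_nabla0 : forall a b e, curvature nabla0 a b e = form curv a b (bmap del e);
  curv_nabla1 : forall a b e, curvature nabla1 a b e = bmap del (form curv a b e);
  curv_closed : forall a b c e, d_nabla_hom nabla1 nabla0 curv a b c e = 0
}.

(* The three clauses are del^* = del, duality of the two connections, and
   R^* = - R, under the canonical identification of Q^** with Q. *)
Definition self_dual (Q : vbundle M) (D : two_rep (dual Q) Q) : Prop :=
  [/\ forall x (s t : dual Q x), t (bmap_at (del D) x s) = s (bmap_at (del D) x t),
      forall a (t : Gamma (dual Q)) (q : Gamma Q),
        anchor (rho L) a (pairing t q) =
        pairing (nabla0 D a t) q + pairing t (nabla1 D a q)
    & forall x (u v : A x) (p q : Q x),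
        form_at (curv D) u v q p = - form_at (curv D) u v p q ].

End Operators.

Record self_dual_two_rep (Q A : vbundle M) := SelfDualTwoRep {
  sd_algebroid : lie_algebroid A;
  sd_rep : two_rep sd_algebroid (dual Q) Q;
  sd_self_dual : self_dual sd_rep
}.

End TwoRepresentations.

Section ShuffleProduct.
Variables (R : realType) (V W : Type).
Implicit Types w h : seq V -> W -> R.

(* w [:: v1; ...; vk] z is the value at z of the alternating k-form component
   of w on (v1, ..., vk). The recursion expresses that contraction with a
   vector is an odd derivation; it unfolds to the signed sum over
   shuffles, with (alpha beta)(u, v) = alpha(u) beta(v) - alpha(v) beta(u)
   for 1-forms. *)
Fixpoint wedge w h (s : seq V) (z : W) {struct s} : R :=
  if s is v :: s' then
    wedge (fun l => w (v :: l)) h s' z +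
    wedge (fun l z => (-1) ^+ size l * w l z) (fun l => h (v :: l)) s' z
  else w [::] z * h [::] z.

Lemma wedge0l h s z : wedge (fun _ _ => 0) h s z = 0.
Proof.
elim: s h => [|v s IH] h /=; first by rewrite mul0r.
rewrite IH add0r (_ : (fun l z => _) = fun _ _ => 0) ?IH //.
by apply/funext => l; apply/funext => y; rewrite mulr0.
Qed.

Lemma wedge0r w s z : wedge w (fun _ _ => 0) s z = 0.
Proof. by elim: s w => [|v s IH] w /=; rewrite ?mulr0 // !IH addr0. Qed.

End ShuffleProduct.

Record opens (M : topologicalType) := Opens {
  opens_set :> set M;
  opens_open : open opens_set
}.
Definition opens_full (M : topologicalType) : opens M := Opens (@openT M).

Section SplitTwoManifold.
Variables (R : realType) (M : manifold R) (Q B : vbundle M).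

(* The algebra wedge(Q_x^* ) (x) S(B_x), its symmetric factor being
   realized as polynomial functions on B_x^*, sits inside gfib x as the
   subalgebra generated by the three families below. *)
Definition gfib (x : M) : lmodType R := seq (Q x) -> dual B x -> R^o.

Definition deg0 (f : Cinf M) : dfun gfib :=
  fun x s _ => if s is [::] then f x else 0.
Definition deg1 (t : Gamma (dual Q)) : dfun gfib :=
  fun x s _ => if s is [:: q] then t x q else 0.
Definition deg2 (b : Gamma B) : dfun gfib :=
  fun x s z => if s is [::] then z (b x) else 0.

Inductive generated : nat -> dfun gfib -> Prop :=
| gen_deg0 f : generated 0 (deg0 f)
| gen_deg1 t : generated 1 (deg1 t)
| gen_deg2 b : generated 2 (deg2 b)
| gen_zero n : generated n 0
| gen_comb n a g h : generated n g -> generated n h -> generated n (a *: g + h)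
| gen_mul m n g h : generated m g -> generated n h ->
    generated (m + n) (fun x => wedge (g x) (h x)).

Definition gsec (U : set M) := dfun (fun p : {x : M | U x} => gfib (sval p)).

Definition glob (U : set M) (h : dfun gfib) : gsec U := fun p => h (sval p).

Definition gres (U V : set M) (VU : V `<=` U) (g : gsec U) : gsec V :=
  fun p => g (exist _ (sval p) (VU _ (svalP p))).

Definition gmul (U : set M) (g h : gsec U) : gsec U :=
  fun p => wedge (g p) (h p).

(* The sheaf is the one generated by global sections: a function on U is locally
   in the subalgebra generated by C^oo(M), Gamma(Q^* ) and Gamma(B). Since smooth
   functions and sections are locally restrictions of global ones, its sections
   are the smooth ones of wedge Q^* (x) S B. *)
Definition gfun_pred (d : int) (U : set M) : {pred gsec U} := [pred g | `[<
  match d with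
  | Posz n => forall p : {x : M | U x}, exists (V : set M) (h : dfun gfib),
      [/\ open V, V (sval p), generated n h &
          forall p' : {x : M | U x}, V (sval p') -> g p' = h (sval p')]
  | Negz _ => g = 0 :> gsec U
  end >]].

Fact gfun_submod d U : submod_closed (@gfun_pred d U).
Proof.
split.
  apply/asboolP; case: d => [n|//] p.
  by exists setT, 0; split => //; [exact: openT|exact: gen_zero].
move=> a g g' /asboolP gP /asboolP g'P; apply/asboolP.
case: d gP g'P => [n|n] gP g'P; last by rewrite gP g'P scaler0 addr0.
move=> p; have [V [h [oV Vp hn gh]]] := gP p.
have [V' [h' [oV' V'p h'n g'h']]] := g'P p.
exists (V `&` V'), (a *: h + h'); split => //.
- exact: openI.
- exact: gen_comb.
- move=> p' [Vp' V'p'].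
  by rewrite -[LHS]/(a *: g p' + g' p') (gh _ Vp') (g'h' _ V'p').
Qed.
HB.instance Definition _ d U :=
  GRing.isSubmodClosed.Build R (gsec U) (@gfun_pred d U) (@gfun_submod d U).

End SplitTwoManifold.

Record gfun (R : realType) (M : manifold R) (Q B : vbundle M) (d : int)
    (U : opens M) := GFun {
  gfun_val : gsec Q B U;
  gfun_mem : gfun_val \in @gfun_pred R M Q B d U
}.

Section SheafOfFunctions.
Variables (R : realType) (M : manifold R) (Q B : vbundle M).
Local Notation O := (gfun Q B).

HB.instance Definition _ d U := [isSub for @gfun_val R M Q B d U].
HB.instance Definition _ d U := [Choice of O d U by <:].
HB.instance Definition _ d U := [SubChoice_isSubLmodule of O d U by <:].

Fact restrict_subproof d (U V : opens M) (VU : V `<=` U) (g : O d U) :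
  gres VU (val g) \in @gfun_pred R M Q B d V.
Proof.
have /asboolP := gfun_mem g; change (gfun_val g) with (val g).
move: (val g) => {}g gP; apply/asboolP.
case: d gP => [n|n] gP; last by rewrite gP.
move=> p; have [W [h [oW Wp hn gh]]] := gP (exist _ (sval p) (VU _ (svalP p))).
exists W, h; split => // p' Wp'.
exact: (gh (exist _ (sval p') (VU _ (svalP p'))) Wp').
Qed.
Definition restrict d (U V : opens M) (VU : V `<=` U) (g : O d U) : O d V :=
  GFun (restrict_subproof VU g).

Fact omul_subproof d e (U : opens M) (g : O d U) (h : O e U) :
  gmul (val g) (val h) \in @gfun_pred R M Q B (d + e) U.
Proof.
have /asboolP := gfun_mem g; have /asboolP := gfun_mem h.
change (gfun_val g) with (val g); change (gfun_val h) with (val h).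
move: (val g) (val h) => {}g {}h.
case: d => [m|m]; last first.
  move=> _ ->; rewrite (_ : gmul _ _ = 0) ?rpred0 //.
  apply: functional_extensionality_dep => p.
  by apply/funext => s; apply/funext => z; exact: wedge0l.
case: e => [n|n]; last first.
  move=> -> _; rewrite (_ : gmul _ _ = 0) ?rpred0 //.
  apply: functional_extensionality_dep => p.
  by apply/funext => s; apply/funext => z; exact: wedge0r.
move=> hP gP; apply/asboolP => p.
have [V [h' [oV Vp hn hh]]] := hP p; have [W [g' [oW Wp gn gg]]] := gP p.
exists (W `&` V), (fun x => wedge (g' x) (h' x)); split => //.
- exact: openI.
- exact: gen_mul.
- by move=> p' [Wp' Vp']; rewrite /gmul gg // hh.
Qed.
Definition omul d e (U : opens M) (g : O d U) (h : O e U) : O (d + e) U :=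
  GFun (omul_subproof g h).

Fact global_subproof n (h : dfun (gfib Q B)) : generated n h ->
  glob h \in @gfun_pred R M Q B n (opens_full M).
Proof.
move=> hn; apply/asboolP => p; exists setT, h; split => //; exact: openT.
Qed.
Definition fun0 f : O 0 (opens_full M) := GFun (global_subproof (gen_deg0 Q B f)).
Definition fun1 t : O 1 (opens_full M) := GFun (global_subproof (gen_deg1 B t)).
Definition fun2 b : O 2 (opens_full M) := GFun (global_subproof (gen_deg2 Q b)).

End SheafOfFunctions.

(* Degrees range over int, functions of negative degree being zero; equations
   between functions whose degrees agree only propositionally are stated
   in gsec. *)
Record poisson (R : realType) (M : manifold R) (Q B : vbundle M) := Poisson {
  pb : forall (U : opens M) (d e : int),
    gfun Q B d U -> gfun Q B e U -> gfun Q B (d + e - 2) U;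
  pb_restrict : forall (U V : opens M) (VU : V `<=` U) d e
      (g : gfun Q B d U) (h : gfun Q B e U),
    restrict VU (pb g h) = pb (restrict VU g) (restrict VU h);
  pb_linear_l : forall U d e (h : gfun Q B e U),
    linear (fun g : gfun Q B d U => pb g h);
  pb_linear_r : forall U d e (g : gfun Q B d U),
    linear (fun h : gfun Q B e U => pb g h);
  pb_skew : forall U d e (g : gfun Q B d U) (h : gfun Q B e U),
    val (pb g h) = - ((-1) ^ (d * e)) *: val (pb h g);
  pb_leibniz : forall U d1 d2 d3 (g1 : gfun Q B d1 U) (g2 : gfun Q B d2 U)
      (g3 : gfun Q B d3 U),
    val (pb g1 (omul g2 g3)) =
    val (omul (pb g1 g2) g3) + (-1) ^ (d1 * d2) *: val (omul g2 (pb g1 g3));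
  pb_jacobi : forall U d1 d2 d3 (g1 : gfun Q B d1 U) (g2 : gfun Q B d2 U)
      (g3 : gfun Q B d3 U),
    val (pb g1 (pb g2 g3)) =
    val (pb (pb g1 g2) g3) + (-1) ^ (d1 * d2) *: val (pb g2 (pb g1 g3))
}.

(* <R(b, b') q, q'> as an element of Gamma(wedge^2 Q^* ). *)
Definition curv_fun (R : realType) (M : manifold R) (Q B : vbundle M)
    (w : hom_form2 B Q (dual Q)) (b b' : Gamma B) : dfun (gfib Q B) :=
  fun x s _ =>
    if s is [:: q; q'] then (form_at w (b x) (b' x) q : dual Q x) q' else 0.

(* The sign of the curvature term is forced by curv_nabla0 and the Jacobi
   identity for b, b', t. *)
Definition derived_from (R : realType) (M : manifold R) (Q B : vbundle M)
    (P : poisson Q B) (D : self_dual_two_rep Q B) : Prop :=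
  let A := sd_algebroid D in
  let rep := sd_rep D in
  [/\ forall t t' : Gamma (dual Q),
        val (pb P (fun1 B t) (fun1 B t')) =
        val (fun0 Q B (pairing t' (bmap (del rep) t))),
      forall (b : Gamma B) (f : Cinf M),
        val (pb P (fun2 Q b) (fun0 Q B f)) = val (fun0 Q B (anchor (rho A) b f)),
      forall (b : Gamma B) (t : Gamma (dual Q)),
        val (pb P (fun2 Q b) (fun1 B t)) = val (fun1 B (nabla0 rep b t))
    & forall b b' : Gamma B,
        val (pb P (fun2 Q b) (fun2 Q b')) =
        val (fun2 Q (brk A b b')) -
          glob (curv_fun (curv rep) b b') ].

(* Main.v *)
(* A Poisson bracket of degree -2 is a local biderivation, so it is determined by
   its values on f, t, b in C^oo(M), Gamma(Q^* ), Gamma(B). For degree reasons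
   {f, f'} and {f, t} vanish, {t, t'} is a function, {b, f} a function, {b, t} a
   section of Q^* and {b, b'} a section of B plus a 2-form on Q; the Leibniz rule
   turns these into del, the anchor, nabla0, the bracket of B and the curvature.
   The Jacobiator is a derivation in each argument, so it vanishes as soon as it
   does on generators, where the cases (b,b,f), (b,t,t), (b,b,t) and (b,b,b) are
   exactly the equations of a self-dual 2-representation.
   Conversely, near a point x with local frames e_j of B and q_i of Q, the bracket
   has to be
     {g, h} = sum_j (dg/de_j) (rho(e_j) h) - (-1)^|g| sum_i {q^i, g} (i_(q_i) h)
              - sum_j {e_j, g} (dh/de_j),
   where rho(e_j) differentiates the coefficients of h in the frames, and where
   {t, g} and {b, g} are given by the same formula with h = g. This defines the
   bracket at x, the frames being allowed to depend on x. *)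
Require Import Defs.
From HB Require Import structures.
From mathcomp Require Import all_boot all_order all_algebra.
From mathcomp Require Import all_classical all_reals all_analysis.
From mathcomp Require Import ring lra zify.

Set Implicit Arguments.
Unset Strict Implicit.
Unset Printing Implicit Defensive.

Import Order.TTheory GRing.Theory Num.Theory.
Import numFieldNormedType.Exports.

Local Open Scope classical_set_scope.
Local Open Scope ring_scope.

(** * Bump functions, tangent vectors and local frames *)

(** Degrees add up only propositionally, so brackets of local functions live in dependent types in
    which the axioms cannot be rewritten freely. The work is therefore done with global functions,
    all elements of the one module [dfun (gfib Q B)], where having degree [d] is the property
    [lgen d]. Bump functions make every germ the germ of a global function, so the sheaf bracket is
    recovered from its global values.

    In the frame formula nothing relates the frames chosen at different points, and independence of
    the frames is never proved directly. The formula is shown, at each fixed point, to satisfy the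
    Leibniz rule in both arguments, and its values on pairs of generators turn out to be frame-free
    expressions. Smoothness, degree and skew-symmetry of the bracket then follow by induction on how
    the two arguments are generated.

    The Jacobiators of generators are computed once, for operations on sections not yet known to
    form a 2-representation, so that the computation serves both directions. *)

Section FlatFunction.
Variable R : realType.
Implicit Types (m : nat) (t : R).

(* The factor t^-m makes the family stable under differentiation. *)
Definition flat m t : R := if 0 < t then t ^- m * expR (- t^-1) else 0.

Lemma flat_le0 m t : t <= 0 -> flat m t = 0.
Proof. by rewrite /flat ltNge => ->. Qed.

Lemma flat_gt0 m t : 0 < t -> 0 < flat m t.
Proof. by move=> t0; rewrite /flat t0 mulr_gt0 ?expR_gt0 // invr_gt0 exprn_gt0. Qed.

Lemma flat_ge0 m t : 0 <= flat m t.
Proof.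
by have [t0|t0] := ltP 0 t; [exact/ltW/flat_gt0|rewrite flat_le0].
Qed.

Lemma flatS m t : flat m t = flat m.+1 t * t.
Proof.
rewrite /flat; case: ifPn => t0; last by rewrite mul0r.
by rewrite exprS invfM mulrAC [t^-1 * _]mulrC mulfVK // gt_eqF.
Qed.

(** The exponential series bounds exp(1/t) below by t^-(m+1) / (m+1)! for t > 0. The estimate
    squeezes [flat m] to 0 at the origin. *)
Lemma flat_bound m t : flat m t <= m.+1`!%:R * `|t|.
Proof.
have [t0|t0] := leP t 0; first by rewrite flat_le0 // mulr_ge0.
rewrite /flat t0 (gtr0_norm t0) expRN.
rewrite ler_pdivrMr ?expR_gt0 // -ler_pdivrMl ?mulr_gt0 ?ltr0n ?fact_gt0 //.
apply: le_trans (expR_ge1Dxn m (ltW _)); last by rewrite invr_gt0.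
rewrite invfM exprVn mulrAC -mulrA -invfM -exprSr mulrC.
by rewrite lerDr ler01.
Qed.

Lemma flat_continuous0 m : {for 0, continuous (flat m)}.
Proof.
rewrite /prop_for /continuous_at flat_le0 //.
apply: (@squeeze_cvgr _ _ _ _ (cst 0) (fun t => m.+1`!%:R * `|t|)).
- by apply: nearW => t; rewrite flat_ge0 flat_bound.
- exact: cvg_cst.
- rewrite -[X in _ --> X](mulr0 m.+1`!%:R) -[X in _ * X](@normr0 R R).
  by apply: cvgM; [exact: cvg_cst|apply: cvg_norm; exact: cvg_id].
Qed.

Lemma is_derive_flat m t :
  is_derive t 1 (flat m) (- m%:R * flat m.+1 t + flat m.+2 t).
Proof.
have [t0|t0|->] := ltgtP t 0.
- rewrite !flat_le0 ?(ltW t0) // mulr0 addr0.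
  have H : {near t, (cst 0 : R -> R) =1 flat m}.
    by near=> u; rewrite flat_le0 //; apply/ltW; near: u; exact: lt_nbhsl.
  split; first exact: near_eq_derivable H _.
  by rewrite -(near_eq_derive _ H) derive_cst.
- have H : {near t, (fun u => u ^- m * expR (- u^-1)) =1 flat m}.
    near=> u; rewrite /flat ifT //; near: u; exact: lt_nbhsr.
  have tn0 : t != 0 by rewrite gt_eqF.
  have H1 : is_derive t 1 (fun u : R => u^-1) (- t ^- 2).
    have HV := is_deriveV (f := id) tn0 (is_derive_id t (1 : R)).
    by apply: is_derive_eq HV _; rewrite /GRing.scale /= mulr1.
  have H2 : is_derive t 1 (fun u => expR (- u^-1)) (t ^- 2 * expR (- t^-1)).
    have H3 : is_derive t 1 (fun u : R => - u^-1) (t ^- 2).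
      by apply: is_derive_eq (opprK _).
    have := @is_derive1_comp _ expR (fun u : R => - u^-1) t _ _ (is_derive_expR _) H3.
    by rewrite mulrC.
  have H4 : is_derive t 1 (fun u : R => u ^- m) (- m%:R * t ^- m.+1).
    have HX : is_derive t 1 (fun u : R => u ^+ m) (m%:R * t ^+ m.-1).
      have := is_deriveX m (is_derive_id t (1 : R)).
      rewrite /= (_ : (id ^+ m)%R = fun u : R => u ^+ m); last first.
        by apply/funext => u; rewrite exprfctE.
      by move=> HX; apply: is_derive_eq HX _; rewrite /GRing.scale /= mulr1.
    have HV := is_deriveV (f := fun u : R => u ^+ m) (expf_neq0 m tn0) HX.
    apply: is_derive_eq HV _.
    rewrite /GRing.scale /=; case: m {H HX} => [|k]; first by rewrite !(mul0r,mulr0,oppr0).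
    rewrite /= mulrCA !mulNr mulrN; congr (- (_ * _)).
    have tk0 : t ^+ k != 0 by rewrite expf_neq0.
    by rewrite !exprS; field; rewrite tn0 tk0.
  have HM := is_deriveM H4 H2.
  split; first by apply: near_eq_derivable H _; case: HM.
  rewrite -(near_eq_derive _ H); case: HM => _.
  rewrite (_ : _ * _ = fun u => u ^- m * expR (- u^-1)) // => ->.
  rewrite /GRing.scale /= /flat t0.
  by rewrite -!exprVn !exprS; ring.
- rewrite !flat_le0 // mulr0 addr0.
  (* By [flatS] the difference quotient of [flat m] at 0 is [flat m.+1], which is continuous there
     with value 0. *)
  apply/is_derive1_caratheodory; exists (flat m.+1); split.
  + by move=> z; rewrite (flat_le0 _ (lexx 0)) !subr0 flatS.
  + exact: flat_continuous0.
  + exact: flat_le0.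
Unshelve. all: by end_near. Qed.

End FlatFunction.

Section MoreSmoothness.
Variables (R : realType).

(** A directional derivative is an ordinary derivative along the line e -> e v + x, which reduces
    the claim to the chain rule in one variable. *)
Lemma is_derive_comp (V : normedModType R) (h : R -> R) (f : V -> R) x v a b :
  is_derive (f x) 1 h a -> is_derive x v f b -> is_derive x v (h \o f) (a * b).
Proof.
move=> dh [df <-].
have E0 (g : V -> R) : 'D_1 (fun e : R => g (e *: v + x) : R) 0 = 'D_v g x.
  rewrite /derive; set g1 := fun e => e^-1 *: _; set g2 := fun e => e^-1 *: _.
  suff -> : g1 = g2 by [].
  by rewrite funeqE /g1 /g2 => e /=; rewrite addr0 scale0r add0r [_%:A]mulr1.
have E (g : V -> R) : derivable g x v ->
    is_derive (0 : R) 1 (fun e : R => g (e *: v + x)) ('D_v g x).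
  move=> dg; split; first exact: (derivable1P _ _ _).1.
  exact: E0.
have dh' : is_derive (f (0 *: v + x)) 1 h a by rewrite scale0r add0r.
have [H1 H2] := is_derive1_comp (g := fun e : R => f (e *: v + x)) dh' (E _ df).
split; first exact: (derivable1P _ _ _).2 H1.
by rewrite -H2 -E0.
Qed.

(** Each differentiation raises the index of [flat], so the induction on k has to keep m
    arbitrary. *)
Lemma Cr_flat n k m (U : set 'rV[R]_n) f :
  open U -> Cr k U f -> Cr k U (flat m \o f).
Proof.
move=> oU; elim: k m f => [|k IH] m f Hf; have [cf df] := Hf.
  split=> // x Ux; apply: continuous_comp; first exact: cf.
  apply/differentiable_continuous/derivable1_diffP.
  by case: (is_derive_flat m (f x)).
split=> [x Ux|i].
  apply: continuous_comp; first exact: cf.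
  apply/differentiable_continuous/derivable1_diffP.
  by case: (is_derive_flat m (f x)).
have [df1 df2] := df i.
have D x : U x -> is_derive x 'e_i (flat m \o f)
    ((- m%:R * flat m.+1 (f x) + flat m.+2 (f x)) * 'D_('e_i) f x).
  by move=> Ux; apply: is_derive_comp; [exact: is_derive_flat|exact/derivableP/df1].
split=> [x Ux|]; first by case: (D x Ux).
have F j := IH j f (CrW Hf).
have := CrM oU (CrD oU (CrM oU (Cr_cst k U (- m%:R : R)) (F m.+1)) (F m.+2)) df2.
by apply: (Cr_ext oU) => x Ux; case: (D x Ux) => _ ->.
Qed.

Lemma CrV n k (U : set 'rV[R]_n) f :
  open U -> (forall x, U x -> f x != 0) -> Cr k U f ->
  Cr k U (fun x => (f x)^-1).
Proof.
move=> oU f0; elim: k => [|k IH] Hf; have [cf df] := Hf.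
  by split=> // x Ux; apply: cvgV (cf x Ux); exact: f0.
split=> [x Ux|i]; first by apply: cvgV (cf x Ux); exact: f0.
have [df1 df2] := df i; have Hk := IH (CrW Hf).
split=> [x Ux|]; first by apply: derivableV; [exact: f0|exact: df1].
have := CrM oU (CrM oU (Cr_cst k U (-1 : R)) (CrM oU Hk Hk)) df2.
apply: (Cr_ext oU) => x Ux; rewrite deriveV; [|exact: f0|exact: df1].
by rewrite /GRing.scale /= mulN1r expr2 invfM.
Qed.

Variable M : manifold R.
Implicit Types (U V : set M) (f g : M -> R).

Lemma smoothM_flat U m f : open U -> smoothM U f -> smoothM U (flat m \o f).
Proof.
by move=> oU sf c ac k; apply: Cr_flat (sf c ac k); exact: chart_open.
Qed.

Lemma smoothMV U f : open U -> (forall x, U x -> f x != 0) -> smoothM U f ->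
  smoothM U (fun x => (f x)^-1).
Proof.
move=> oU f0 sf c ac k; apply: CrV (sf c ac k); first exact: chart_open.
by move=> y [_ Uy]; exact: f0.
Qed.

Lemma smoothMZ U a f : open U -> smoothM U f -> smoothM U (fun x => a * f x).
Proof. by move=> oU; apply: smoothMM => //; exact: smoothM_cst. Qed.

Lemma smoothMB U f g : open U -> smoothM U f -> smoothM U g ->
  smoothM U (fun x => f x - g x).
Proof.
move=> oU sf sg; apply: smoothM_ext oU _ (smoothMD oU sf (smoothMZ (-1) oU sg)).
by move=> x _; rewrite mulN1r.
Qed.

Lemma smooth_coord c j : atlas M c -> smoothM (cdom c) (fun p => cmap c p 0 j).
Proof. by move=> ac c' ac'; exact: atlas_compat. Qed.

(** C is the image of a compact box in a chart, and is closed because M is Hausdorff. Its complement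
    is then open, which makes the extension by 0 beyond the chart smooth. *)
Lemma bump_function (x : M) V : open V -> V x ->
  exists psi : Cinf M, exists C : set M,
    [/\ closed C, C `<=` V, forall y, ~ C y -> psi y = 0
      & \forall y \near x, psi y = 1].
Proof.
move=> oV Vx; have [c ac cx] := atlas_cover x.
pose n := mdim M; pose y0 : 'rV[R]_n := cmap c x.
have oO := chart_open (c := c) oV.
have Oy0 : (crange c `&` cinv c @^-1` V) y0.
  by split; [exact: cmap_range|rewrite /= cmapK].
have /nbhs_ballP[e /= e0 eO] := open_nbhs_nbhs (conj oO Oy0).
pose r := e / 2; have r0 : 0 < r by rewrite divr_gt0.
pose K : set 'rV[R]_n := [set v | forall i, `[y0 0 i - r, y0 0 i + r]%classic (v 0 i)].
have KO : K `<=` crange c `&` cinv c @^-1` V.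
  move=> v Kv; apply: eO; split=> // i j; rewrite ord1 /ball /=.
  have := Kv j; rewrite /= in_itv /= => /andP[h1 h2].
  by rewrite ltr_norml /r in h1 h2 *; apply/andP; split; lra.
have cK : compact K.
  apply: (@rV_compact _ _ (fun i => `[y0 0 i - r, y0 0 i + r]%classic)) => i.
  exact: segment_compact.
pose C := cinv c @` K.
have clC : closed C.
  apply: compact_closed; first exact: points_hausdorff.
  apply: continuous_compact cK; apply: continuous_in_subspaceT => v.
  by rewrite inE => /KO[rv _]; exact: cinv_continuous.
(* Within the chart phi is positive only inside the box. The quotient [psi0] is 0 where phi <= 0 and
   1 where phi >= r^2/2; its denominator is positive since phi and r^2/2 - phi are never both
   nonpositive. *)
pose phi (p : M) := r ^+ 2 - \sum_i (cmap c p 0 i - y0 0 i) ^+ 2.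
pose psi0 p := flat 0 (phi p) / (flat 0 (phi p) + flat 0 (r ^+ 2 / 2 - phi p)).
pose psi p := if pselect (cdom c p) then psi0 p else 0.
have psiE p : cdom c p -> psi p = psi0 p by rewrite /psi; case: pselect.
have den p : flat 0 (phi p) + flat 0 (r ^+ 2 / 2 - phi p) != 0.
  rewrite gt_eqF //; have [p0|p0] := leP (phi p) 0.
    rewrite ltr_wpDl ?flat_ge0 // flat_gt0 //.
    by rewrite subr_gt0 (le_lt_trans p0) // divr_gt0 // exprn_gt0.
  by rewrite ltr_pwDl ?flat_ge0 // flat_gt0.
have od := @cdom_open _ _ _ c.
have sphi : smoothM (cdom c) phi.
  apply: smoothMB => //; first exact: smoothM_cst.
  apply: smoothM_sum => // i.
  have s1 : smoothM (cdom c) (fun p => cmap c p 0 i - y0 0 i).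
    by apply: smoothMB => //; [exact: smooth_coord|exact: smoothM_cst].
  by apply: smoothM_ext od _ (smoothMM od s1 s1) => p _; rewrite expr2.
have spsi : smoothM (cdom c) psi.
  have s1 := smoothM_flat 0 od sphi.
  have s2 : smoothM (cdom c) (fun p => flat 0 (r ^+ 2 / 2 - phi p)).
    apply: smoothM_flat => //; apply: smoothMB => //; exact: smoothM_cst.
  have := smoothMM od s1 (smoothMV od (fun p _ => den p) (smoothMD od s1 s2)).
  by apply: smoothM_ext od _ => p cp; rewrite psiE.
have psi0C p : ~ C p -> psi p = 0.
  move=> nC; rewrite /psi; case: pselect => // cp.
  rewrite /psi0 flat_le0 ?mul0r // leNgt; apply/negP; rewrite subr_gt0 => lr.
  apply: nC; exists (cmap c p); last exact: cmapK.
  move=> i /=; rewrite in_itv /=.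
  have : (cmap c p 0 i - y0 0 i) ^+ 2 <= r ^+ 2.
    apply: le_trans (ltW lr); rewrite (bigD1 i) //= lerDl sumr_ge0 // => j _.
    exact: sqr_ge0.
  rewrite -[X in X <= _]real_normK ?num_real // ler_pXn2r ?nnegrE ?(ltW r0) // ler_norml => /andP[h1 h2].
  by apply/andP; split; lra.
have sm : psi \in @smooth_fun R M.
  apply/smooth_funP; apply: smoothM_local => p _.
  have [Cp|nCp] := pselect (C p).
    exists (cdom c); split => //; case: Cp => v /KO[rv _] <-.
    exact: cinv_dom.
  exists (~` C); split => //; first exact: closed_openC.
  apply: smoothM_ext (smoothM_cst _ 0); first exact: closed_openC.
  by move=> q /psi0C.
exists (SmoothFun sm), C; split => //.
  by move=> p [v /KO[_ Vv] <-].
have ctn : {for x, continuous (fun p : M => cmap c p)} by exact: cmap_continuous.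
(* In this ball each squared coordinate difference is at most r^2/4/(n+1), so their sum is at most
   r^2/4 and psi is 1. Dividing by n+1 rather than n covers dimension 0. *)
have : nbhs y0 (ball y0 (r / 2 / (n.+1)%:R)) by exact/nbhsx_ballx/divr_gt0/ltr0Sn/divr_gt0.
move=> /ctn /= H.
have Hc : nbhs x (cdom c) by exact: open_nbhs_nbhs.
near=> p.
have cp : cdom c p by near: p.
have : ball y0 (r / 2 / (n.+1)%:R) (cmap c p) by near: p.
rewrite [psi p]psiE // /psi0 => bp.
suff hp : r ^+ 2 / 2 - phi p <= 0.
  rewrite (flat_le0 _ hp) addr0 divff //.
  by have := den p; rewrite (flat_le0 _ hp) addr0.
rewrite /phi.
have le1 i : (cmap c p 0 i - y0 0 i) ^+ 2 <= r ^+ 2 / 4 / n.+1%:R.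
  have := bp.2 0 i; rewrite /ball /= distrC => /ltW bi.
  rewrite -[X in X <= _]real_normK ?num_real //.
  apply: le_trans (_ : (r / 2 / n.+1%:R) ^+ 2 <= _).
    by rewrite lerXn2r // nnegrE ltW // !divr_gt0.
  have N0 : n.+1%:R != 0 :> R by rewrite pnatr_eq0.
  rewrite (_ : (_ / _) ^+ 2 = r ^+ 2 / 4 / n.+1%:R * n.+1%:R^-1); last by field.
  apply: ler_piMr; first by rewrite !divr_ge0 // exprn_ge0 // ltW.
  by rewrite invf_le1 // ler1n.
have : \sum_i (cmap c p 0 i - y0 0 i) ^+ 2 <= \sum_(i < n) r ^+ 2 / 4 / n.+1%:R.
  by apply: ler_sum => i _; exact: le1.
rewrite sumr_const card_ord -[X in _ <= X]mulr_natr -mulrA => H1.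
have : n.+1%:R^-1 * n%:R <= 1 :> R.
  by rewrite ler_pdivrMl // mulr1 ler_nat.
have := exprn_gt0 2 r0; set q := _ * n%:R in H1 * => r20 q1.
have : r ^+ 2 / 4 * q <= r ^+ 2 / 4 by rewrite ler_piMr // ltW // divr_gt0.
lra.
Unshelve. all: by end_near. Qed.

End MoreSmoothness.

Lemma linear_lfun (K : fieldType) (V W : vectType K) (f : V -> W) :
  linear f -> exists h : 'Hom(V, W), h =1 f.
Proof.
move=> lf; pose F := GRing.isLinear.Build K V W _ f lf.
pose g : {linear V -> W} := HB.pack f F.
by exists (linfun g) => v; rewrite lfunE.
Qed.

Section Tangent.
Variables (R : realType) (M : manifold R).
Implicit Types (f g : Cinf M) (x : M).

Lemma Cinf_ext f g : (forall x, f x = g x) -> f = g.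
Proof. by move=> fg; apply/val_inj/funext. Qed.

Lemma Cinf1E x : (1 : Cinf M) x = 1. Proof. by []. Qed.

Section AtPoint.
Variables (x : M) (v : Cinf M -> R).
Hypothesis tv : tangent x v.

Lemma tangentD f g : v (f + g) = v f + v g.
Proof.
have := tv.1 1 f g; rewrite mul1r => <-; congr (v (_ + _)).
by apply: Cinf_ext => y /=; rewrite -[LHS]mul1r.
Qed.

Lemma tangent0 : v 0 = 0.
Proof. by apply: (addrI (v 0)); rewrite -tangentD !addr0. Qed.

Lemma tangentZ r f : v (Cinf_cst M r * f) = r * v f.
Proof. by have := tv.1 r f 0; rewrite !addr0 tangent0 addr0. Qed.

Lemma tangentN f : v (- f) = - v f.
Proof. by apply/eqP; rewrite -subr_eq0 opprK -tangentD addNr tangent0. Qed.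

Lemma tangentM f g : v (f * g) = v f * g x + f x * v g.
Proof. exact: tv.2. Qed.

Lemma tangent1 : v 1 = 0.
Proof.
have := tangentM 1 1; rewrite mulr1 Cinf1E mulr1 mul1r => /eqP.
by rewrite -subr_eq0 opprD addrA subrr sub0r oppr_eq0 => /eqP.
Qed.

Lemma tangent_cst r : v (Cinf_cst M r) = 0.
Proof. by rewrite -[Cinf_cst M r]mulr1 tangentZ tangent1 mulr0. Qed.

Lemma tangent_sum (I : Type) (s : seq I) (F : I -> Cinf M) :
  v (\sum_(i <- s) F i) = \sum_(i <- s) v (F i).
Proof.
by apply: (big_morph v) => [f g|]; [exact: tangentD|exact: tangent0].
Qed.

(** A tangent vector is a derivation of global functions. Its locality comes from a bump function
    psi with psi f = psi g: in the Leibniz rule psi is 1 at x, and the terms with v psi agree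
    because f x = g x. *)
Lemma tangent_near f g : (\forall y \near x, f y = g y) -> v f = v g.
Proof.
rewrite /prop_near1 nbhsE => -[V [oV Vx] fg].
have [psi [C [_ CV psi0 psi1]]] := bump_function oV Vx.
have E : psi * f = psi * g.
  apply: Cinf_ext => y; rewrite -[LHS]/(psi y * f y) -[RHS]/(psi y * g y).
  have [/CV/fg ->//|nC] := pselect (C y).
  by rewrite psi0 // !mul0r.
have := congr1 v E; rewrite !tangentM (nbhs_singleton psi1) !mul1r.
by rewrite (fg x Vx) => /addrI.
Qed.

End AtPoint.
End Tangent.

Lemma sec_sumE (R : realType) (M : manifold R) (E : vbundle M) (I : Type)
    (r : seq I) (F : I -> Gamma E) y :
  (\sum_(i <- r) F i) y = \sum_(i <- r) F i y.
Proof. exact: (big_morph (fun s : Gamma E => s y)). Qed.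

Lemma Cinf_sumE (R : realType) (M : manifold R) (I : Type)
    (r : seq I) (F : I -> Cinf M) y :
  (\sum_(i <- r) F i) y = \sum_(i <- r) F i y.
Proof. exact: (big_morph (fun s : Cinf M => s y)). Qed.

Section Cutoff.
Variables (R : realType) (M : manifold R) (E : vbundle M).

(** Outside [tdom t] the map [tinv t] is arbitrary, but psi vanishes there. At the edge of [tdom t]
    smoothness holds because the complement of C is open and the section is 0 on it. *)
Lemma cutoff_section t (psi : Cinf M) (C : set M) i : trivs E t ->
  closed C -> C `<=` tdom t -> (forall y, ~ C y -> psi y = 0) ->
  exists s : Gamma E, forall y, s y = psi y *: tinv t y 'e_i.
Proof.
move=> tE clC Ct psi0.
suff sm : ((fun y => psi y *: tinv t y 'e_i) : dfun (fib E)) \in smooth_sec E.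
  by exists (Sec sm).
apply/smooth_secP => t' t'E j; apply: smoothM_local => y ty.
have ot := @tdom_open _ _ _ _ t; have ot' := @tdom_open _ _ _ _ t'.
have [Cy|nCy] := pselect (C y).
  exists (tdom t `&` tdom t'); split; [exact: openI|by split=> //; exact: Ct|].
  have spsi := smoothM_sub (@subsetT _ (tdom t `&` tdom t'))
    (elimT (smooth_funP _) (Cinf_smooth psi)).
  have := smoothMM (openI ot ot') spsi (trivs_compat tE t'E i j).
  by apply: smoothM_ext (openI ot ot') _ => z _; rewrite linearZ mxE.
exists (~` C); split=> //; first exact: closed_openC.
apply: smoothM_ext (smoothM_cst _ 0); first exact: closed_openC.
by move=> z /psi0 ->; rewrite scale0r linear0 mxE.
Qed.

End Cutoff.

Section Frames.
Variables (R : realType) (M : manifold R) (E : vbundle M).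

Lemma local_frame_ex (x : M) :
  exists ee : ('I_(vrank E) -> Gamma E) * ('I_(vrank E) -> Gamma (dual E)),
  \forall y \near x, (forall v : E y, v = \sum_i (ee.2 i y v : R) *: ee.1 i y) /\
    forall i j, ee.2 i y (ee.1 j y) = (i == j)%:R.
Proof.
have [t tE tx] := trivs_cover E x.
have [psi [C [clC Ct psi0 psi1]]] := bump_function (@tdom_open _ _ _ _ t) tx.
have /choice[e eP] := fun i => cutoff_section i tE clC Ct psi0.
have tE' : trivs (dual E) (dual_triv t) by exists t.
have /choice[e' e'P] := fun i => @cutoff_section _ _ (dual E) _ _ _ i tE' clC Ct psi0.
exists (e, e') => /=.
have Hc : nbhs x (tdom t) by apply: open_nbhs_nbhs; split => //; exact: tdom_open.
near=> y.
have p1 : psi y = 1 by near: y.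
have ty : tdom t y by near: y.
have e'E i v : e' i y v = tmap t y v 0 i.
  rewrite e'P p1 scale1r /= !lfunE /= /of_coords (bigD1 i) //=.
  by rewrite mxE !eqxx mul1r big1 ?addr0 // => k ki; rewrite mxE eqxx (negbTE ki) mul0r.
split=> [v|i j].
  rewrite -[LHS](tmapK ty) [X in tinv t y X]row_sum_delta linear_sum.
  by apply: eq_bigr => i _; rewrite linearZ e'E eP p1 scale1r.
rewrite e'E eP p1 scale1r tinvK // mxE eqxx /=.
by rewrite eq_sym.
Unshelve. all: by end_near. Qed.

(* Global sections that form a frame, and its dual, only near x. *)
Definition frame x := (projT1 (cid (local_frame_ex x))).1.
Definition coframe x := (projT1 (cid (local_frame_ex x))).2.

Lemma frame_near x : \forall y \near x,
  (forall v : E y, v = \sum_i (coframe x i y v : R) *: frame x i y) /\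
  forall i j, coframe x i y (frame x j y) = (i == j)%:R.
Proof. exact: (projT2 (cid (local_frame_ex x))). Qed.

Lemma frame_expand x (v : E x) : v = \sum_i (coframe x i x v : R) *: frame x i x.
Proof. exact: (nbhs_singleton (frame_near x)).1. Qed.

Lemma coframe_expand_of y (e : 'I_(vrank E) -> E y) (e' : 'I_(vrank E) -> dual E y) :
  (forall v : E y, v = \sum_i (e' i v : R) *: e i) ->
  forall a : dual E y, a = \sum_i (a (e i) : R) *: e' i.
Proof.
move=> H a; apply/lfunP => v; rewrite {1}(H v) linear_sum sum_lfunE.
by apply: eq_bigr => i _; rewrite linearZ scale_lfunE /GRing.scale /= mulrC.
Qed.

Lemma coframe_expand x (a : dual E x) : a = \sum_i (a (frame x i x) : R) *: coframe x i x.
Proof. by apply: coframe_expand_of => v; exact: frame_expand. Qed.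

Lemma section_near x (s : Gamma E) : \forall y \near x,
  s y = (\sum_i pairing (coframe x i) s *: frame x i) y.
Proof. by apply: filterS (frame_near x) => y [H _]; rewrite sec_sumE. Qed.

Lemma cosection_near x (a : Gamma (dual E)) : \forall y \near x,
  a y = (\sum_i pairing a (frame x i) *: coframe x i) y.
Proof.
apply: filterS (frame_near x) => y [H _]; rewrite sec_sumE.
exact: coframe_expand_of.
Qed.

(** The constant coefficients make the extension linear in v over constants, so that operators on
    sections induce linear maps of fibres. *)
Definition extend x (v : E x) : Gamma E :=
  \sum_i Cinf_cst M (coframe x i x v) *: frame x i.

Lemma extend_at x (v : E x) : extend v x = v.
Proof. by rewrite sec_sumE -frame_expand. Qed.

Lemma extendP x a (u v : E x) :
  extend (a *: u + v) = Cinf_cst M a *: extend u + extend v.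
Proof.
rewrite /extend scaler_sumr -big_split /=; apply: eq_bigr => i _.
rewrite scalerA -scalerDl; congr (_ *: _); apply: Cinf_ext => y.
by rewrite -[LHS]/(coframe x i x (a *: u + v)) linearP.
Qed.

(** Multiplication by a bump function makes the two sections equal everywhere and does not change F,
    since the bump function is 1 at x. *)
Lemma section_locality (W : lmodType R) x (F : Gamma E -> W) (s s' : Gamma E) :
  (forall u v, F (u + v) = F u + F v) -> (forall f u, F (f *: u) = f x *: F u) ->
  (\forall y \near x, s y = s' y) -> F s = F s'.
Proof.
move=> FD FZ; rewrite /prop_near1 nbhsE => -[V [oV Vx] ss].
have [psi [C [_ CV psi0 psi1]]] := bump_function oV Vx.
have E0 : psi *: s = psi *: s'.
  apply: sec_ext => y; rewrite -[LHS]/(psi y *: s y) -[RHS]/(psi y *: s' y).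
  have [/CV/ss ->//|nC] := pselect (C y).
  by rewrite psi0 // !scale0r.
by have := congr1 F E0; rewrite !FZ (nbhs_singleton psi1) !scale1r.
Qed.

Lemma tensorial_sum (W : lmodType R) x (F : Gamma E -> W) n (f : 'I_n -> Cinf M)
    (e : 'I_n -> Gamma E) (s : Gamma E) :
  (forall u v, F (u + v) = F u + F v) -> (forall f u, F (f *: u) = f x *: F u) ->
  (\forall y \near x, s y = (\sum_i f i *: e i) y) ->
  F s = \sum_i f i x *: F (e i).
Proof.
move=> FD FZ se.
have F0 : F 0 = 0 by rewrite -(scale0r s) FZ scale0r.
rewrite (section_locality FD FZ se) (big_morph F FD F0).
by apply: eq_bigr => i _; rewrite FZ.
Qed.

(** Near x a section is a combination of the frame, and F sees only the values at x of its
    coefficients. *)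
Lemma tensoriality (W : lmodType R) x (F : Gamma E -> W) (s s' : Gamma E) :
  (forall u v, F (u + v) = F u + F v) -> (forall f u, F (f *: u) = f x *: F u) ->
  s x = s' x -> F s = F s'.
Proof.
move=> FD FZ ss; rewrite (tensorial_sum FD FZ (section_near x s)).
rewrite (tensorial_sum FD FZ (section_near x s')); apply: eq_bigr => i _.
by rewrite -[pairing _ s x]/(coframe x i x (s x)) ss.
Qed.

End Frames.

Arguments frame {R M} E x i.
Arguments coframe {R M} E x i.

(** * The algebra of functions *)

Section ShuffleAlgebra.
Variables (R : realType) (V W : Type).
Local Notation F := (seq V -> W -> R^o).
Implicit Types (w h k : F) (b c : bool).

(** The parity involution: it carries the sign that contraction picks up when it passes a factor. *)
Definition flip w : F := fun s z => (-1) ^+ size s * w s z.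
Definition contraction v w : F := fun s => w (v :: s).
Definition scalar_form (r : R) : F := fun s _ => if s is [::] then r else 0.

Lemma wedge_cons w h v s z : wedge w h (v :: s) z =
  wedge (contraction v w) h s z + wedge (flip w) (contraction v h) s z.
Proof. by []. Qed.

Lemma flipP a w h : flip (a *: w + h) = a *: flip w + flip h.
Proof. by apply/funext => s; apply/funext => z; rewrite /flip mulrDr mulrCA. Qed.

Lemma flipK w : flip (flip w) = w.
Proof.
by apply/funext => s; apply/funext => z; rewrite /flip mulrA -expr2 sqrr_sign mul1r.
Qed.

Lemma contraction_flip v w : contraction v (flip w) = - flip (contraction v w).
Proof.
by apply/funext => s; apply/funext => z; rewrite /contraction /flip /= exprS mulN1r mulNr.
Qed.

Lemma wedgePl a w w' h : wedge (a *: w + w') h = a *: wedge w h + wedge w' h :> F.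
Proof.
suff H s z : forall w w' h, wedge (a *: w + w' : F) h s z = a * wedge w h s z + wedge w' h s z.
  by apply/funext => s; apply/funext => z; exact: H.
elim: s => [|v s IH] {}w {}w' {}h /=; first by rewrite mulrDl -mulrA.
rewrite -!/(contraction v _) -!/(flip _) flipP !IH mulrDr -!addrA; congr (_ + _).
by rewrite addrCA.
Qed.

Lemma wedgePr a w h h' : wedge w (a *: h + h') = a *: wedge w h + wedge w h' :> F.
Proof.
suff H s z : forall w h h', wedge w (a *: h + h' : F) s z = a * wedge w h s z + wedge w h' s z.
  by apply/funext => s; apply/funext => z; exact: H.
elim: s => [|v s IH] {}w {}h {}h' /=; first by rewrite mulrDr mulrCA.
rewrite -!/(contraction v _) -!/(flip _) !IH mulrDr -!addrA; congr (_ + _).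
by rewrite addrCA.
Qed.

Lemma wedge_0l h : wedge (0 : F) h = 0 :> F.
Proof. by apply/funext => s; apply/funext => z; exact: wedge0l. Qed.

Lemma wedge_0r h : wedge h (0 : F) = 0 :> F.
Proof. by apply/funext => s; apply/funext => z; exact: wedge0r. Qed.

Lemma wedgeDl w w' h : wedge (w + w') h = wedge w h + wedge w' h :> F.
Proof. by have := wedgePl 1 w w' h; rewrite !scale1r. Qed.

Lemma wedgeDr w h h' : wedge w (h + h') = wedge w h + wedge w h' :> F.
Proof. by have := wedgePr 1 w h h'; rewrite !scale1r. Qed.

Lemma wedgeZl a w h : wedge (a *: w) h = a *: wedge w h :> F.
Proof. by have := wedgePl a w 0 h; rewrite !addr0 wedge_0l addr0. Qed.

Lemma wedgeZr a w h : wedge w (a *: h) = a *: wedge w h :> F.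
Proof. by have := wedgePr a w h 0; rewrite !addr0 wedge_0r addr0. Qed.

Lemma wedgeNl w h : wedge (- w) h = - wedge w h :> F.
Proof. by rewrite -scaleN1r wedgeZl scaleN1r. Qed.

Lemma wedgeNr w h : wedge w (- h) = - wedge w h :> F.
Proof. by rewrite -scaleN1r wedgeZr scaleN1r. Qed.

Lemma wedge_suml (I : Type) (r : seq I) (f : I -> F) h :
  wedge (\sum_(i <- r) f i) h = \sum_(i <- r) wedge (f i) h :> F.
Proof.
apply: (big_morph (fun w : F => wedge w h : F)); last exact: wedge_0l.
by move=> w w'; exact: wedgeDl.
Qed.

Lemma wedge_sumr (I : Type) (r : seq I) (f : I -> F) h :
  wedge h (\sum_(i <- r) f i) = \sum_(i <- r) wedge h (f i) :> F.
Proof.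
apply: (big_morph (fun w : F => wedge h w : F)); last exact: wedge_0r.
by move=> w w'; exact: wedgeDr.
Qed.

Lemma flip_wedge w h : flip (wedge w h) = wedge (flip w) (flip h).
Proof.
suff H s z : forall w h, (-1) ^+ size s * wedge w h s z = wedge (flip w) (flip h) s z.
  by apply/funext => s; apply/funext => z; exact: H.
elim: s => [|v s IH] {}w {}h; first by rewrite /= /flip /= !mul1r.
rewrite !wedge_cons !contraction_flip wedgeNl wedgeNr flipK.
rewrite [size _]/= exprS mulN1r mulNr mulrDr !IH flipK opprD.
by congr (_ + _).
Qed.

(** Contraction is an odd derivation of both sides, so both obey the same recursion on the list of
    vectors; [flip_wedge] matches the sign of the last term. *)
Lemma wedgeA w h k : wedge w (wedge h k) = wedge (wedge w h) k :> F.
Proof.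
suff H s z : forall w h k, wedge w (wedge h k) s z = wedge (wedge w h) k s z.
  by apply/funext => s; apply/funext => z; exact: H.
elim: s => [|v s IH] {}w {}h {}k; first by rewrite /= mulrA.
rewrite !wedge_cons.
have -> : contraction v (wedge w h) =
  (wedge (contraction v w) h : F) + wedge (flip w) (contraction v h) by [].
have -> : contraction v (wedge h k) =
  (wedge (contraction v h) k : F) + wedge (flip h) (contraction v k) by [].
rewrite wedgeDl wedgeDr flip_wedge.
rewrite [X in _ + X]/(wedge (flip w) (wedge (contraction v h) k) s z +
  wedge (flip w) (wedge (flip h) (contraction v k)) s z).
by rewrite !IH addrA.
Qed.

(* Only the parity of the form degree: it coincides with that of the total degree,
   sections of B being even. *)
Definition homog b w := flip w = (-1) ^+ b *: w.

Lemma homog_contraction b v w : homog b w -> homog (~~ b) (contraction v w).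
Proof.
move=> hw; have := congr1 (contraction v) hw; rewrite contraction_flip => /eqP.
rewrite eqr_oppLR => /eqP; rewrite /homog => ->.
by rewrite -[contraction v _]/((-1) ^+ b *: contraction v w) -scaleNr signrN.
Qed.

Lemma homog0 b : homog b 0.
Proof.
rewrite /homog scaler0; apply/funext => s; apply/funext => z; exact: mulr0.
Qed.

Lemma homogP b a w h : homog b w -> homog b h -> homog b (a *: w + h).
Proof. by rewrite /homog flipP => -> ->; rewrite scalerDr !scalerA mulrC. Qed.

Lemma homogD b w h : homog b w -> homog b h -> homog b (w + h).
Proof. by move=> hw /(homogP 1 hw); rewrite scale1r. Qed.

Lemma homogZ b a w : homog b w -> homog b (a *: w).
Proof. by move=> /homogP/(_ (homog0 _)) => /(_ a); rewrite addr0. Qed.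

Lemma homogN b w : homog b w -> homog b (- w).
Proof. by rewrite -scaleN1r; exact: homogZ. Qed.

Lemma homog_wedge b c w h : homog b w -> homog c h -> homog (b (+) c) (wedge w h).
Proof.
rewrite /homog flip_wedge => -> ->.
by rewrite wedgeZl wedgeZr scalerA signr_addb.
Qed.

Lemma homog_scalar r : homog false (scalar_form r).
Proof.
rewrite /homog scale1r; apply/funext => s; apply/funext => z.
by rewrite /flip; case: s => [|v s]; rewrite ?mul1r ?mulr0.
Qed.

Lemma wedge_scalarl r h : wedge (scalar_form r) h = r *: h :> F.
Proof.
suff H s z : forall h, wedge (scalar_form r) h s z = r * h s z.
  by apply/funext => s; apply/funext => z; exact: H.
elim: s => [//|v s IH] {}h; rewrite wedge_cons [contraction v _](_ : _ = 0) // wedge0l add0r.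
by rewrite homog_scalar scale1r IH.
Qed.

Lemma wedge_scalarr r h : wedge h (scalar_form r) = r *: h :> F.
Proof.
suff H s z : forall h, wedge h (scalar_form r) s z = r * h s z.
  by apply/funext => s; apply/funext => z; exact: H.
elim: s => [|v s IH] {}h; first by rewrite /= mulrC.
rewrite wedge_cons [X in wedge (flip h) X](_ : _ = 0) // wedge0r addr0.
by rewrite IH.
Qed.

Lemma wedgeC b c w h : homog b w -> homog c h ->
  wedge w h = (-1) ^+ (b && c) *: wedge h w :> F.
Proof.
suff H s z : forall b c w h, homog b w -> homog c h ->
    wedge w h s z = (-1) ^+ (b && c) * wedge h w s z.
  by move=> hw hh; apply/funext => s; apply/funext => z; exact: H.
elim: s => [|v s IH] {}b {}c {}w {}h hw hh.
  rewrite /= mulrC; case: b c hw {hh} => [] [] hw /=; rewrite ?mul1r //.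
  (* Two odd factors remain. An odd w satisfies w [::] = - w [::], so it has no scalar part and both
     sides are 0. *)
  have := congr1 (fun w => w [::] z) hw; rewrite /flip /= mul1r.
  rewrite [RHS](_ : _ = - w [::] z) ?expr1; last by rewrite [LHS]mulN1r.
  by move=> /eqP; rewrite -addr_eq0 -mulr2n mulrn_eq0 /= => /eqP ->; rewrite !(mulr0, mul0r).
rewrite !wedge_cons hw hh !wedgeZl.
rewrite (IH _ _ _ _ (homog_contraction v hw) hh).
rewrite (_ : (_ *: (wedge w _ : F)) s z = (-1) ^+ b * wedge w (contraction v h) s z) //.
rewrite (_ : (_ *: (wedge h _ : F)) s z = (-1) ^+ c * wedge h (contraction v w) s z) //.
rewrite (IH _ _ _ _ hw (homog_contraction v hh)).
by case: b c {hw hh} => [] [] /=; rewrite ?(expr0, expr1, mul1r, mulN1r, opprD, opprK) 1?addrC.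
Qed.

Lemma wedge_mapl (V' W' : Type) (f : V' -> V) (g : W' -> W) w h s z :
  wedge w h (map f s) (g z) =
  wedge (fun s z => w (map f s) (g z)) (fun s z => h (map f s) (g z)) s z.
Proof.
elim: s w h => [//|v s IH] w h; rewrite /= !IH; congr (_ + _).
by congr (wedge _ _ _ _); apply/funext => l; apply/funext => y; rewrite size_map.
Qed.

Section Derivation.
Variables (Y : Type) (y0 : Y) (S : (Y -> R) -> Prop) (D : (Y -> R) -> R).
Hypothesis S_add : forall f g, S f -> S g -> S (fun y => f y + g y).
Hypothesis S_mul : forall f g, S f -> S g -> S (fun y => f y * g y).
Hypothesis S_scale : forall a f, S f -> S (fun y => a * f y).
Hypothesis D_add : forall f g, S f -> S g ->
  D (fun y => f y + g y) = D f + D g.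
Hypothesis D_mul : forall f g, S f -> S g ->
  D (fun y => f y * g y) = D f * g y0 + f y0 * D g.
Hypothesis D_scale : forall a f, S f -> D (fun y => a * f y) = a * D f.

Lemma wedge_derivation (w h : Y -> F) s z :
  (forall s, S (fun y => w y s z)) -> (forall s, S (fun y => h y s z)) ->
  S (fun y => wedge (w y) (h y) s z) /\
  D (fun y => wedge (w y) (h y) s z) =
    wedge (fun s z => D (fun y => w y s z)) (h y0) s z +
    wedge (w y0) (fun s z => D (fun y => h y s z)) s z.
Proof.
elim: s w h => [|v s IH] w h Sw Sh.
  by split; [exact: S_mul|exact: D_mul].
have Sf : forall s, S (fun y => flip (w y) s z) by move=> l; exact: S_scale.
have [S1 D1] := IH (fun y => contraction v (w y)) h (fun s => Sw (v :: s)) Sh.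
have [S2 D2] := IH (fun y => flip (w y)) (fun y => contraction v (h y)) Sf (fun s => Sh (v :: s)).
split; first exact: S_add.
rewrite [LHS]D_add // D1 D2 !wedge_cons.
have E1 : (fun s z => D (fun y => w y (v :: s) z)) =
  contraction v (fun s z => D (fun y => w y s z)) by [].
rewrite E1 addrACA; congr (_ + _); congr (_ + _).
suff E2 s' : D (fun y => flip (w y) s' z) = flip (fun s z => D (fun y => w y s z)) s' z.
  (* The identity for [flip] is available only at the fixed z, and a product at z involves only
     values at z. *)
  have H s' k' w1 w2 : (forall s, w1 s z = w2 s z) -> wedge w1 k' s' z = wedge w2 k' s' z.
    elim: s' w1 w2 k' => [|u s' IHs] w1 w2 k' ww; first by rewrite /= ww.
    rewrite !wedge_cons; congr (_ + _); apply: IHs => l; first exact: ww.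
    by rewrite /flip ww.
  exact: H.
exact: D_scale.
Qed.

End Derivation.
End ShuffleAlgebra.

Definition odz (d : int) : bool := odd `|d|%N.

(** With signs reduced to booleans, the sign identities below become finite case analyses closed by
    [ring]. *)
Lemma signz (R : realType) (d : int) : (-1) ^ d = (-1) ^+ odz d :> R.
Proof.
case: d => n; first by rewrite -exprnP /odz /= signr_odd.
by rewrite -[LHS]/((-1) ^- n.+1) invr_sign -[RHS]/((-1) ^+ odd n.+1) signr_odd.
Qed.

Lemma odzD (d e : int) : odz (d + e) = odz d (+) odz e.
Proof. rewrite /odz; lia. Qed.

Lemma odzB (d e : int) : odz (d - e) = odz d (+) odz e.
Proof. rewrite /odz; lia. Qed.

Lemma odzM (d e : int) : odz (d * e) = odz d && odz e.
Proof. by rewrite /odz abszM oddM. Qed.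

Arguments deg0 {R M} Q B f.
Arguments deg1 {R M Q} B t.
Arguments deg2 {R M} Q {B} b.
Arguments curv_fun {R M Q B} w b b'.

(** * Graded functions: the degree as a property *)

Section GradedFunctions.
Variables (R : realType) (M : manifold R) (Q B : vbundle M).
Local Notation G := (dfun (gfib Q B)).
Implicit Types (g h k : G) (d e : int) (x : M).

Lemma gfun_ext g h : (forall x, g x = h x) -> g = h.
Proof. exact: functional_extensionality_dep. Qed.

Definition mulg g h : G := fun x => wedge (g x) (h x).
Arguments mulg : clear implicits.
Local Infix "**" := mulg (at level 40).

Lemma mulgA g h k : g ** (h ** k) = (g ** h) ** k.
Proof. by apply: gfun_ext => x; exact: wedgeA. Qed.
Lemma mulgDl g h k : (g + h) ** k = g ** k + h ** k.
Proof. by apply: gfun_ext => x; exact: wedgeDl. Qed.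
Lemma mulgDr g h k : g ** (h + k) = g ** h + g ** k.
Proof. by apply: gfun_ext => x; exact: wedgeDr. Qed.
Lemma mulgZl a g h : (a *: g) ** h = a *: (g ** h).
Proof. by apply: gfun_ext => x; exact: wedgeZl. Qed.
Lemma mulgZr a g h : g ** (a *: h) = a *: (g ** h).
Proof. by apply: gfun_ext => x; exact: wedgeZr. Qed.
Lemma mulg0r g : g ** 0 = 0.
Proof. by apply: gfun_ext => x; exact: wedge_0r. Qed.
Lemma mulg0l g : 0 ** g = 0.
Proof. by apply: gfun_ext => x; exact: wedge_0l. Qed.
Lemma mulgNl g h : (- g) ** h = - (g ** h).
Proof. by rewrite -scaleN1r mulgZl scaleN1r. Qed.
Lemma mulgNr g h : g ** (- h) = - (g ** h).
Proof. by rewrite -scaleN1r mulgZr scaleN1r. Qed.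

Lemma deg0_mul f g : deg0 Q B f ** g = (fun x => f x *: g x).
Proof.
apply: gfun_ext => x; rewrite /mulg.
exact: (wedge_scalarl (f x) (g x)).
Qed.

Lemma mul_deg0 f g : g ** deg0 Q B f = (fun x => f x *: g x).
Proof.
apply: gfun_ext => x; rewrite /mulg.
exact: (wedge_scalarr (f x) (g x)).
Qed.

Lemma deg0D f f' : deg0 Q B (f + f') = deg0 Q B f + deg0 Q B f'.
Proof.
apply: gfun_ext => x; apply/funext => s; apply/funext => z.
by case: s => [|q s] //; rewrite -[RHS]/(0 + 0) addr0.
Qed.

Lemma deg1D t t' : deg1 B (t + t') = deg1 B t + deg1 B t' :> dfun (gfib Q B).
Proof.
apply: gfun_ext => x; apply/funext => s; apply/funext => z.
case: s => [|q [|q' s]]; rewrite -?[RHS]/(0 + 0) ?addr0 //=.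
by rewrite -[LHS]/((t x + t' x) q) add_lfunE.
Qed.

Lemma deg0_0 : deg0 Q B 0 = 0.
Proof. by apply: (addrI (deg0 Q B 0)); rewrite -deg0D !addr0. Qed.

Lemma deg1_0 : deg1 B 0 = 0 :> dfun (gfib Q B).
Proof. by apply: (addrI (deg1 B 0 : dfun (gfib Q B))); rewrite -deg1D !addr0. Qed.

Lemma deg0N f : deg0 Q B (- f) = - deg0 Q B f.
Proof. by apply/eqP; rewrite -addr_eq0 -deg0D addNr deg0_0. Qed.

Lemma deg1N t : deg1 B (- t) = - deg1 B t :> dfun (gfib Q B).
Proof. by apply/eqP; rewrite -addr_eq0 -deg1D addNr deg1_0. Qed.

Lemma deg2D b b' : deg2 Q (b + b') = deg2 Q b + deg2 Q b' :> dfun (gfib Q B).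
Proof.
apply: gfun_ext => x; apply/funext => s; apply/funext => z.
case: s => [|q s]; rewrite -?[RHS]/(0 + 0) ?addr0 //=.
by rewrite -[LHS]/(z (b x + b' x)) linearD.
Qed.

Lemma deg0M f f' : deg0 Q B f ** deg0 Q B f' = deg0 Q B (f * f').
Proof.
rewrite deg0_mul; apply: gfun_ext => x; apply/funext => s; apply/funext => z.
by case: s => //= *; exact: mulr0.
Qed.

Lemma deg1Z f t : deg0 Q B f ** deg1 B t = deg1 B (f *: t).
Proof.
rewrite deg0_mul; apply: gfun_ext => x; apply/funext => s; apply/funext => z.
case: s => [|q [|q' s]] //=; rewrite ?[LHS]mulr0 //.
by rewrite -[RHS]/((f x *: t x) q) scale_lfunE.
Qed.

Lemma deg2Z f b : deg0 Q B f ** deg2 Q b = deg2 Q (f *: b).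
Proof.
rewrite deg0_mul; apply: gfun_ext => x; apply/funext => s; apply/funext => z.
case: s => [|q s] //=; rewrite ?[LHS]mulr0 //.
by rewrite -[RHS]/(z (f x *: b x)) linearZ.
Qed.

Lemma mul_deg0C f g : g ** deg0 Q B f = deg0 Q B f ** g.
Proof. by rewrite deg0_mul mul_deg0. Qed.

Lemma scale_deg0 a g : a *: g = deg0 Q B (Cinf_cst M a) ** g.
Proof. by rewrite deg0_mul. Qed.

Definition genz d g := if d is Posz n then generated n g else g = 0.

Lemma genz0 d : genz d 0.
Proof. by case: d => // n; exact: gen_zero. Qed.

Lemma genzP d a g h : genz d g -> genz d h -> genz d (a *: g + h).
Proof.
by case: d => [n|n] /=; [exact: gen_comb|move=> -> ->; rewrite scaler0 addr0].
Qed.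

Lemma genzM d e g h : genz d g -> genz e h -> genz (d + e) (g ** h).
Proof.
case: d => [m|m]; last by move=> -> _; rewrite mulg0l; exact: genz0.
case: e => [n|n]; last by move=> _ ->; rewrite mulg0r; exact: genz0.
exact: gen_mul.
Qed.

Lemma generated_homog n g x : generated n g -> homog (odd n) (g x).
Proof.
elim=> {n g} [f|t|b|n|n a g h _ IHg _ IHh|m n g h _ IHg _ IHh].
- exact: homog_scalar.
- rewrite /homog /=; apply/funext => s; apply/funext => z.
  by rewrite /flip; case: s => [|q [|q' s]] //=; rewrite ?mulr0 ?[RHS]mulr0.
- rewrite /homog /=; apply/funext => s; apply/funext => z.
  by rewrite /flip; case: s => [|q s] //=; rewrite ?mulr0 ?[RHS]mulr0.
- exact: homog0.
- exact: homogP.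
- by rewrite oddD; exact: homog_wedge.
Qed.

(** The sheaf condition at x for an element of G. Required at every x, it says that g is a global
    function of degree d on the [2]-manifold. *)
Definition locgen x d g := exists2 h, genz d h & \forall y \near x, g y = h y.
Definition lgen d g := forall x, locgen x d g.

Lemma locgen_near x d g : locgen x d g -> \forall y \near x, locgen y d g.
Proof.
by move=> [h dh /near_join gh]; apply: filterS gh => y gh; exists h.
Qed.

Lemma locgen_eq x d g h : (\forall y \near x, g y = h y) ->
  locgen x d g -> locgen x d h.
Proof.
move=> gh [k dk gk]; exists k => //.
by apply: filterS2 gh gk => y <- ->.
Qed.

Lemma genz_lgen d g : genz d g -> lgen d g.
Proof. by move=> dg x; exists g => //; exact: nearW. Qed.

Lemma locgen0 x d : locgen x d 0.
Proof. exact/genz_lgen/genz0. Qed.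

Lemma locgenP x d a g h : locgen x d g -> locgen x d h -> locgen x d (a *: g + h).
Proof.
move=> [g' dg gg] [h' dh hh]; exists (a *: g' + h'); first exact: genzP.
apply: filterS2 gg hh => y gg hh.
by rewrite -[LHS]/(a *: g y + h y) -[RHS]/(a *: g' y + h' y) gg hh.
Qed.

Lemma locgenD x d g h : locgen x d g -> locgen x d h -> locgen x d (g + h).
Proof. by move=> dg dh; rewrite -[g]scale1r; exact: locgenP. Qed.

Lemma locgenZ x d a g : locgen x d g -> locgen x d (a *: g).
Proof.
by move=> dg; rewrite -[_ *: _]addr0; apply: locgenP => //; exact: locgen0.
Qed.

Lemma locgenN x d g : locgen x d g -> locgen x d (- g).
Proof. by rewrite -scaleN1r; exact: locgenZ. Qed.

Lemma locgenB x d g h : locgen x d g -> locgen x d h -> locgen x d (g - h).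
Proof. by move=> dg /locgenN; exact: locgenD. Qed.

Lemma locgenM x d e g h :
  locgen x d g -> locgen x e h -> locgen x (d + e) (g ** h).
Proof.
move=> [g' dg gg] [h' dh hh]; exists (g' ** h'); first exact: genzM.
by apply: filterS2 gg hh => y gg hh; rewrite /mulg gg hh.
Qed.

Lemma locgen_neg x n g : locgen x (Negz n) g -> g x = 0.
Proof. by move=> [h -> /nbhs_singleton ->]. Qed.

Lemma locgen_homog x d g : locgen x d g -> homog (odz d) (g x).
Proof.
move=> [h dh /nbhs_singleton ->]; case: d dh => [n|n] /=.
  exact: generated_homog.
by move=> ->; exact: homog0.
Qed.

(** Degrees are natural numbers, so the factors of a product of degree at most 2 have degree at most
    2 themselves. Besides products with functions on M, the only new products are those of two
    sections of the dual of Q. *)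
Lemma generated_low n g : generated n g ->
  match n with
  | 0 => exists f, g = deg0 Q B f
  | 1 => exists t, g = deg1 B t
  | 2 => exists b (l : seq (Gamma (dual Q) * Gamma (dual Q))),
      g = deg2 Q b + \sum_(p <- l) deg1 B p.1 ** deg1 B p.2
  | _ => True
  end.
Proof.
have z1 : deg1 B 0 = 0 :> G.
  by apply: (addrI (deg1 B 0)); rewrite -deg1D !addr0.
have z2 : deg2 Q 0 = 0 :> G.
  by apply: (addrI (deg2 Q 0)); rewrite -deg2D !addr0.
have mul02 f k : (exists b (l : seq (Gamma (dual Q) * Gamma (dual Q))),
      k = deg2 Q b + \sum_(p <- l) deg1 B p.1 ** deg1 B p.2) ->
   exists b (l : seq (Gamma (dual Q) * Gamma (dual Q))),
      deg0 Q B f ** k = deg2 Q b + \sum_(p <- l) deg1 B p.1 ** deg1 B p.2.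
  move=> [b [l ->]]; exists (f *: b), [seq (f *: p.1, p.2) | p <- l].
  rewrite mulgDr deg2Z big_map; congr (_ + _).
  rewrite (big_morph (mulg (deg0 Q B f)) (mulgDr _) (mulg0r _)).
  by apply: eq_bigr => p _; rewrite mulgA deg1Z.
move=> gn; elim: n g / gn => [f|t|b|n|n a g1 h _ IHg _ IHh|m n g1 h _ IHg _ IHh].
- by exists f.
- by exists t.
- by exists b, [::]; rewrite big_nil addr0.
- case: n => [|[|[|n]]] //.
  + by exists 0; apply: (addrI (deg0 Q B 0)); rewrite -deg0D !addr0.
  + by exists 0.
  + by exists 0, [::]; rewrite big_nil z2 addr0.
- case: n IHg IHh => [|[|[|n]]] //.
  + move=> [f ->] [f' ->]; exists (Cinf_cst M a * f + f').
    by rewrite deg0D -deg0M scale_deg0.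
  + move=> [t ->] [t' ->]; exists (Cinf_cst M a *: t + t').
    by rewrite deg1D -deg1Z scale_deg0.
  + move=> IHg [b' [l' ->]]; rewrite scale_deg0.
    have [b [l ->]] := mul02 (Cinf_cst M a) _ IHg.
    by exists (b + b'), (l ++ l'); rewrite deg2D big_cat /= addrACA.
- rewrite -/(g1 ** h).
  case: m n IHg IHh => [|[|[|m]]] [|[|[|n]]] //=.
  + by move=> [f ->] [f' ->]; exists (f * f'); rewrite deg0M.
  + by move=> [f ->] [t ->]; exists (f *: t); rewrite deg1Z.
  + by move=> [f ->]; exact: mul02.
  + by move=> [t ->] [f ->]; exists (f *: t); rewrite mul_deg0C deg1Z.
  + move=> [t ->] [t' ->]; exists 0, [:: (t, t')].
    by rewrite big_seq1 z2 add0r.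
  + by move=> + [f ->]; rewrite mul_deg0C; exact: mul02.
Qed.

End GradedFunctions.
Arguments mulg {R M Q B} g h.
Arguments genz {R M Q B} d g.
Arguments locgen {R M Q B} x d g.
Arguments lgen {R M Q B} d g.

Section Brackets.
Variables (R : realType) (M : manifold R) (Q B : vbundle M).
Local Notation G := (dfun (gfib Q B)).
Local Infix "**" := mulg (at level 40).
Implicit Types (g h k : G) (d e : int) (x : M).

Lemma gfun_addE g h x s z : (g + h) x s z = g x s z + h x s z. Proof. by []. Qed.
Lemma gfun_oppE g x s z : (- g) x s z = - g x s z. Proof. by []. Qed.
Lemma gfun_scaleE a g x s z : (a *: g) x s z = a * g x s z. Proof. by []. Qed.
Lemma gfun_zeroE x s z : (0 : G) x s z = 0. Proof. by []. Qed.
Definition gfunE := (gfun_addE, gfun_oppE, gfun_scaleE, gfun_zeroE).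
Lemma gfun_ext3 g h : (forall x s z, g x s z = h x s z) -> g = h.
Proof.
by move=> gh; apply: gfun_ext => x; apply/funext => s; apply/funext => z.
Qed.

(** The vanishing principle behind uniqueness, skew-symmetry and the Jacobi identity. Locality
    replaces g near each point by a generated function; induction on its generation then reduces to
    generators. *)
Lemma lgen_ind (T : int -> G -> G) :
  (forall d g h x, lgen d g -> lgen d h -> (\forall y \near x, g y = h y) ->
    (T d g : G) x = (T d h : G) x) ->
  (forall d a g h, lgen d g -> lgen d h -> T d (a *: g + h) = a *: T d g + T d h) ->
  (forall d e g h, lgen d g -> lgen e h -> T d g = 0 -> T e h = 0 ->
    T (d + e) (g ** h) = 0) ->
  (forall f, T 0 (deg0 Q B f) = 0) -> (forall t, T 1 (deg1 B t) = 0) ->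
  (forall b, T 2 (deg2 Q b) = 0) ->
  forall d g, lgen d g -> T d g = 0.
Proof.
move=> Tloc Tlin Tmul T0 T1 T2 d g dg; apply: gfun_ext => x.
have Tz e : T e 0 = 0.
  have l0 : lgen e (0 : G) by exact/genz_lgen/genz0.
  by have := Tlin e (-1) 0 0 l0 l0; rewrite scaler0 addr0 scaleN1r addNr.
have [h dh gh] := dg x; rewrite (Tloc _ _ _ _ dg (genz_lgen dh) gh).
suff -> : T d h = 0 by [].
case: d dh {dg gh} => [n|n]; last by move=> ->.
rewrite /genz => gn; elim: n h / gn => [f|t|b|n|n a g1 h ? IHg ? IHh|m n g1 h ? IHg ? IHh].
- exact: T0.
- exact: T1.
- exact: T2.
- exact: Tz.
- by rewrite Tlin ?IHg ?IHh ?scaler0 ?addr0 //; exact: genz_lgen.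
- rewrite PoszD; apply: Tmul => //; exact: genz_lgen.
Qed.

(** * Biderivations of degree -2 *)

(* Brackets of global functions only; the degrees are arguments because an element
   of G does not determine its degree (0 has all degrees). *)
Record gbracket := GBracket {
  bk : int -> int -> G -> G -> G;
  bk_lgen : forall d e g h, lgen d g -> lgen e h -> lgen (d + e - 2) (bk d e g h);
  bk_local : forall d e g g' h h' x, lgen d g -> lgen d g' -> lgen e h ->
    lgen e h' -> (\forall y \near x, g y = g' y) ->
    (\forall y \near x, h y = h' y) -> (bk d e g h : G) x = (bk d e g' h' : G) x;
  bk_linl : forall d e a g g' h, lgen d g -> lgen d g' -> lgen e h ->
    bk d e (a *: g + g') h = a *: bk d e g h + bk d e g' h;
  bk_skew : forall d e g h, lgen d g -> lgen e h ->
    bk d e g h = - ((-1) ^ (d * e)) *: bk e d h g;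
  bk_leibniz : forall d1 d2 d3 g1 g2 g3, lgen d1 g1 -> lgen d2 g2 ->
    lgen d3 g3 -> bk d1 (d2 + d3) g1 (g2 ** g3) =
    bk d1 d2 g1 g2 ** g3 + (-1) ^ (d1 * d2) *: (g2 ** bk d1 d3 g1 g3)
}.

Arguments bk : clear implicits.

Section OneBracket.
Variable P : gbracket.
Local Notation br := (bk P).

Lemma bk_linr d e a g h h' : lgen d g -> lgen e h -> lgen e h' ->
  br d e g (a *: h + h') = a *: br d e g h + br d e g h'.
Proof.
move=> dg eh eh'; have eh2 : lgen e (a *: h + h') by move=> x; exact: locgenP.
rewrite bk_skew // bk_linl // (bk_skew P dg eh) (bk_skew P dg eh').
by rewrite scalerDr !scalerA mulrC.
Qed.

Lemma lgen0 d : lgen d (0 : G). Proof. by move=> x; exact: locgen0. Qed.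

Lemma bk0r d e g : lgen d g -> br d e g 0 = 0.
Proof.
move=> dg; have := bk_linr (-1) dg (lgen0 e) (lgen0 e).
by rewrite scaler0 addr0 scaleN1r addNr.
Qed.

Lemma bk0l d e g : lgen d g -> br e d 0 g = 0.
Proof. by move=> dg; rewrite bk_skew ?bk0r ?scaler0 //; exact: lgen0. Qed.

Lemma bkDr d e g h h' : lgen d g -> lgen e h -> lgen e h' ->
  br d e g (h + h') = br d e g h + br d e g h'.
Proof. by move=> dg eh eh'; have := bk_linr 1 dg eh eh'; rewrite !scale1r. Qed.

Lemma bkZr d e a g h : lgen d g -> lgen e h ->
  br d e g (a *: h) = a *: br d e g h.
Proof.
by move=> dg eh; have := bk_linr a dg eh (lgen0 e); rewrite !addr0 bk0r // addr0.
Qed.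

Lemma bkNr d e g h : lgen d g -> lgen e h -> br d e g (- h) = - br d e g h.
Proof. by move=> dg eh; rewrite -scaleN1r bkZr // scaleN1r. Qed.

Lemma bkBr d e g h h' : lgen d g -> lgen e h -> lgen e h' ->
  br d e g (h - h') = br d e g h - br d e g h'.
Proof.
by move=> dg eh eh'; rewrite bkDr ?bkNr //; move=> x; exact: locgenN.
Qed.

Lemma bkZl d e a g h : lgen d g -> lgen e h ->
  br d e (a *: g) h = a *: br d e g h.
Proof.
move=> dg eh; have := bk_linl P a dg (lgen0 d) eh.
by rewrite !addr0 bk0l // addr0.
Qed.

Lemma bkDl d e g g' h : lgen d g -> lgen d g' -> lgen e h ->
  br d e (g + g') h = br d e g h + br d e g' h.
Proof. by move=> dg dg' eh; have := bk_linl P 1 dg dg' eh; rewrite !scale1r. Qed.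

Lemma bkNl d e g h : lgen d g -> lgen e h -> br d e (- g) h = - br d e g h.
Proof. by move=> dg eh; rewrite -scaleN1r bkZl // scaleN1r. Qed.

Lemma bkBl d e g g' h : lgen d g -> lgen d g' -> lgen e h ->
  br d e (g - g') h = br d e g h - br d e g' h.
Proof.
by move=> dg dg' eh; rewrite bkDl ?bkNl //; move=> x; exact: locgenN.
Qed.

Lemma lgen_neg n g : lgen (Negz n) g -> g = 0.
Proof. by move=> ng; apply: gfun_ext => x; exact: locgen_neg (ng x). Qed.

Lemma bk_neg d e g h : (d + e < 2)%R -> lgen d g -> lgen e h -> br d e g h = 0.
Proof.
move=> de dg eh; have := bk_lgen P dg eh.
have : (d + e - 2 < 0)%R by rewrite subr_lt0.
by case: (d + e - 2)%R => // n _; exact: lgen_neg.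
Qed.

Lemma bk_near d e g g' h h' x : lgen d g -> lgen d g' -> lgen e h ->
  lgen e h' -> (\forall y \near x, g y = g' y) ->
  (\forall y \near x, h y = h' y) ->
  \forall y \near x, br d e g h y = br d e g' h' y.
Proof.
move=> dg dg' eh eh' /near_join gg /near_join hh.
by apply: filterS2 gg hh => y; exact: bk_local.
Qed.

Lemma lgenM d e g h : lgen d g -> lgen e h -> lgen (d + e) (g ** h).
Proof. by move=> dg eh x; exact: locgenM. Qed.
Lemma lgenD d g h : lgen d g -> lgen d h -> lgen d (g + h).
Proof. by move=> dg eh x; exact: locgenD. Qed.
Lemma lgenB d g h : lgen d g -> lgen d h -> lgen d (g - h).
Proof. by move=> dg eh x; exact: locgenB. Qed.
Lemma lgenZ d a g : lgen d g -> lgen d (a *: g).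
Proof. by move=> dg x; exact: locgenZ. Qed.
Lemma lgenN d g : lgen d g -> lgen d (- g).
Proof. by move=> dg x; exact: locgenN. Qed.

Definition jacobiator d1 d2 d3 g1 g2 g3 :=
  br d1 (d2 + d3 - 2) g1 (br d2 d3 g2 g3) -
  br (d1 + d2 - 2) d3 (br d1 d2 g1 g2) g3 -
  (-1) ^ (d1 * d2) *: br d2 (d1 + d3 - 2) g2 (br d1 d3 g1 g3).

(** A consequence of bilinearity and skew-symmetry alone. It lets a reduction in the third argument
    serve for the other two. *)
Lemma jacobiator_rot d1 d2 d3 g1 g2 g3 : lgen d1 g1 -> lgen d2 g2 -> lgen d3 g3 ->
  jacobiator d3 d1 d2 g3 g1 g2 =
  (-1) ^ (d3 * (d1 + d2)) *: jacobiator d1 d2 d3 g1 g2 g3.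
Proof.
move=> l1 l2 l3; rewrite /jacobiator.
rewrite (bk_skew P l3 (bk_lgen P l1 l2)).
rewrite (bk_skew P (bk_lgen P l3 l1) l2) (bk_skew P l3 l1) (bk_skew P l3 l2).
rewrite [(d3 + d1 - 2)%R](_ : _ = d1 + d3 - 2); last by rewrite (addrC d3).
rewrite [(d3 + d2 - 2)%R](_ : _ = d2 + d3 - 2); last by rewrite (addrC d3).
rewrite (bkZr _ l2 (bk_lgen P l1 l3)) (bkZr _ l1 (bk_lgen P l2 l3)).
apply: gfun_ext3 => x s z; rewrite !gfunE.
rewrite !signz !(odzM, odzD, odzB).
by case: (odz d1) (odz d2) (odz d3) => [] [] [] /=; ring.
Qed.

(** The mixed products, in which g1 acts on one factor and g2 on the other, cancel between the first
    and the last term of the Jacobiator. *)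
Lemma jacobiator_leibniz d1 d2 p q g1 g2 g h :
  lgen d1 g1 -> lgen d2 g2 -> lgen p g -> lgen q h ->
  jacobiator d1 d2 (p + q) g1 g2 (g ** h) =
  jacobiator d1 d2 p g1 g2 g ** h +
  (-1) ^ ((d1 + d2) * p) *: (g ** jacobiator d1 d2 q g1 g2 h).
Proof.
move=> l1 l2 lg lh.
have lb e e' (k k' : G) (l : lgen e k) (l' : lgen e' k') := bk_lgen P l l'.
have deg e : e + (p + q) - 2 = (e + p - 2) + q by ring.
have deg' e : e + (p + q) - 2 = p + (e + q - 2) by ring.
(* Both iterated brackets of the product are instances of this expansion, with the roles of g1 and
   g2 exchanged. The identities [deg] and [deg'] regroup degrees so that the Leibniz rule
   matches. *)
have main e1 e2 (k1 k2 : G) : lgen e1 k1 -> lgen e2 k2 ->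
    br e1 (e2 + (p + q) - 2) k1 (br e2 (p + q) k2 (g ** h)) =
    br e1 (e2 + p - 2) k1 (br e2 p k2 g) ** h +
    (-1) ^ (e1 * (e2 + p - 2)) *: (br e2 p k2 g ** br e1 q k1 h) +
    (-1) ^ (e2 * p) *: (br e1 p k1 g ** br e2 q k2 h +
    (-1) ^ (e1 * p) *: (g ** br e1 (e2 + q - 2) k1 (br e2 q k2 h))).
  move=> lk1 lk2; rewrite bk_leibniz // bkDr //; last first.
  - by rewrite deg'; apply/lgenZ/lgenM => //; exact: lb.
  - by rewrite deg; apply/lgenM => //; exact: lb.
  rewrite bkZr //; last by rewrite deg'; apply/lgenM => //; exact: lb.
  rewrite {1}deg bk_leibniz //; last exact: lb.
  by rewrite deg' bk_leibniz //; exact: lb.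
rewrite /jacobiator !main // bk_leibniz //; last exact: lb.
apply: gfun_ext3 => x s z; rewrite !(mulgDl, mulgDr, mulgNl, mulgNr, mulgZl, mulgZr) !gfunE.
rewrite !signz !(odzM, odzD, odzB).
by case: (odz d1) (odz d2) (odz p) => [] [] [] /=; ring.
Qed.

Lemma jacobiator_third d1 d2 g1 g2 : lgen d1 g1 -> lgen d2 g2 ->
  (forall f, jacobiator d1 d2 0 g1 g2 (deg0 Q B f) = 0) ->
  (forall t, jacobiator d1 d2 1 g1 g2 (deg1 B t) = 0) ->
  (forall b, jacobiator d1 d2 2 g1 g2 (deg2 Q b) = 0) ->
  forall d3 g3, lgen d3 g3 -> jacobiator d1 d2 d3 g1 g2 g3 = 0.
Proof.
move=> l1 l2 H0 H1 H2.
apply: (lgen_ind (T := fun d g => jacobiator d1 d2 d g1 g2 g)) => //.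
- move=> d g h x lg lh gh; rewrite /jacobiator.
  have r k : \forall y \near x, k y = k y by exact: nearW.
  have E1 := bk_near l2 l2 lg lh (r _) gh.
  have E2 := bk_near l1 l1 lg lh (r _) gh.
  have lb := bk_lgen P.
  congr (_ - _ - _ *: _).
  + exact (bk_local P l1 l1 (lb _ _ _ _ l2 lg) (lb _ _ _ _ l2 lh) (r _) E1).
  + exact (bk_local P (lb _ _ _ _ l1 l2) (lb _ _ _ _ l1 l2) lg lh (r _) gh).
  + exact (bk_local P l2 l2 (lb _ _ _ _ l1 lg) (lb _ _ _ _ l1 lh) (r _) E2).
- move=> d a g h lg lh; rewrite /jacobiator.
  have lb := bk_lgen P.
  rewrite !bk_linr //; try exact: lb.
  by apply: gfun_ext3 => x s z; rewrite !gfunE; ring.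
- move=> d e g h lg lh Jg Jh; rewrite jacobiator_leibniz // Jg Jh.
  by rewrite mulg0l mulg0r scaler0 addr0.
Qed.

Inductive is_gen : int -> G -> Prop :=
| is_gen0 f : is_gen 0 (deg0 Q B f)
| is_gen1 t : is_gen 1 (deg1 B t)
| is_gen2 b : is_gen 2 (deg2 Q b).

Lemma is_gen_lgen d g : is_gen d g -> lgen d g.
Proof.
by case=> ?; apply: genz_lgen; [exact: gen_deg0|exact: gen_deg1|exact: gen_deg2].
Qed.

(** The arguments are freed one at a time: the third directly, then the first and the second, after
    a rotation that moves them into third position. *)
Lemma jacobi_from_generators :
  (forall d1 d2 d3 g1 g2 g3, is_gen d1 g1 -> is_gen d2 g2 -> is_gen d3 g3 ->
    jacobiator d1 d2 d3 g1 g2 g3 = 0) ->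
  forall d1 d2 d3 g1 g2 g3, lgen d1 g1 -> lgen d2 g2 -> lgen d3 g3 ->
    jacobiator d1 d2 d3 g1 g2 g3 = 0.
Proof.
move=> H.
have third d1 d2 g1 g2 : lgen d1 g1 -> lgen d2 g2 ->
    (forall d3 g3, is_gen d3 g3 -> jacobiator d1 d2 d3 g1 g2 g3 = 0) ->
    forall d3 g3, lgen d3 g3 -> jacobiator d1 d2 d3 g1 g2 g3 = 0.
  by move=> l1 l2 K; apply: jacobiator_third => // ?; apply: K; constructor.
have lg := is_gen_lgen.
have H1 d1 d2 d3 g1 g2 g3 : is_gen d1 g1 -> is_gen d2 g2 -> lgen d3 g3 ->
    jacobiator d1 d2 d3 g1 g2 g3 = 0.
  move=> l1 l2; apply: (third _ _ _ _ (lg _ _ l1) (lg _ _ l2)) => d g l.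
  exact: H.
have H2 d1 d2 d3 g1 g2 g3 : lgen d1 g1 -> is_gen d2 g2 -> lgen d3 g3 ->
    jacobiator d1 d2 d3 g1 g2 g3 = 0.
  move=> l1 /[dup] l2 /lg l2'; apply: (third _ _ _ _ l1 l2') => d g l.
  by rewrite (jacobiator_rot l2' (lg _ _ l) l1) H1 ?scaler0.
move=> d1 d2 d3 g1 g2 g3 l1 l2; apply: third => // d g l.
by rewrite (jacobiator_rot l2 (lg _ _ l) l1) H2 ?scaler0.
Qed.

End OneBracket.

(** With the first argument fixed, the difference of the two brackets is local and linear, and by
    the Leibniz rule vanishes on a product once it does on the factors. Skew-symmetry exchanges the
    arguments. *)
Lemma bracket_unique (P P' : gbracket) :
  (forall d1 d2 g1 g2, is_gen d1 g1 -> is_gen d2 g2 ->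
    bk P d1 d2 g1 g2 = bk P' d1 d2 g1 g2) ->
  forall d1 d2 g1 g2, lgen d1 g1 -> lgen d2 g2 ->
    bk P d1 d2 g1 g2 = bk P' d1 d2 g1 g2.
Proof.
move=> H.
have second d g : lgen d g ->
    (forall e h, is_gen e h -> bk P d e g h = bk P' d e g h) ->
    forall e h, lgen e h -> bk P d e g h = bk P' d e g h.
  move=> lg K e h lh; apply/eqP; rewrite -subr_eq0; apply/eqP.
  move: e h lh; apply: (lgen_ind (T := fun e h => bk P d e g h - bk P' d e g h)).
  - move=> e h h' x lh lh' hh.
    have r k : \forall y \near x, k y = k y by exact: nearW.
    by congr (_ - _); apply: bk_local.
  - move=> e a h h' lh lh'; rewrite !bk_linr //.
    by apply: gfun_ext3 => x s z; rewrite !gfunE; ring.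
  - move=> e e' h h' lh lh' /eqP; rewrite subr_eq0 => /eqP E /eqP.
    by rewrite subr_eq0 => /eqP E'; rewrite !bk_leibniz // E E' subrr.
  - by move=> f; rewrite K ?subrr //; constructor.
  - by move=> f; rewrite K ?subrr //; constructor.
  - by move=> f; rewrite K ?subrr //; constructor.
have H1 d1 d2 g1 g2 : is_gen d1 g1 -> lgen d2 g2 ->
    bk P d1 d2 g1 g2 = bk P' d1 d2 g1 g2.
  move=> l1 l2; apply: second => //; first exact: is_gen_lgen.
  by move=> ? ? ?; exact: H.
move=> d1 d2 g1 g2 l1 l2; apply: second => // e h lh.
have lh' := is_gen_lgen lh.
by rewrite (bk_skew P) // (bk_skew P') // H1.
Qed.

End Brackets.

Arguments bk {R M Q B} g d e g h : rename.
Arguments jacobiator {R M Q B} P d1 d2 d3 g1 g2 g3.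
Arguments is_gen {R M Q B} d g.

(** * Two-forms as sums of products, and the curvature term *)

Section TwoForms.
Variables (R : realType) (M : manifold R) (Q B : vbundle M).
Local Notation G := (dfun (gfib Q B)).
Local Infix "**" := mulg (at level 40).

Lemma lgen_deg0 f : lgen 0 (deg0 Q B f). Proof. exact/genz_lgen/gen_deg0. Qed.
Lemma lgen_deg1 t : lgen 1 (deg1 B t : G). Proof. exact/genz_lgen/gen_deg1. Qed.
Lemma lgen_deg2 b : lgen 2 (deg2 Q b : G). Proof. exact/genz_lgen/gen_deg2. Qed.

Lemma deg0_inj f f' : deg0 Q B f = deg0 Q B f' -> f = f'.
Proof.
move=> ff; apply: Cinf_ext => x.
exact: (congr1 (fun g : G => g x [::] 0) ff).
Qed.

Lemma deg1_inj t t' : deg1 B t = deg1 B t' :> G -> t = t'.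
Proof.
move=> tt; apply: sec_ext => x; apply/lfunP => q.
exact: (congr1 (fun g : G => g x [:: q] 0) tt).
Qed.

Lemma deg2_inj b b' : deg2 Q b = deg2 Q b' :> G -> b = b'.
Proof.
move=> bb; apply: sec_ext => x.
rewrite [LHS]frame_expand [RHS]frame_expand; apply: eq_bigr => i _; congr (_ *: _).
exact: (congr1 (fun g : G => g x [::] (coframe B x i x)) bb).
Qed.

Lemma deg1E t x q z : (deg1 B t : G) x [:: q] z = t x q. Proof. by []. Qed.

Lemma deg1M_nil t t' x z : (deg1 B t ** deg1 B t' : G) x [::] z = 0.
Proof. exact: mulr0. Qed.

Lemma deg1M_cons t t' x q s z : (deg1 B t ** deg1 B t' : G) x (q :: s) z =
  t x q * (deg1 B t' : G) x s z - t' x q * (deg1 B t : G) x s z.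
Proof.
rewrite /mulg wedge_cons.
have E u : contraction q ((deg1 B u : G) x) = scalar_form (u x q).
  by apply/funext => l; apply/funext => y; case: l.
rewrite !E wedge_scalarl wedge_scalarr -[LHS]/(t x q * _ + t' x q * _).
congr (_ + _); rewrite -mulrN; congr (_ * _).
by rewrite /flip; case: s => [|v [|v' s]]; rewrite /= ?mulr0 ?oppr0 // expr1 mulN1r.
Qed.

Definition pairs_form (l : seq (Gamma (dual Q) * Gamma (dual Q))) : G :=
  \sum_(p <- l) deg1 B p.1 ** deg1 B p.2.

Arguments pairs_form l : clear implicits.

Lemma pairs_form_cons p l :
  pairs_form (p :: l) = deg1 B p.1 ** deg1 B p.2 + pairs_form l.
Proof. exact: big_cons. Qed.

Lemma lgen_pairs l : lgen 2 (pairs_form l).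
Proof.
elim: l => [|p l IH]; first by rewrite /pairs_form big_nil => x; exact: locgen0.
rewrite pairs_form_cons; apply: lgenD IH.
exact: lgenM (lgen_deg1 _) (lgen_deg1 _).
Qed.

Lemma pairs_form_supp l x s z : size s != 2 -> pairs_form l x s z = 0.
Proof.
move=> s2; elim: l => [|p l IH]; first by rewrite /pairs_form big_nil.
rewrite pairs_form_cons gfun_addE IH addr0.
case: s s2 {IH} => [|q [|q' [|q'' s]]] //= _; first exact: deg1M_nil.
  by rewrite deg1M_cons /= !mulr0 subr0.
by rewrite deg1M_cons /= !mulr0 subr0.
Qed.

Lemma pairs_form2 l (q q' : Gamma Q) : exists F : Cinf M,
  forall x z, F x = pairs_form l x [:: q x; q' x] z.
Proof.
elim: l => [|p l [F IH]]; first by exists 0 => x z; rewrite /pairs_form big_nil.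
exists (pairing p.1 q * pairing p.2 q' - pairing p.2 q * pairing p.1 q' + F) => x z.
by rewrite pairs_form_cons gfun_addE deg1M_cons -IH.
Qed.

Section CurvatureForm.
Variable w : hom_form2 B Q (dual Q).
Hypothesis w_skew : forall x (u v : B x) (p q : Q x),
  form_at w u v q p = - form_at w u v p q.

(** The curvature term is an element of G given by its values. A local expression by products of
    generators shows that it is a function of degree 2, and makes its brackets computable by the
    Leibniz rule. *)
Lemma curv_fun_pairs (x : M) (b b' : Gamma B) : exists l,
  \forall y \near x, (curv_fun w b b' : G) y = pairs_form l y.
Proof.
pose W i k := pairing (Defs.form w b b' (frame Q x i)) (frame Q x k).
(* The factor 1/2 compensates for summing over all ordered pairs of indices, each unordered pair
   being counted twice by skew-symmetry. *)
pose l := flatten [seq [seq ((Cinf_cst M 2^-1 * W i k) *: coframe Q x i, coframe Q x k)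
  | k <- enum 'I_(vrank Q)] | i <- enum 'I_(vrank Q)].
have lE : pairs_form l =
    \sum_i \sum_k deg1 B ((Cinf_cst M 2^-1 * W i k) *: coframe Q x i) ** deg1 B (coframe Q x k).
  rewrite /pairs_form /l big_flatten big_map big_enum /=; apply: eq_bigr => i _.
  by rewrite big_map big_enum.
exists l; apply: filterS (frame_near Q x) => y [Hy _].
apply/funext => s; apply/funext => z.
case: s => [|q [|q' [|q'' s]]]; try by rewrite pairs_form_supp.
rewrite lE /curv_fun.
have sumE (I : finType) (F : I -> G) : (\sum_i F i) y [:: q; q'] z = \sum_i F i y [:: q; q'] z.
  exact: (big_morph (fun g : G => g y [:: q; q'] z)).
rewrite sumE; under eq_bigr => i _.
  rewrite sumE; under eq_bigr => k _ do rewrite deg1M_cons !deg1E.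
  over.
pose f p p' : R := (form_at w (b y) (b' y) p : dual Q y) p'.
have fE p p' : f p p' = \sum_i \sum_k coframe Q x i y p * (coframe Q x k y p' * W i k y).
  rewrite /f {1}(Hy p) linear_sum sum_lfunE; apply: eq_bigr => i _.
  rewrite linearZ scale_lfunE {1}(Hy p') linear_sum /GRing.scale /= mulr_sumr.
  by apply: eq_bigr => k _; rewrite linearZ.
rewrite -/(f q q').
have -> : f q q' = 2^-1 * f q q' - 2^-1 * f q' q.
  by rewrite {3}/f w_skew -/(f q q'); field.
rewrite !fE !mulr_sumr -sumrB; apply: eq_bigr => i _.
rewrite !mulr_sumr -sumrB; apply: eq_bigr => k _.
have E p : ((Cinf_cst M 2^-1 * W i k) *: coframe Q x i) y p = (2^-1 * W i k y) * coframe Q x i y p.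
  by rewrite -[LHS]/(((2^-1 * W i k y) *: coframe Q x i y) p) scale_lfunE.
by rewrite !E; ring.
Qed.

End CurvatureForm.
End TwoForms.
Arguments pairs_form {R M Q B} l.

(** * Brackets with two-forms and Jacobiators of generators *)

Section GeneratorBrackets.
Variables (R : realType) (M : manifold R) (Q B : vbundle M).
Local Notation G := (dfun (gfib Q B)).
Local Infix "**" := mulg (at level 40).
Local Notation hform := Defs.form.

Variables (P : gbracket Q B) (rh : anchor_map B).
Variables (bb : Gamma B -> Gamma B -> Gamma B).
Variables (n0 : Gamma B -> Gamma (dual Q) -> Gamma (dual Q)).
Variables (n1 : Gamma B -> Gamma Q -> Gamma Q).
Variables (dl : bundle_map (dual Q) Q) (w : hom_form2 B Q (dual Q)).

Hypothesis bk11 : forall t t',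
  bk P 1 1 (deg1 B t) (deg1 B t') = deg0 Q B (pairing t' (bmap dl t)).
Hypothesis bk20 : forall b f,
  bk P 2 0 (deg2 Q b) (deg0 Q B f) = deg0 Q B (anchor rh b f).
Hypothesis bk21 : forall b t,
  bk P 2 1 (deg2 Q b) (deg1 B t) = deg1 B (n0 b t).
Hypothesis bk22 : forall b b',
  bk P 2 2 (deg2 Q b) (deg2 Q b') = deg2 Q (bb b b') - (curv_fun w b b' : G).
Hypothesis n_dual : forall a (t : Gamma (dual Q)) (q : Gamma Q),
  anchor rh a (pairing t q) = pairing (n0 a t) q + pairing t (n1 a q).
Hypothesis w_skew : forall x (u v : B x) (p q : Q x),
  form_at w u v q p = - form_at w u v p q.

Let lg0 := @lgen_deg0 R M Q B.
Let lg1 := @lgen_deg1 R M Q B.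
Let lg2 := @lgen_deg2 R M Q B.
Let lgp := @lgen_pairs R M Q B.
Local Hint Resolve lg0 lg1 lg2 lgp : core.

Lemma sign2M (d : int) : (-1) ^ (2 * d) = 1 :> R.
Proof. by rewrite signz odzM. Qed.

Lemma bk_pairs_deg0 l f : bk P 2 0 (pairs_form l) (deg0 Q B f) = 0.
Proof.
elim: l => [|p l IH]; first by rewrite /pairs_form big_nil bk0l.
have lp : lgen 2 (deg1 B p.1 ** deg1 B p.2 : G) by exact: (lgenM (lg1 _) (lg1 _)).
rewrite pairs_form_cons bkDl // IH addr0 bk_skew //.
rewrite -[X in bk P 0 X]/(1 + 1 : int) bk_leibniz //.
rewrite !(@bk_neg _ _ _ _ P 0 1) //.
by rewrite mulg0l mulg0r scaler0 addr0 scaler0.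
Qed.

(** Both {t, .} and the contraction with del t are odd derivations, and they agree on sections of
    the dual of Q. *)
Lemma bk_deg1_pairs t l (x : M) :
  bk P 1 2 (deg1 B t) (pairs_form l) x =
  contraction (bmap_at dl x (t x)) (pairs_form l x).
Proof.
apply/funext => s; apply/funext => z; rewrite /contraction.
elim: l => [|p l IH]; first by rewrite /pairs_form big_nil bk0r.
have lp : lgen 2 (deg1 B p.1 ** deg1 B p.2 : G) by exact: (lgenM (lg1 _) (lg1 _)).
rewrite pairs_form_cons bkDr // !gfun_addE IH; congr (_ + _).
rewrite -[X in bk P 1 X]/(1 + 1 : int) bk_leibniz // !bk11 deg1M_cons.
by rewrite deg0_mul mul_deg0 gfun_addE gfun_scaleE mulr1 expr1z mulN1r.
Qed.

Lemma bk_deg2_deg1M b t t' : bk P 2 2 (deg2 Q b) (deg1 B t ** deg1 B t') =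
  deg1 B (n0 b t) ** deg1 B t' + deg1 B t ** deg1 B (n0 b t').
Proof.
rewrite -[X in bk P 2 X (deg2 Q b) (_ ** _)]/(1 + 1 : int) bk_leibniz // !bk21.
by rewrite sign2M scale1r.
Qed.

Lemma bk_deg2_pairs b l : bk P 2 2 (deg2 Q b) (pairs_form l) =
  pairs_form [seq (n0 b p.1, p.2) | p <- l] + pairs_form [seq (p.1, n0 b p.2) | p <- l].
Proof.
elim: l => [|p l IH]; first by rewrite /pairs_form !big_nil bk0r // addr0.
have lp : lgen 2 (deg1 B p.1 ** deg1 B p.2 : G) by exact: (lgenM (lg1 _) (lg1 _)).
rewrite /= !pairs_form_cons bkDr // IH.
rewrite bk_deg2_deg1M.
by rewrite addrACA.
Qed.

(** The covariant derivative of a two-form: differentiate its value on q, q' and subtract the terms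
    where the dual connection acts on q or q'. The witness F is this value as a smooth function, to
    which the anchor can be applied. *)
Lemma bk_deg2_pairs_eval b l (q q' : Gamma Q) : exists F : Cinf M,
  (forall x z, F x = (pairs_form l : G) x [:: q x; q' x] z) /\
  forall x z, bk P 2 2 (deg2 Q b) (pairs_form l) x [:: q x; q' x] z =
    anchor rh b F x - (pairs_form l : G) x [:: n1 b q x; q' x] z
                    - (pairs_form l : G) x [:: q x; n1 b q' x] z.
Proof.
elim: l => [|p l [F [F1 F2]]].
  exists 0; split=> x z; rewrite /pairs_form !big_nil // bk0r //.
  by rewrite [anchor _ _ _ _](tangent0 (anchor_tangent _ _)) !subr0.
exists (pairing p.1 q * pairing p.2 q' - pairing p.2 q * pairing p.1 q' + F).
split=> x z; first by rewrite pairs_form_cons gfun_addE deg1M_cons !deg1E -F1.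
have lp : lgen 2 (deg1 B p.1 ** deg1 B p.2 : G) by exact: (lgenM (lg1 _) (lg1 _)).
have tv := anchor_tangent rh (b x).
have AE f : anchor rh b f x = anchor_at rh (b x) f by [].
rewrite !pairs_form_cons bkDr // !gfun_addE F2 !deg1M_cons !deg1E !AE.
rewrite (tangentD tv) (tangentD tv) (tangentN tv) !(tangentM tv) -!AE !n_dual.
rewrite bk_deg2_deg1M gfun_addE !deg1M_cons !deg1E.
have PE (t : Gamma (dual Q)) (u : Gamma Q) : pairing t u x = t x (u x) by [].
have DE (f g : Cinf M) : (f + g) x = f x + g x by [].
by rewrite !DE !PE; ring.
Qed.

Lemma lgen_curv b b' : lgen 2 (curv_fun w b b' : G).
Proof.
move=> x; have [l wl] := curv_fun_pairs w_skew x b b'.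
by apply: locgen_eq (lgp l x); apply: filterS wl => y ->.
Qed.
Hint Resolve lgen_curv : core.

Let near_refl (x : M) (g : G) : \forall y \near x, g y = g y.
Proof. exact: nearW. Qed.

Lemma bk_curv_deg0 b b' f : bk P 2 0 (curv_fun w b b') (deg0 Q B f) = 0.
Proof.
apply: gfun_ext => x; have [l wl] := curv_fun_pairs w_skew x b b'.
rewrite (bk_local P (lgen_curv b b') (lgp l) (lg0 f) (lg0 f) wl (near_refl x _)).
by rewrite bk_pairs_deg0.
Qed.

Lemma bk_deg1_curv t b b' : bk P 1 2 (deg1 B t) (curv_fun w b b') =
  deg1 B (hform w b b' (bmap dl t)).
Proof.
apply: gfun_ext => x; have [l wl] := curv_fun_pairs w_skew x b b'.
rewrite (bk_local P (lg1 t) (lg1 t) (lgen_curv b b') (lgp l) (near_refl x _) wl).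
rewrite bk_deg1_pairs -(nbhs_singleton wl).
by apply/funext => s; apply/funext => z; case: s => [|q [|q' s]].
Qed.

Definition lie_form a b b' (q : Gamma Q) : Gamma (dual Q) :=
  n0 a (hform w b b' q) - hform w b b' (n1 a q).

Lemma bk_deg2_curv a b b' (q q' : Gamma Q) x z :
  bk P 2 2 (deg2 Q a) (curv_fun w b b') x [:: q x; q' x] z =
  pairing (lie_form a b b' q) q' x.
Proof.
have [l wl] := curv_fun_pairs w_skew x b b'.
rewrite (bk_local P (lg2 a) (lg2 a) (lgen_curv b b') (lgp l) (near_refl x _) wl).
have [F [F1 F2]] := bk_deg2_pairs_eval a l q q'.
rewrite F2 -!(nbhs_singleton wl).
(* F and the pairing agree only near x, where the list l represents the curvature; that is enough
   for a tangent vector. *)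
have -> : anchor rh a F x = anchor rh a (pairing (hform w b b' q) q') x.
  apply: (tangent_near (anchor_tangent rh (a x))).
  by apply: filterS wl => y wl; rewrite (F1 y 0) -wl.
rewrite n_dual -[LHS]/(pairing (n0 a (hform w b b' q)) q' x +
  pairing (hform w b b' q) (n1 a q') x - hform w b b' (n1 a q) x (q' x) -
  pairing (hform w b b' q) (n1 a q') x).
rewrite addrAC addrK /lie_form.
rewrite -[RHS]/((n0 a (hform w b b' q) x - hform w b b' (n1 a q) x) (q' x)).
by rewrite add_lfunE opp_lfunE.
Qed.

Lemma bk_deg2_curv_supp a b b' x s z : size s != 2 ->
  bk P 2 2 (deg2 Q a) (curv_fun w b b') x s z = 0.
Proof.
move=> s2; have [l wl] := curv_fun_pairs w_skew x b b'.
rewrite (bk_local P (lg2 a) (lg2 a) (lgen_curv b b') (lgp l) (near_refl x _) wl).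
by rewrite bk_deg2_pairs gfun_addE !pairs_form_supp // addr0.
Qed.

Lemma jacobiator220 a b f :
  jacobiator P 2 2 0 (deg2 Q a) (deg2 Q b) (deg0 Q B f) =
  deg0 Q B (anchor rh a (anchor rh b f) - anchor rh (bb a b) f
            - anchor rh b (anchor rh a f)).
Proof.
rewrite /jacobiator -[(2 + 0 - 2)%R]/(0 : int) -[(2 + 2 - 2)%R]/(2 : int).
rewrite !bk20 bk22 bkBl // !bk20 bk_curv_deg0 subr0.
rewrite sign2M scale1r.
by rewrite !deg0D !deg0N.
Qed.

Lemma jacobiator211 b t t' :
  jacobiator P 2 1 1 (deg2 Q b) (deg1 B t) (deg1 B t') =
  deg0 Q B (anchor rh b (pairing t' (bmap dl t)) - pairing t' (bmap dl (n0 b t))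
            - pairing (n0 b t') (bmap dl t)).
Proof.
rewrite /jacobiator -[(1 + 1 - 2)%R]/(0 : int) -[(2 + 1 - 2)%R]/(1 : int).
rewrite !bk11 bk20 !bk21 !bk11.
rewrite sign2M scale1r.
by rewrite !deg0D !deg0N.
Qed.

(** The two-form in {a, b} contributes its bracket with t, which skew-symmetry and [bk_deg1_curv]
    turn into R(a, b)(del t). *)
Lemma jacobiator221 a b t :
  jacobiator P 2 2 1 (deg2 Q a) (deg2 Q b) (deg1 B t) =
  deg1 B (n0 a (n0 b t) - (n0 (bb a b) t + hform w a b (bmap dl t)) - n0 b (n0 a t)).
Proof.
rewrite /jacobiator -[(2 + 1 - 2)%R]/(1 : int) -[(2 + 2 - 2)%R]/(2 : int).
rewrite !bk21 bk22 bkBl // !bk21.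
rewrite (bk_skew P (lgen_curv a b) (lg1 t)) bk_deg1_curv.
rewrite sign2M sign2M scale1r.
by rewrite !(deg1D, deg1N) scaleN1r opprK.
Qed.

(** Unfolds to the same expression as [d_nabla_hom], but makes sense before the operations are known
    to be connections of a Lie algebroid. *)
Definition d_form a b c (q : Gamma Q) : Gamma (dual Q) :=
  lie_form a b c q - lie_form b a c q + lie_form c a b q
  - hform w (bb a b) c q + hform w (bb a c) b q - hform w (bb b c) a q.

(** Lists of length 0 and 2 separate the two components of a function of degree 2: the first carries
    the Jacobi identity of [bb], the second the closedness of the curvature. *)
Lemma jacobiator222 a b c :
  let J := jacobiator P 2 2 2 (deg2 Q a) (deg2 Q b) (deg2 Q c) in
  [/\ forall x z, J x [::] z =
        z ((bb a (bb b c) - bb (bb a b) c - bb b (bb a c)) x),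
      forall x (q q' : Gamma Q) z, J x [:: q x; q' x] z =
        - pairing (d_form a b c q) q' x
    & forall x s z, size s != 0 -> size s != 2 -> J x s z = 0].
Proof.
have JE : jacobiator P 2 2 2 (deg2 Q a) (deg2 Q b) (deg2 Q c) =
    (deg2 Q (bb a (bb b c)) - curv_fun w a (bb b c) - bk P 2 2 (deg2 Q a) (curv_fun w b c)) -
    (deg2 Q (bb (bb a b) c) - curv_fun w (bb a b) c + bk P 2 2 (deg2 Q c) (curv_fun w a b)) -
    (deg2 Q (bb b (bb a c)) - curv_fun w b (bb a c) - bk P 2 2 (deg2 Q b) (curv_fun w a c)).
  rewrite /jacobiator -[(2 + 2 - 2)%R]/(2 : int).
  rewrite !bk22 bkBl // !bkBr // !bk22.
  rewrite (bk_skew P (lgen_curv a b) (lg2 c)).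
  by rewrite sign2M scale1r scaleN1r opprK.
split=> [x z|x q q' z|x s z s0 s2]; rewrite JE !gfunE.
- rewrite !bk_deg2_curv_supp //=.
  rewrite -[RHS]/(z (bb a (bb b c) x - bb (bb a b) c x - bb b (bb a c) x)).
  by rewrite !linearB /=; ring.
- rewrite !bk_deg2_curv.
  have alt u v : hform w u v q x (q' x) = - hform w v u q x (q' x).
    by rewrite -[LHS]/(form_at w (u x) (v x) (q x) (q' x)) form_alt !opp_lfunE.
  have CE u v : (curv_fun w u v : G) x [:: q x; q' x] z = hform w u v q x (q' x) by [].
  have DE u : (deg2 Q u : G) x [:: q x; q' x] z = 0 by [].
  rewrite !CE !DE (alt a) (alt b).
  have PE (t : Gamma (dual Q)) : pairing t q' x = t x (q' x) by [].
  have AE (t t' : Gamma (dual Q)) : (t + t') x (q' x) = t x (q' x) + t' x (q' x).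
    by rewrite -[LHS]/((t x + t' x) (q' x)) add_lfunE.
  have OE (t : Gamma (dual Q)) : (- t) x (q' x) = - t x (q' x).
    by rewrite -[LHS]/((- t x) (q' x)) opp_lfunE.
  by rewrite /d_form !PE !(AE, OE); ring.
- rewrite !bk_deg2_curv_supp //.
  by case: s s0 s2 => [|q [|q' [|q'' s]]] //= _ _; ring.
Qed.

End GeneratorBrackets.

(** * Brackets of global functions and brackets of sheaves *)

Section SheafBracket.
Variables (R : realType) (M : manifold R) (Q B : vbundle M).
Local Notation G := (dfun (gfib Q B)).
Local Infix "**" := mulg (at level 40).
Local Notation O := (gfun Q B).
Local Notation X := (opens_full M).

(** Puts functions on all open sets into the single module G. The jump at the boundary of U is
    harmless, since only germs at points of U are ever used. *)
Definition zero_ext (U : set M) (g : gsec Q B U) : G :=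
  fun x => if pselect (U x) is left Ux then g (exist _ x Ux) else 0.
Arguments zero_ext U g : clear implicits.

Lemma zero_extE (U : set M) (g : gsec Q B U) (p : {x : M | U x}) :
  zero_ext U g (sval p) = g p.
Proof.
case: p => x Ux; rewrite /zero_ext /=; case: pselect => // Ux'.
by rewrite (Prop_irrelevance Ux' Ux).
Qed.

Lemma zero_extP (U : set M) a (g h : gsec Q B U) :
  zero_ext U (a *: g + h) = a *: zero_ext U g + zero_ext U h.
Proof.
apply: gfun_ext => x; rewrite -[RHS]/(a *: zero_ext U g x + zero_ext U h x).
by rewrite /zero_ext; case: pselect => // _; rewrite scaler0 addr0.
Qed.

Lemma zero_ext_mul (U : set M) (g h : gsec Q B U) :
  zero_ext U (gmul g h) = zero_ext U g ** zero_ext U h.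
Proof.
apply: gfun_ext => x; rewrite /zero_ext /mulg; case: pselect => // _.
by rewrite wedge_0l.
Qed.

Lemma gfun_predP d (U : opens M) (g : gsec Q B U) :
  g \in gfun_pred d (U:=U) <-> forall x, opens_set U x -> locgen x d (zero_ext U g).
Proof.
split=> [/asboolP gd x Ux|gd].
  case: d gd => [n|n] gd; last first.
    exists 0 => //; apply: nearW => y; rewrite gd /zero_ext; by case: pselect.
  have [V [h [oV Vx hn gh]]] := gd (exist _ x Ux); exists h => //.
  have nV : nbhs x (U `&` V).
    by apply: open_nbhs_nbhs; split => //; apply: openI => //; exact: opens_open.
  apply: filterS nV => y [Uy Vy]; rewrite -[y]/(sval (exist (opens_set U) y Uy)) zero_extE.
  exact: gh.
apply/asboolP; case: d gd => [n|n] gd.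
  move=> p; have [h hn] := gd _ (svalP p).
  rewrite /prop_near1 nbhsE => -[V [oV Vp] gh].
  by exists V, h; split => // p' Vp'; rewrite -zero_extE; exact: gh.
apply: functional_extensionality_dep => p; rewrite -zero_extE.
exact: (locgen_neg (gd _ (svalP p))).
Qed.

Lemma gfun_locgen d (U : opens M) (g : O d U) x : opens_set U x -> locgen x d (zero_ext U (val g)).
Proof. exact: ((gfun_predP d (gfun_val g)).1 (gfun_mem g)). Qed.

Lemma zero_ext_glob (g : G) : zero_ext setT (glob g) = g.
Proof. by apply: gfun_ext => x; rewrite /zero_ext; case: pselect => // /(_ I). Qed.

Lemma glob_zero_ext (g : gsec Q B X) : glob (zero_ext X g) = g.
Proof. by apply: functional_extensionality_dep => p; rewrite /glob zero_extE. Qed.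

Lemma glob_inj (g h : G) : glob g = glob h :> gsec Q B X -> g = h.
Proof. by move=> /(congr1 (zero_ext X)); rewrite !zero_ext_glob. Qed.

Lemma lgen_zero_ext d (g : O d X) : lgen d (zero_ext X (val g)).
Proof. by move=> x; exact: gfun_locgen. Qed.

Lemma glob_mem d (g : G) : lgen d g -> (glob g : gsec Q B X) \in gfun_pred d (U:=X).
Proof. by move=> dg; apply/gfun_predP => x _; rewrite zero_ext_glob. Qed.

Definition global_fun d (g : G) : O d X :=
  if pselect (lgen d g) is left dg then GFun (glob_mem dg) else 0.

Lemma val_global_fun d (g : G) : lgen d g -> val (global_fun d g) = glob g.
Proof. by rewrite /global_fun; case: pselect. Qed.

Lemma global_fun_ext d (g : O d X) : global_fun d (zero_ext X (val g)) = g.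
Proof.
by apply: val_inj; rewrite val_global_fun ?glob_zero_ext //; exact: lgen_zero_ext.
Qed.

Lemma fun0E f : Defs.fun0 Q B f = global_fun 0 (deg0 Q B f).
Proof. by apply: val_inj; rewrite val_global_fun //; exact: lgen_deg0. Qed.
Lemma fun1E t : Defs.fun1 B t = global_fun 1 (deg1 B t : G).
Proof. by apply: val_inj; rewrite val_global_fun //; exact: lgen_deg1. Qed.
Lemma fun2E b : Defs.fun2 Q b = global_fun 2 (deg2 Q b : G).
Proof. by apply: val_inj; rewrite val_global_fun //; exact: lgen_deg2. Qed.

Section FromPoisson.
Variable P : poisson Q B.

(* Meaningful only for g and h of degrees d and e, [global_fun] being 0 otherwise. *)
Definition pbg d e (g h : G) : G :=
  zero_ext X (val (pb P (global_fun d g) (global_fun e h))).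
Arguments pbg : clear implicits.

Lemma val_restrict d (U V : opens M) (VU : V `<=` U) (g : O d U)
    (p : {x : M | opens_set V x}) :
  val (Defs.restrict VU g) p = val g (exist (opens_set U) (sval p) (VU (sval p) (svalP p))).
Proof. by []. Qed.

(** On a neighbourhood of p inside U the local functions and their global representatives have the
    same restrictions, and the bracket commutes with restriction. *)
Lemma pb_rep (U : opens M) d e (g : O d U) (h : O e U) (p : {x : M | opens_set U x}) g' h' :
  lgen d g' -> lgen e h' ->
  (\forall y \near sval p, zero_ext U (val g) y = g' y) ->
  (\forall y \near sval p, zero_ext U (val h) y = h' y) ->
  val (pb P g h) p = pbg d e g' h' (sval p).
Proof.
move=> dg eh gg hh.
have [V0 [oV0 V0p] V0P] : exists2 V, open_nbhs (sval p) V & forall y, V y ->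
    zero_ext U (val g) y = g' y /\ zero_ext U (val h) y = h' y.
  have : nbhs (sval p) [set y | zero_ext U (val g) y = g' y /\ zero_ext U (val h) y = h' y].
    by apply: filterS2 gg hh.
  by rewrite nbhsE => -[V oV VP]; exists V.
pose V := Opens (openI oV0 (@opens_open _ U)).
have VU : V `<=` U by move=> y [].
have VX : V `<=` X by [].
have Vp : opens_set V (sval p) by split => //; exact: (svalP p).
have Eg : Defs.restrict VU g = Defs.restrict VX (global_fun d g').
  apply: val_inj; apply: functional_extensionality_dep => -[y Vy].
  rewrite !val_restrict val_global_fun // -zero_extE /=.
  by have [-> _] := V0P y Vy.1.
have Eh : Defs.restrict VU h = Defs.restrict VX (global_fun e h').
  apply: val_inj; apply: functional_extensionality_dep => -[y Vy].
  rewrite !val_restrict val_global_fun // -zero_extE /=.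
  by have [_ ->] := V0P y Vy.1.
have := pb_restrict P VU g h; rewrite Eg Eh -pb_restrict => /(congr1 val).
move=> /(congr1 (fun f => f (exist (opens_set V) (sval p) Vp))); rewrite !val_restrict.
rewrite -(zero_extE _ p) -(zero_extE _ (exist (opens_set U) _ _))
  -(zero_extE _ (exist (opens_set X) _ _)) /=.
by [].
Qed.

Lemma poisson_gbracket : exists K : gbracket Q B, bk K = pbg.
Proof.
have near_refl (x : M) (g : G) : \forall y \near x, g y = g y by exact: nearW.
have pbgE d e g h : lgen d g -> lgen e h ->
    glob (pbg d e g h) = val (pb P (global_fun d g) (global_fun e h)).
  by move=> dg eh; rewrite /pbg glob_zero_ext.
unshelve eexists (GBracket (bk := pbg) _ _ _ _ _) => //.
- by move=> d e g h dg eh; exact: lgen_zero_ext.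
- move=> d e g g' h h' x dg dg' eh eh' gg hh.
  rewrite {1}/pbg -[x]/(sval (exist (opens_set X) x I)) zero_extE.
  refine (@pb_rep X d e _ _ (exist (opens_set X) x I) g' h' dg' eh' _ _).
  + by rewrite val_global_fun // zero_ext_glob.
  + by rewrite val_global_fun // zero_ext_glob.
- move=> d e a g g' h dg dg' eh; rewrite /pbg.
  have -> : global_fun d (a *: g + g') = a *: global_fun d g + global_fun d g'.
    apply: val_inj; rewrite [RHS]linearP /= !val_global_fun //.
    by move=> x; exact: locgenP.
  by rewrite pb_linear_l linearP zero_extP.
- move=> d e g h dg eh; rewrite /pbg pb_skew.
  by have := zero_extP (- (-1) ^ (d * e)) (val (pb P (global_fun e h) (global_fun d g))) 0;
    rewrite addr0 => ->;
    rewrite [X in _ + X](_ : _ = 0) ?addr0 //; apply: gfun_ext => x; rewrite /zero_ext; case: pselect.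
- move=> d1 d2 d3 g1 g2 g3 l1 l2 l3; apply: glob_inj.
  have l23 : lgen (d2 + d3) (g2 ** g3) by move=> x; exact: locgenM.
  rewrite pbgE //.
  have -> : global_fun (d2 + d3) (g2 ** g3) = omul (global_fun d2 g2) (global_fun d3 g3).
    by apply: val_inj; rewrite val_global_fun //= !val_global_fun.
  rewrite pb_leibniz /= -!pbgE // !val_global_fun //.
Qed.

Lemma pbg_jacobi (K : gbracket Q B) : bk K = pbg ->
  forall d1 d2 d3 g1 g2 g3, lgen d1 g1 -> lgen d2 g2 -> lgen d3 g3 ->
    jacobiator K d1 d2 d3 g1 g2 g3 = 0.
Proof.
move=> E d1 d2 d3 g1 g2 g3 l1 l2 l3; rewrite /jacobiator E.
apply: glob_inj; rewrite -[RHS]/(0 : gsec Q B X).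
have pbgE d e (g : O d X) (h : O e X) :
    glob (zero_ext X (val (pb P g h))) = val (pb P g h) by exact: glob_zero_ext.
rewrite -[LHS]/(glob (pbg d1 (d2 + d3 - 2) g1 (pbg d2 d3 g2 g3)) -
  glob (pbg (d1 + d2 - 2) d3 (pbg d1 d2 g1 g2) g3) -
  (-1) ^ (d1 * d2) *: glob (pbg d2 (d1 + d3 - 2) g2 (pbg d1 d3 g1 g3))).
rewrite /pbg !pbgE !global_fun_ext pb_jacobi.
by rewrite addrAC addrK subrr.
Qed.

End FromPoisson.

Lemma poisson_ext (P P' : poisson Q B) :
  (forall d e g h, lgen d g -> lgen e h -> pbg P d e g h = pbg P' d e g h) -> P = P'.
Proof.
move=> E.
have E1 : pb P = pb P'.
  apply: functional_extensionality_dep => U; apply: functional_extensionality_dep => d.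
  apply: functional_extensionality_dep => e; apply/funext => g; apply/funext => h.
  apply: val_inj; apply: functional_extensionality_dep => p.
  have [g' dg gg] := gfun_locgen g (svalP p); have [h' dh hh] := gfun_locgen h (svalP p).
  have lg := genz_lgen dg; have lh := genz_lgen dh.
  by rewrite (pb_rep P lg lh gg hh) (pb_rep P' lg lh gg hh) E.
case: P P' E1 {E} => [p1 a1 b1 c1 d1 e1 f1] [p2 a2 b2 c2 d2 e2 f2] /= E.
by subst p2; congr Poisson; exact: Prop_irrelevance.
Qed.

Section ToPoisson.
Variable K : gbracket Q B.
Hypothesis K_jacobi : forall d1 d2 d3 g1 g2 g3, lgen d1 g1 -> lgen d2 g2 ->
  lgen d3 g3 -> jacobiator K d1 d2 d3 g1 g2 g3 = 0.

(* Bump functions make every germ of a function on U the germ of a global one. *)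
Definition local_rep (U : opens M) d (g : O d U) (p : {x : M | opens_set U x}) : G :=
  s2val (cid2 (gfun_locgen g (svalP p))).
Arguments local_rep : clear implicits.

Lemma local_rep_lgen (U : opens M) d (g : O d U) (p : {x : M | opens_set U x}) :
  lgen d (local_rep U d g p).
Proof. exact: genz_lgen (s2valP (cid2 (gfun_locgen g (svalP p)))). Qed.

Lemma local_rep_near (U : opens M) d (g : O d U) (p : {x : M | opens_set U x}) :
  \forall y \near sval p, zero_ext U (val g) y = local_rep U d g p y.
Proof. exact: (s2valP' (cid2 (gfun_locgen g (svalP p)))). Qed.

Definition sheaf_bracket (U : opens M) d e (g : O d U) (h : O e U) : gsec Q B U :=
  fun p => bk K d e (local_rep U d g p) (local_rep U e h p) (sval p).

Arguments sheaf_bracket {U d e} g h.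

(** Independence of the chosen representatives. Each axiom at p may then use representatives adapted
    to it, such as sums and products of given ones. *)
Lemma sheaf_bracketE (U : opens M) d e (g : O d U) (h : O e U)
    (p : {x : M | opens_set U x}) g' h' :
  lgen d g' -> lgen e h' ->
  (\forall y \near sval p, zero_ext U (val g) y = g' y) ->
  (\forall y \near sval p, zero_ext U (val h) y = h' y) ->
  sheaf_bracket g h p = bk K d e g' h' (sval p).
Proof.
move=> dg eh gg hh.
refine (bk_local K (local_rep_lgen _ _) dg (local_rep_lgen _ _) eh _ _).
  by apply: filterS2 gg (local_rep_near g p) => y -> ->.
by apply: filterS2 hh (local_rep_near h p) => y -> ->.
Qed.

Lemma sheaf_bracket_near (U : opens M) d e (g : O d U) (h : O e U) x g' h' :
  opens_set U x -> lgen d g' -> lgen e h' ->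
  (\forall y \near x, zero_ext U (val g) y = g' y) ->
  (\forall y \near x, zero_ext U (val h) y = h' y) ->
  \forall y \near x, zero_ext U (sheaf_bracket g h) y = bk K d e g' h' y.
Proof.
move=> Ux dg eh /near_join gg /near_join hh.
have nU : nbhs x U by apply: open_nbhs_nbhs; split => //; exact: opens_open.
apply: filterS3 nU gg hh => y Uy gg hh.
rewrite -[y]/(sval (exist (opens_set U) y Uy)) zero_extE; exact: sheaf_bracketE.
Qed.

Lemma sheaf_bracket_mem (U : opens M) d e (g : O d U) (h : O e U) :
  sheaf_bracket g h \in gfun_pred (d + e - 2) (U:=U).
Proof.
apply/gfun_predP => x Ux.
have [g' dg gg] := gfun_locgen g Ux; have [h' dh hh] := gfun_locgen h Ux.
have lg := genz_lgen dg; have lh := genz_lgen dh.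
apply: locgen_eq (bk_lgen K lg lh x).
by apply: filterS (sheaf_bracket_near Ux lg lh gg hh) => y ->.
Qed.

Definition sheaf_pb (U : opens M) d e (g : O d U) (h : O e U) : O (d + e - 2) U :=
  GFun (sheaf_bracket_mem g h).

Lemma gfun_rep (U : opens M) d (g : O d U) (p : {x : M | opens_set U x}) : exists2 g', lgen d g' &
  \forall y \near sval p, zero_ext U (val g) y = g' y.
Proof.
by have [g' dg gg] := gfun_locgen g (svalP p); exists g' => //; exact: genz_lgen.
Qed.

Lemma zero_ext_restrict (U V : opens M) (VU : V `<=` U) d (g : O d U) x : opens_set V x ->
  \forall y \near x, zero_ext V (val (Defs.restrict VU g)) y = zero_ext U (val g) y.
Proof.
move=> Vx; have nV : nbhs x V by apply: open_nbhs_nbhs; split => //; exact: opens_open.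
apply: filterS nV => y Vy; rewrite -[y in LHS]/(sval (exist (opens_set V) y Vy)) zero_extE.
by rewrite val_restrict -zero_extE.
Qed.

Lemma gbracket_poisson : exists P : poisson Q B,
  forall d e g h, lgen d g -> lgen e h -> pbg P d e g h = bk K d e g h.
Proof.
have SE U d e (g : O d U) (h : O e U) (p : {x : M | opens_set U x}) :
    val (sheaf_pb g h) p = sheaf_bracket g h p by [].
unshelve eexists (Poisson (pb := sheaf_pb) _ _ _ _ _ _).
- move=> U V VU d e g h; apply: val_inj; apply: functional_extensionality_dep => p.
  rewrite val_restrict !SE; set p' := exist _ _ _.
  have [g' lg gg] := gfun_rep g p'; have [h' lh hh] := gfun_rep h p'.
  rewrite (sheaf_bracketE lg lh gg hh) (sheaf_bracketE (p := p) lg lh) //.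
  + by apply: filterS2 gg (zero_ext_restrict VU g (svalP p)) => y <- ->.
  + by apply: filterS2 hh (zero_ext_restrict VU h (svalP p)) => y <- ->.
- move=> U d e h a g1 g2; apply: val_inj; apply: functional_extensionality_dep => p.
  have [g1' l1 gg1] := gfun_rep g1 p; have [g2' l2 gg2] := gfun_rep g2 p.
  have [h' lh hh] := gfun_rep h p.
  rewrite [val (_ + _)]linearP -[RHS]/(a *: sheaf_bracket g1 h p + sheaf_bracket g2 h p).
  rewrite SE (sheaf_bracketE l1 lh gg1 hh) (sheaf_bracketE l2 lh gg2 hh).
  have l3 : lgen d (a *: g1' + g2') by move=> x; exact: locgenP.
  rewrite (sheaf_bracketE l3 lh _ hh) ?bk_linl //.
  rewrite linearP; apply: filterS2 gg1 gg2 => y e1 e2; rewrite zero_extP.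
  by rewrite -[RHS]/(a *: g1' y + g2' y) -e1 -e2.
- move=> U d e g a h1 h2; apply: val_inj; apply: functional_extensionality_dep => p.
  have [h1' l1 gg1] := gfun_rep h1 p; have [h2' l2 gg2] := gfun_rep h2 p.
  have [g' lh hh] := gfun_rep g p.
  rewrite [val (_ + _)]linearP -[RHS]/(a *: sheaf_bracket g h1 p + sheaf_bracket g h2 p).
  rewrite SE (sheaf_bracketE lh l1 hh gg1) (sheaf_bracketE lh l2 hh gg2).
  have l3 : lgen e (a *: h1' + h2') by move=> x; exact: locgenP.
  rewrite (sheaf_bracketE lh l3 hh) ?bk_linr //.
  rewrite linearP; apply: filterS2 gg1 gg2 => y e1 e2; rewrite zero_extP.
  by rewrite -[RHS]/(a *: h1' y + h2' y) -e1 -e2.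
- move=> U d e g h; apply: functional_extensionality_dep => p.
  have [g' lg gg] := gfun_rep g p; have [h' lh hh] := gfun_rep h p.
  rewrite -[RHS]/(- (-1) ^ (d * e) *: sheaf_bracket h g p) SE.
  by rewrite (sheaf_bracketE lg lh gg hh) (sheaf_bracketE lh lg hh gg) bk_skew.
- move=> U d1 d2 d3 g1 g2 g3; apply: functional_extensionality_dep => p.
  have [g1' l1 gg1] := gfun_rep g1 p; have [g2' l2 gg2] := gfun_rep g2 p.
  have [g3' l3 gg3] := gfun_rep g3 p.
  have l23 : lgen (d2 + d3) (g2' ** g3') by move=> x; exact: locgenM.
  rewrite -[RHS]/(wedge (sheaf_bracket g1 g2 p) (val g3 p) +
    (-1) ^ (d1 * d2) *: (wedge (val g2 p) (sheaf_bracket g1 g3 p) : gfib Q B (sval p))).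
  rewrite SE (sheaf_bracketE l1 l2 gg1 gg2) (sheaf_bracketE l1 l3 gg1 gg3).
  rewrite (sheaf_bracketE l1 l23 gg1) ?bk_leibniz //.
    by rewrite -!zero_extE (nbhs_singleton gg3) (nbhs_singleton gg2).
  by rewrite zero_ext_mul; apply: filterS2 gg2 gg3 => y e2 e3; rewrite /mulg e2 e3.
- move=> U d1 d2 d3 g1 g2 g3; apply: functional_extensionality_dep => p.
  have [g1' l1 gg1] := gfun_rep g1 p; have [g2' l2 gg2] := gfun_rep g2 p.
  have [g3' l3 gg3] := gfun_rep g3 p.
  have Up := svalP p.
  (* For iterated brackets agreement at p is too weak: the bracket of representatives has to
     represent the inner bracket on a whole neighbourhood. *)
  have n12 : \forall y \near sval p, zero_ext U (val (sheaf_pb g1 g2)) y =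
      bk K d1 d2 g1' g2' y by exact: (sheaf_bracket_near Up l1 l2 gg1 gg2).
  have n13 : \forall y \near sval p, zero_ext U (val (sheaf_pb g1 g3)) y =
      bk K d1 d3 g1' g3' y by exact: (sheaf_bracket_near Up l1 l3 gg1 gg3).
  have n23 : \forall y \near sval p, zero_ext U (val (sheaf_pb g2 g3)) y =
      bk K d2 d3 g2' g3' y by exact: (sheaf_bracket_near Up l2 l3 gg2 gg3).
  have lb := bk_lgen K.
  rewrite -[RHS]/(sheaf_bracket (sheaf_pb g1 g2) g3 p +
    (-1) ^ (d1 * d2) *: sheaf_bracket g2 (sheaf_pb g1 g3) p) SE.
  rewrite (sheaf_bracketE l1 (lb _ _ _ _ l2 l3) gg1 n23).
  rewrite (sheaf_bracketE (lb _ _ _ _ l1 l2) l3 n12 gg3).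
  rewrite (sheaf_bracketE l2 (lb _ _ _ _ l1 l3) gg2 n13).
  have /eqP := K_jacobi l1 l2 l3; rewrite /jacobiator subr_eq0 subr_eq => /eqP ->.
  by rewrite addrC.
- move=> d e g h lg lh; apply: gfun_ext => x.
  rewrite /pbg -[x]/(sval (exist (opens_set X) x I)) zero_extE /=.
  refine (@sheaf_bracketE X d e _ _ (exist (opens_set X) x I) _ _ lg lh _ _).
    by rewrite val_global_fun // zero_ext_glob; exact: nearW.
  by rewrite val_global_fun // zero_ext_glob; exact: nearW.
Qed.

End ToPoisson.
End SheafBracket.
Arguments pbg {R M Q B} P d e g h.

(** * The bracket of a 2-representation *)

Lemma wedge_precomp (R : realType) (V W W' : Type) (f : W' -> W)
    (w h : seq V -> W -> R^o) s z :
  wedge w h s (f z) = wedge (fun s z => w s (f z)) (fun s z => h s (f z)) s z.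
Proof. by elim: s w h => [//|v s IH] w h; rewrite /= !IH. Qed.

(** * Differentiation at a point in chosen frames *)

Section SmoothGerms.
Variables (R : realType) (M : manifold R) (x : M).

(** A global representative is required because tangent vectors act on [Cinf M] only. *)
Definition smooth_germ (phi : M -> R) :=
  exists f : Cinf M, \forall y \near x, phi y = f y.

Lemma smooth_germ_Cinf (f : Cinf M) : smooth_germ f.
Proof. by exists f; exact: nearW. Qed.

Lemma smooth_germD phi chi : smooth_germ phi -> smooth_germ chi ->
  smooth_germ (fun y => phi y + chi y).
Proof.
move=> [f pf] [g cg]; exists (f + g); apply: filterS2 pf cg => y -> -> //.
Qed.

Lemma smooth_germM phi chi : smooth_germ phi -> smooth_germ chi ->
  smooth_germ (fun y => phi y * chi y).
Proof.
move=> [f pf] [g cg]; exists (f * g); apply: filterS2 pf cg => y -> -> //.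
Qed.

Lemma smooth_germZ a phi : smooth_germ phi -> smooth_germ (fun y => a * phi y).
Proof.
move=> [f pf]; exists (Cinf_cst M a * f); apply: filterS pf => y -> //.
Qed.

(* The value 0 for functions that are not smooth near x is a junk value. *)
Definition germ_deriv (v : Cinf M -> R) (phi : M -> R) : R :=
  if pselect (smooth_germ phi) is left sp then v (projT1 (cid sp)) else 0.

Section Tangent.
Variable v : Cinf M -> R.
Hypothesis tv : tangent x v.

Lemma germ_derivE phi (f : Cinf M) :
  (\forall y \near x, phi y = f y) -> germ_deriv v phi = v f.
Proof.
move=> pf; rewrite /germ_deriv; case: pselect => [sp|[]]; last by exists f.
apply: (tangent_near tv); case: (cid sp) => g /= pg.
by apply: filterS2 pf pg => y -> ->.
Qed.

Lemma germ_derivD phi chi : smooth_germ phi -> smooth_germ chi ->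
  germ_deriv v (fun y => phi y + chi y) = germ_deriv v phi + germ_deriv v chi.
Proof.
move=> [f pf] [g cg]; rewrite (germ_derivE pf) (germ_derivE cg) -(tangentD tv).
by apply: germ_derivE; apply: filterS2 pf cg => y -> ->.
Qed.

Lemma germ_derivM phi chi : smooth_germ phi -> smooth_germ chi ->
  germ_deriv v (fun y => phi y * chi y) =
  germ_deriv v phi * chi x + phi x * germ_deriv v chi.
Proof.
move=> [f pf] [g cg]; rewrite (germ_derivE pf) (germ_derivE cg).
rewrite (nbhs_singleton pf) (nbhs_singleton cg) -(tangentM tv).
by apply: germ_derivE; apply: filterS2 pf cg => y -> ->.
Qed.

Lemma germ_derivZ a phi : smooth_germ phi ->
  germ_deriv v (fun y => a * phi y) = a * germ_deriv v phi.
Proof.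
move=> [f pf]; rewrite (germ_derivE pf) -(tangentZ tv).
by apply: germ_derivE; apply: filterS pf => y ->.
Qed.

Lemma germ_deriv_near phi chi : smooth_germ phi ->
  (\forall y \near x, phi y = chi y) -> germ_deriv v phi = germ_deriv v chi.
Proof.
move=> [f pf] pc; rewrite (germ_derivE pf); apply/esym/germ_derivE.
by apply: filterS2 pf pc => y <- ->.
Qed.

End Tangent.
End SmoothGerms.

Section Derivations.
Variables (R : realType) (M : manifold R) (Q B : vbundle M) (x : M).
Local Notation G := (dfun (gfib Q B)).
Local Notation F := (gfib Q B x).
Local Infix "**" := mulg (at level 40).
Implicit Types (g h : G) (d e : int).

Definition coextend (z : dual B x) : Gamma (dual B) :=
  \sum_j Cinf_cst M (z (frame B x j x)) *: coframe B x j.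

Lemma coextend_at z : coextend z x = z.
Proof. by rewrite sec_sumE -coframe_expand. Qed.

(** The arguments s and z, given over x, are moved to y with constant coefficients in the frames; g
    becomes a family of real functions on M that tangent vectors can differentiate. *)
Definition along_frame g s z (y : M) : R :=
  g y (map (fun q : Q x => extend q y) s) (coextend z y).

Lemma along_frame_at g s z : along_frame g s z x = g x s z.
Proof.
rewrite /along_frame coextend_at; congr (g x _ z).
by rewrite -[RHS]map_id; apply: eq_map => q; exact: extend_at.
Qed.

Lemma along_frameM g h s z y : along_frame (g ** h) s z y =
  wedge (fun s z => along_frame g s z y) (fun s z => along_frame h s z y) s z.
Proof. by rewrite /along_frame /mulg; exact: wedge_mapl. Qed.

Definition along_fiber (z0 : dual B x) g s z (e : R) : R := g x s (z + e *: z0).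

Lemma along_fiberM z0 g h s z (e : R) : along_fiber z0 (g ** h) s z e =
  wedge (fun s z => along_fiber z0 g s z e) (fun s z => along_fiber z0 h s z e) s z.
Proof. exact: (wedge_precomp (fun z => z + e *: z0)). Qed.

(* [hor v g] is the derivative of g along v in the trivial connection of the frames at
   x, and [vert z0 g] that of the polynomial g x along z0 in B_x^*. *)
Definition hor (v : Cinf M -> R) g : F :=
  fun s z => germ_deriv x v (along_frame g s z).

Definition vert (z0 : dual B x) g : F :=
  fun s z => 'D_1 (along_fiber z0 g s z) 0.

Lemma hor_mul v g h : tangent x v ->
  (forall s z, smooth_germ x (along_frame g s z)) ->
  (forall s z, smooth_germ x (along_frame h s z)) ->
  (forall s z, smooth_germ x (along_frame (g ** h) s z)) /\
  hor v (g ** h) = (wedge (hor v g) (h x) : F) + wedge (g x) (hor v h).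
Proof.
move=> tv sg sh.
have W s z := @wedge_derivation R (Q x) (dual B x) M x (smooth_germ x)
  (germ_deriv x v) (@smooth_germD _ _ _) (@smooth_germM _ _ _)
  (@smooth_germZ _ _ _) (@germ_derivD _ _ _ _ tv) (@germ_derivM _ _ _ _ tv)
  (@germ_derivZ _ _ _ _ tv) (fun y s z => along_frame g s z y)
  (fun y s z => along_frame h s z y) s z (fun s => sg s z) (fun s => sh s z).
have E s z : along_frame (g ** h) s z =
    fun y => wedge (fun s z => along_frame g s z y) (fun s z => along_frame h s z y) s z.
  by apply/funext => y; exact: along_frameM.
have E0 k : (fun s z => along_frame k s z x) = k x.
  by apply/funext => s; apply/funext => z; exact: along_frame_at.
split=> [s z|]; first by rewrite E; case: (W s z).
apply/funext => s; apply/funext => z; rewrite /hor E.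
by have [_ ->] := W s z; rewrite !E0.
Qed.

Lemma vert_mul z0 g h :
  (forall s z, derivable (along_fiber z0 g s z) 0 1) ->
  (forall s z, derivable (along_fiber z0 h s z) 0 1) ->
  (forall s z, derivable (along_fiber z0 (g ** h) s z) 0 1) /\
  vert z0 (g ** h) = (wedge (vert z0 g) (h x) : F) + wedge (g x) (vert z0 h).
Proof.
move=> sg sh.
pose S (f : R -> R) := derivable f 0 1.
have SD f f' : S f -> S f' -> S (fun y => f y + f' y) by exact: derivableD.
have SM f f' : S f -> S f' -> S (fun y => f y * f' y) by exact: derivableM.
have SZ a f : S f -> S (fun y => a * f y) by exact: derivableZ.
have DD f f' : S f -> S f' -> 'D_1 (fun y => f y + f' y) 0 = 'D_1 f 0 + 'D_1 f' 0 by exact: deriveD.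
have DM f f' : S f -> S f' -> 'D_1 (fun y => f y * f' y) 0 = 'D_1 f 0 * f' 0 + f 0 * 'D_1 f' 0.
  by move=> Sf Sf'; rewrite [LHS](deriveM Sf Sf') addrC [X in X + _ = _]mulrC.
have DZ a f : S f -> 'D_1 (fun y => a * f y) 0 = a * 'D_1 f 0 by exact: deriveZ.
have W s z := @wedge_derivation R (Q x) (dual B x) R 0 S (fun f => 'D_1 f 0)
  SD SM SZ DD DM DZ (fun (e : R) s z => along_fiber z0 g s z e)
  (fun (e : R) s z => along_fiber z0 h s z e) s z (fun s => sg s z) (fun s => sh s z).
have E s z : along_fiber z0 (g ** h) s z =
    fun y => wedge (fun s z => along_fiber z0 g s z y) (fun s z => along_fiber z0 h s z y) s z.
  by apply/funext => y; exact: along_fiberM.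
have E0 k : (fun s z => along_fiber z0 k s z 0) = k x.
  by apply/funext => s; apply/funext => z; rewrite /along_fiber scale0r addr0.
split=> [s z|]; first by rewrite E; case: (W s z).
apply/funext => s; apply/funext => z; rewrite /vert E.
by have [_ ->] := W s z; rewrite !E0.
Qed.

Lemma generated_smooth n g : generated n g ->
  (forall s z, smooth_germ x (along_frame g s z)) /\
  (forall z0 s z, derivable (along_fiber z0 g s z) 0 1).
Proof.
have z_smooth : smooth_germ x (fun=> 0) by exact: (smooth_germ_Cinf x 0).
have cd (c : R) : derivable (fun=> c : R) (0 : R) 1 by exact: derivable_cst.
(* The zero vector feeds [hor_mul], of which only the smoothness half is used here. *)
have t0 : tangent x (fun=> 0) by split=> *; rewrite ?(mulr0, mul0r) addr0.
elim=> {n g} [f|t|b|n|n a g h _ [IHg IHg'] _ [IHh IHh']|m n g h _ [IHg IHg'] _ [IHh IHh']].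
- split=> [s z|z0 s z]; last by rewrite /along_fiber /deg0; case: s => *; exact: cd.
  rewrite /along_frame; case: s => [|q s] //; exact: smooth_germ_Cinf.
- split=> [s z|z0 s z].
    rewrite /along_frame; case: s => [|q [|q' s]] //=.
    exact: (smooth_germ_Cinf x (pairing t (extend q))).
  by rewrite /along_fiber /deg1; case: s => [|q [|q' s]] *; exact: cd.
- split=> [s z|z0 s z].
    rewrite /along_frame; case: s => [|q s] //=.
    exact: (smooth_germ_Cinf x (pairing (coextend z) b)).
  rewrite /along_fiber /deg2; case: s => [|q s] *; last exact: cd.
  rewrite (_ : (fun e : R => _) = fun e : R => z (b x) + e * z0 (b x)); last first.
    by apply/funext => e; rewrite add_lfunE scale_lfunE.
  apply: derivableD; first exact: cd.
  by apply: derivableM; [exact: derivable_id|exact: cd].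
- by split=> *; [exact: z_smooth|exact: cd].
- split=> [s z|z0 s z].
    by apply: smooth_germD; [apply: smooth_germZ; exact: IHg|exact: IHh].
  by apply: derivableD; [apply: derivableZ; exact: IHg'|exact: IHh'].
- split; first by case: (hor_mul t0 IHg IHh).
  by move=> z0; case: (vert_mul (IHg' z0) (IHh' z0)).
Qed.

Lemma locgen_smooth d g s z : locgen x d g -> smooth_germ x (along_frame g s z).
Proof.
move=> [h dh gh].
have [f fh] : smooth_germ x (along_frame h s z).
  case: d dh => [n|n] /=; first by move=> /generated_smooth[].
  by move=> ->; exact: (smooth_germ_Cinf x 0).
by exists f; apply: filterS2 gh fh => y gh <-; rewrite /along_frame gh.
Qed.

Lemma locgen_derivable d g z0 s z : locgen x d g ->
  derivable (along_fiber z0 g s z) 0 1.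
Proof.
move=> [h dh /nbhs_singleton gh]; rewrite /along_fiber gh.
case: d dh => [n|n] /=; first by move=> /generated_smooth[_]; exact.
by move=> ->; exact: derivable_cst.
Qed.

Lemma horM v d e g h : tangent x v -> locgen x d g -> locgen x e h ->
  hor v (g ** h) = (wedge (hor v g) (h x) : F) + wedge (g x) (hor v h).
Proof.
move=> tv dg eh; have [] // := hor_mul tv (fun s z => (@locgen_smooth d _ s z dg))
  (fun s z => (@locgen_smooth e _ s z eh)).
Qed.

Lemma vertM z0 d e g h : locgen x d g -> locgen x e h ->
  vert z0 (g ** h) = (wedge (vert z0 g) (h x) : F) + wedge (g x) (vert z0 h).
Proof.
move=> dg eh; have [] // := @vert_mul z0 g h (fun s z => (@locgen_derivable d _ z0 s z dg))
  (fun s z => (@locgen_derivable e _ z0 s z eh)).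
Qed.

Lemma horP v d a g h : tangent x v -> locgen x d g -> locgen x d h ->
  hor v (a *: g + h) = a *: hor v g + hor v h.
Proof.
move=> tv dg dh; apply/funext => s; apply/funext => z.
have sg := (@locgen_smooth d _ s z dg); have sh := (@locgen_smooth d _ s z dh).
rewrite -[LHS]/(germ_deriv x v (fun y => a * along_frame g s z y + along_frame h s z y)).
by rewrite (germ_derivD tv (smooth_germZ a sg) sh) (germ_derivZ tv _ sg).
Qed.

Lemma vertP z0 d a g h : locgen x d g -> locgen x d h ->
  vert z0 (a *: g + h) = a *: vert z0 g + vert z0 h.
Proof.
move=> dg dh; apply/funext => s; apply/funext => z.
have sg := (@locgen_derivable d _ z0 s z dg); have sh := (@locgen_derivable d _ z0 s z dh).
rewrite -[LHS]/('D_1 (fun y => a * along_fiber z0 g s z y + along_fiber z0 h s z y) 0).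
have saz : derivable (a *: along_fiber z0 g s z : R -> R) 0 1 by exact: derivableZ.
have saD : 'D_1 (a *: along_fiber z0 g s z : R -> R) 0 = a * vert z0 g s z by exact: deriveZ.
by rewrite [LHS](deriveD saz sh) saD.
Qed.

Lemma hor_homog v d g : tangent x v -> locgen x d g -> homog (odz d) (hor v g).
Proof.
move=> tv dg; apply/funext => s; apply/funext => z; rewrite /flip /hor.
have sg := (@locgen_smooth d _ s z dg).
rewrite -(germ_derivZ tv _ sg) -[RHS]/((-1) ^+ odz d * germ_deriv x v (along_frame g s z)).
rewrite -(germ_derivZ tv _ sg).
apply: (germ_deriv_near tv); first exact: smooth_germZ.
apply: filterS (locgen_near dg) => y /locgen_homog.
move=> /(congr1 (fun k => k (map (fun q : Q x => extend q y) s) (coextend z y))).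
by rewrite /flip size_map.
Qed.

Lemma vert_homog z0 d g : locgen x d g -> homog (odz d) (vert z0 g).
Proof.
move=> dg; apply/funext => s; apply/funext => z; rewrite /flip /vert.
have sg := (@locgen_derivable d _ z0 s z dg).
rewrite -[RHS]/((-1) ^+ odz d * 'D_1 (along_fiber z0 g s z) 0).
have saD (a : R) : a * 'D_1 (along_fiber z0 g s z) 0 = 'D_1 (a *: along_fiber z0 g s z : R -> R) 0.
  by apply/esym; exact: deriveZ.
rewrite [LHS]saD [RHS]saD.
apply: (congr1 (fun f : R -> R => 'D_1 f (0 : R))); apply/funext => e.
exact: (congr1 (fun k => k s (z + e *: z0)) (locgen_homog dg)).
Qed.

Lemma hor_near v d g h : tangent x v -> locgen x d g ->
  (\forall y \near x, g y = h y) -> hor v g = hor v h.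
Proof.
move=> tv dg gh; apply/funext => s; apply/funext => z.
apply: (germ_deriv_near tv); first exact: locgen_smooth dg.
by apply: filterS gh => y; rewrite /along_frame => ->.
Qed.

Lemma vert_near z0 g h : g x = h x -> vert z0 g = vert z0 h.
Proof. by rewrite /vert /along_fiber => ->. Qed.

Lemma hor_deg0 v f : tangent x v -> hor v (deg0 Q B f) = scalar_form (v f).
Proof.
move=> tv; apply/funext => s; apply/funext => z; rewrite /hor.
case: s => [|q s].
  by rewrite [LHS](germ_derivE tv (f := f)) //; exact: nearW.
rewrite [LHS](germ_derivE tv (f := 0)) ?(tangent0 tv) //; exact: nearW.
Qed.

Lemma hor_deg1 v t : tangent x v -> hor v (deg1 B t : G) =
  \sum_i v (pairing t (frame Q x i)) *: (deg1 B (coframe Q x i) : G) x.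
Proof.
move=> tv; apply/funext => s; apply/funext => z.
have sumE (I : finType) (f : I -> F) : (\sum_i f i) s z = \sum_i f i s z.
  exact: (big_morph (fun k : F => k s z)).
rewrite sumE /hor; case: s sumE => [|q [|q' s]] sumE.
- rewrite [LHS](germ_derivE tv (f := 0)) ?(tangent0 tv); last exact: nearW.
  by rewrite big1 // => i _; exact: mulr0.
- rewrite [LHS](germ_derivE tv (f := pairing t (extend q))); last exact: nearW.
  rewrite (_ : pairing t (extend q) =
    \sum_i Cinf_cst M (coframe Q x i x q) * pairing t (frame Q x i)).
    rewrite (tangent_sum tv); apply: eq_bigr => i _.
    by rewrite (tangentZ tv) -[RHS]/(v (pairing t (frame Q x i)) * coframe Q x i x q) mulrC.
  apply: Cinf_ext => y; rewrite Cinf_sumE -[LHS]/(t y (extend q y)) /extend sec_sumE linear_sum.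
  apply: eq_bigr => i _.
  by rewrite -[LHS]/(t y (coframe Q x i x q *: frame Q x i y)) linearZ.
- rewrite [LHS](germ_derivE tv (f := 0)) ?(tangent0 tv); last exact: nearW.
  by rewrite big1 // => i _; exact: mulr0.
Qed.

Lemma hor_deg2 v b : tangent x v -> hor v (deg2 Q b : G) =
  \sum_j v (pairing (coframe B x j) b) *: (deg2 Q (frame B x j) : G) x.
Proof.
move=> tv; apply/funext => s; apply/funext => z.
have sumE (I : finType) (f : I -> F) : (\sum_i f i) s z = \sum_i f i s z.
  exact: (big_morph (fun k : F => k s z)).
rewrite sumE /hor; case: s sumE => [|q s] sumE.
- rewrite [LHS](germ_derivE tv (f := pairing (coextend z) b)); last exact: nearW.
  rewrite (_ : pairing (coextend z) b =
    \sum_j Cinf_cst M (z (frame B x j x)) * pairing (coframe B x j) b).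
    rewrite (tangent_sum tv); apply: eq_bigr => j _.
    by rewrite (tangentZ tv) -[RHS]/(v (pairing (coframe B x j) b) * z (frame B x j x)) mulrC.
  apply: Cinf_ext => y; rewrite Cinf_sumE -[LHS]/(coextend z y (b y)) /coextend sec_sumE sum_lfunE.
  apply: eq_bigr => i _.
  by rewrite -[LHS]/((z (frame B x i x) *: coframe B x i y) (b y)) scale_lfunE.
- rewrite [LHS](germ_derivE tv (f := 0)) ?(tangent0 tv); last exact: nearW.
  by rewrite big1 // => i _; exact: mulr0.
Qed.

Lemma vert_deg0 z0 f : vert z0 (deg0 Q B f) = 0.
Proof. by apply/funext => s; apply/funext => z; exact: derive_cst. Qed.

Lemma vert_deg1 z0 t : vert z0 (deg1 B t : G) = 0.
Proof. by apply/funext => s; apply/funext => z; exact: derive_cst. Qed.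

Lemma vert_deg2 z0 b : vert z0 (deg2 Q b : G) = scalar_form (z0 (b x)).
Proof.
apply/funext => s; apply/funext => z; case: s => [|q s]; last exact: derive_cst.
rewrite /vert (_ : along_fiber _ _ _ _ = fun e : R => z (b x) + e * z0 (b x)); last first.
  by apply/funext => e; rewrite /along_fiber /deg2 add_lfunE scale_lfunE.
have di : derivable (fun e : R => e) (0 : R) 1 by exact: derivable_id.
have dc (c : R) : derivable (fun=> c) (0 : R) 1 by exact: derivable_cst.
have d1 : derivable (fun e : R => e * z0 (b x)) (0 : R) 1 by exact: (derivableM di (dc _)).
have Dc (c : R) : 'D_1 (fun=> c) (0 : R) = 0 by exact: derive_cst.
have Di : 'D_1 (fun e : R => e) (0 : R) = 1 by exact: derive_id.
rewrite [LHS](deriveD (dc _) d1) Dc add0r.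
by rewrite [LHS](deriveM di (dc _)) Dc Di scaler0 add0r [LHS]mulr1.
Qed.

Lemma contraction_deg0 q f : contraction q ((deg0 Q B f : G) x) = 0.
Proof. by []. Qed.

Lemma contraction_deg1 q t : contraction q ((deg1 B t : G) x) = scalar_form (t x q).
Proof. by apply/funext => s; apply/funext => z; case: s. Qed.

Lemma contraction_deg2 q b : contraction q ((deg2 Q b : G) x) = 0.
Proof. by []. Qed.

End Derivations.

Lemma addr3ACA (V : zmodType) (u1 u2 u3 w1 w2 w3 : V) :
  (u1 + w1) + (u2 + w2) + (u3 + w3) = u1 + u2 + u3 + (w1 + w2 + w3).
Proof. by rewrite (addrACA u1) (addrACA (u1 + u2)). Qed.

(** * Derivations at a point with prescribed values on generators *)

Section FrameDerivations.
Variables (R : realType) (M : manifold R) (Q B : vbundle M) (x : M).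
Variable v : 'I_(vrank B) -> Cinf M -> R.
Hypothesis tv : forall j, tangent x (v j).
Local Notation G := (dfun (gfib Q B)).
Local Notation F := (gfib Q B x).
Local Infix "**" := mulg (at level 40).
Implicit Types (g h : G) (d e : int) (c beta : 'I_(vrank B) -> F)
  (tau : 'I_(vrank Q) -> F).

(** The general derivation in the frames at x, with values in the fibre: it takes f to [symbol f],
    q^i to tau i and e_j to beta j. The derivations {t, .}, {b, .} and {g, .} are all of this
    form. *)
Definition der c tau beta g : F :=
  \sum_j (wedge (c j) (hor (v j) g) : F) +
  \sum_i (wedge (tau i) (contraction (frame Q x i x) (g x)) : F) +
  \sum_j (wedge (beta j) (vert (coframe B x j x) g) : F).

Lemma der_linear c tau beta d a g h : locgen x d g -> locgen x d h ->
  der c tau beta (a *: g + h) = a *: der c tau beta g + der c tau beta h.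
Proof.
move=> dg dh; rewrite /der !scalerDr.
rewrite -addr3ACA; congr (_ + _ + _); rewrite scaler_sumr -big_split; apply: eq_bigr => j _ /=.
- by rewrite (horP _ (tv j) dg dh) -wedgePr.
- by rewrite -wedgePr.
- by rewrite (vertP _ _ dg dh) -wedgePr.
Qed.

Lemma der_near c tau beta d g h : locgen x d g ->
  (\forall y \near x, g y = h y) -> der c tau beta g = der c tau beta h.
Proof.
move=> dg gh; have gx := nbhs_singleton gh; rewrite /der gx.
congr (_ + _ + _); apply: eq_bigr => j _; first by rewrite (hor_near (tv j) dg gh).
by rewrite (vert_near _ gx).
Qed.

Lemma der_coef a c tau beta c' tau' beta' g :
  der (fun j => a *: c j + c' j) (fun i => a *: tau i + tau' i)
      (fun j => a *: beta j + beta' j) g =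
  a *: der c tau beta g + der c' tau' beta' g.
Proof.
rewrite /der !scalerDr.
rewrite -addr3ACA; congr (_ + _ + _); rewrite scaler_sumr -big_split;
  by apply: eq_bigr => j _ /=; rewrite -wedgePl.
Qed.

Lemma der_homog b c tau beta d g : (forall j, homog b (c j)) ->
  (forall i, homog (~~ b) (tau i)) -> (forall j, homog b (beta j)) ->
  locgen x d g -> homog (b (+) odz d) (der c tau beta g).
Proof.
move=> hc ht hb dg; rewrite /der.
have hsum (I : finType) (f : I -> F) (e : bool) : (forall i, homog e (f i)) -> homog e (\sum_i f i).
  by move=> hf; apply: big_ind => //; [exact: homog0|exact: homogD].
apply: homogD; first apply: homogD; apply: hsum => j.
- by apply: homog_wedge => //; exact: hor_homog.
- have -> : b (+) odz d = ~~ b (+) ~~ odz d by rewrite addNb addbN negbK.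
  by apply: homog_wedge => //; apply: homog_contraction; exact: locgen_homog.
- by apply: homog_wedge => //; exact: vert_homog.
Qed.

(** Contraction is odd while [hor] and [vert] are even, so coefficients of parity [~~ b] on the
    former and b on the latter combine to a derivation of parity b. *)
Lemma der_mul b c tau beta d e g h : (forall j, homog b (c j)) ->
  (forall i, homog (~~ b) (tau i)) -> (forall j, homog b (beta j)) ->
  locgen x d g -> locgen x e h ->
  der c tau beta (g ** h) = (wedge (der c tau beta g) (h x) : F) +
    (-1) ^+ (b && odz d) *: (wedge (g x) (der c tau beta h) : F).
Proof.
move=> hc ht hb dg eh; have hg := locgen_homog dg.
rewrite /der !(wedgeDl, wedgeDr) !(wedge_suml, wedge_sumr) !scalerDr -addr3ACA.
have even_case (k u w : F) : homog b k ->
    wedge k ((wedge u (h x) : F) + wedge (g x) w) =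
    (wedge (wedge k u) (h x) : F) + (-1) ^+ (b && odz d) *: (wedge (g x) (wedge k w) : F) :> F.
  by move=> hk; rewrite wedgeDr !wedgeA (wedgeC hk hg) wedgeZl.
congr (_ + _ + _); rewrite scaler_sumr -big_split; apply: eq_bigr => j _ /=.
- by rewrite (horM (tv j) dg eh) even_case.
- have -> : contraction (frame Q x j x) ((g ** h) x) =
     (wedge (contraction (frame Q x j x) (g x)) (h x) : F) +
      wedge (flip (g x)) (contraction (frame Q x j x) (h x)) by [].
  rewrite hg wedgeZl wedgeDr wedgeZr !wedgeA (wedgeC (ht j) hg) wedgeZl scalerA.
  by rewrite -signr_addb; congr (_ + _ ^+ _ *: _); case: (b) (odz d) => [] [].
- by rewrite (vertM _ dg eh) even_case.
Qed.

Section Values.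
Variables (c beta : 'I_(vrank B) -> F) (tau : 'I_(vrank Q) -> F).

Definition symbol (f : Cinf M) : F := \sum_j v j f *: c j.

Lemma symbol_const (f : Cinf M) r : (\forall y \near x, f y = r) -> symbol f = 0.
Proof.
move=> fr; rewrite /symbol big1 // => j _.
by rewrite (tangent_near (tv j) (g := Cinf_cst M r)) // (tangent_cst (tv j)) scale0r.
Qed.

(** The analogue of [tensorial_sum] for first-order operators. They are local too, because the
    symbol of a bump function vanishes where that function is constant. *)
Lemma first_order_expand (E : vbundle M) (T D : Gamma E -> F) (n : nat)
    (f : 'I_n -> Cinf M) (e : 'I_n -> Gamma E) (s : Gamma E) :
  (forall s s', T (s + s') = T s + T s') ->
  (forall f s, T (f *: s) = f x *: T s + wedge (symbol f) (D s)) ->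
  (\forall y \near x, s y = (\sum_i f i *: e i) y) ->
  T s = \sum_i (f i x *: T (e i) + (wedge (symbol (f i)) (D (e i)) : F)).
Proof.
move=> TD TZ; rewrite /prop_near1 nbhsE => -[V [oV Vx] ss].
have T0 : T 0 = 0 by apply: (addrI (T 0)); rewrite -TD !addr0.
transitivity (T (\sum_i f i *: e i)); last first.
  by rewrite (big_morph T TD T0); apply: eq_bigr => i _; rewrite TZ.
have [psi [C [_ CV psi0 psi1]]] := bump_function oV Vx.
have E0 : psi *: s = psi *: (\sum_i f i *: e i).
  apply: sec_ext => y; rewrite -[LHS]/(psi y *: s y) -[RHS]/(psi y *: (\sum_i f i *: e i) y).
  have [/CV/ss <-//|nC] := pselect (C y).
  by rewrite psi0 // !scale0r.
have := congr1 T E0; rewrite !TZ (symbol_const psi1) !wedge_0l !addr0.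
by rewrite (nbhs_singleton psi1) !scale1r.
Qed.

Lemma der_deg0 f : der c tau beta (deg0 Q B f) = symbol f.
Proof.
rewrite /der [X in _ + X]big1 ?addr0; last first.
  by move=> j _; rewrite vert_deg0 wedge_0r.
rewrite [X in _ + X]big1 ?addr0; last by move=> j _; rewrite contraction_deg0 wedge_0r.
by apply: eq_bigr => j _; rewrite hor_deg0 ?wedge_scalarr.
Qed.

(** Two first-order operators with the same symbol agree once they agree on the coframe. When T is
    frame-free, this removes the frames from the value on every section. *)
Lemma der_deg1 (T : Gamma (dual Q) -> F) :
  (forall s s', T (s + s') = T s + T s') ->
  (forall f s, T (f *: s) = f x *: T s + wedge (symbol f) ((deg1 B s : G) x)) ->
  (forall i, tau i = T (coframe Q x i)) ->
  forall t, der c tau beta (deg1 B t : G) = T t.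
Proof.
move=> TD TZ tauE t; rewrite (first_order_expand TD TZ (cosection_near x t)).
rewrite /der [X in _ + X]big1 ?addr0; last by move=> j _; rewrite vert_deg1 wedge_0r.
rewrite addrC big_split /=; congr (_ + _).
  by apply: eq_bigr => i _; rewrite contraction_deg1 wedge_scalarr tauE.
transitivity (\sum_j \sum_i v j (pairing t (frame Q x i)) *:
    (wedge (c j) ((deg1 B (coframe Q x i) : G) x) : F)).
  apply: eq_bigr => j _; rewrite hor_deg1 // wedge_sumr.
  by apply: eq_bigr => i _; rewrite wedgeZr.
rewrite exchange_big; apply: eq_bigr => i _ /=.
by rewrite wedge_suml; apply: eq_bigr => j _; rewrite wedgeZl.
Qed.

Lemma der_deg2 (T : Gamma B -> F) :
  (forall s s', T (s + s') = T s + T s') ->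
  (forall f s, T (f *: s) = f x *: T s + wedge (symbol f) ((deg2 Q s : G) x)) ->
  (forall j, beta j = T (frame B x j)) ->
  forall b, der c tau beta (deg2 Q b : G) = T b.
Proof.
move=> TD TZ betaE b; rewrite (first_order_expand TD TZ (section_near x b)).
rewrite /der [X in _ + X + _]big1 ?addr0; last by move=> j _; rewrite contraction_deg2 wedge_0r.
rewrite addrC big_split /=; congr (_ + _).
  by apply: eq_bigr => j _; rewrite vert_deg2 wedge_scalarr betaE.
transitivity (\sum_j \sum_i v j (pairing (coframe B x i) b) *:
    (wedge (c j) ((deg2 Q (frame B x i) : G) x) : F)).
  apply: eq_bigr => j _; rewrite hor_deg2 // wedge_sumr.
  by apply: eq_bigr => i _; rewrite wedgeZr.
rewrite exchange_big; apply: eq_bigr => i _ /=.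
by rewrite wedge_suml; apply: eq_bigr => j _; rewrite wedgeZl.
Qed.

End Values.
End FrameDerivations.

Lemma addr5_perm (V : zmodType) (a p c q r : V) :
  a - p + c - (q + r) = a - q + (c - r - p).
Proof.
rewrite opprD !addrA (addrAC a (- p) c) (addrAC _ (- p) (- q)).
by rewrite (addrAC _ (- p) (- r)) (addrAC a c (- q)).
Qed.

(** * The pointwise frame formula and the global bracket *)

Section BracketOfRepresentation.
Variables (R : realType) (M : manifold R) (Q B : vbundle M).
Local Notation G := (dfun (gfib Q B)).
Local Infix "**" := mulg (at level 40).
Implicit Types (g h : G) (d e : int) (x : M) (t : Gamma (dual Q)) (b : Gamma B)
  (f : Cinf M).

Variables (L : lie_algebroid B) (D : two_rep L (dual Q) Q).
Hypothesis sD : self_dual D.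
Let rh := rho L.
Let bb := brk L.
Let n0 := nabla0 D.
Let dl := del D.
Let w := curv D.

Lemma anchorE b f x : anchor rh b f x = anchor_at rh (b x) f. Proof. by []. Qed.

Lemma cst1_scale (E : vbundle M) (s : Gamma E) : Cinf_cst M 1 *: s = s.
Proof. by apply: sec_ext => x; exact: scale1r. Qed.

Lemma n0Dr b t t' : n0 b (t + t') = n0 b t + n0 b t'.
Proof. by have := nabla_linear_r n0 1 b t t'; rewrite !cst1_scale. Qed.
Lemma n0Dl b b' t : n0 (b + b') t = n0 b t + n0 b' t.
Proof. by have := nabla_linear_l n0 1 b b' t; rewrite !scale1r. Qed.
Lemma n0Zl f b t : n0 (f *: b) t = f *: n0 b t.
Proof.
have n00 : n0 0 t = 0 by apply: (addrI (n0 0 t)); rewrite -n0Dl !addr0.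
by have := nabla_linear_l n0 f b 0 t; rewrite n00 !addr0.
Qed.
Lemma bbDl b b' c : bb (b + b') c = bb b c + bb b' c.
Proof. by have := brk_linear L 1 b b' c; rewrite !cst1_scale. Qed.
Lemma bb_skew b b' : bb b b' = - bb b' b. Proof. exact: brk_skew. Qed.
Lemma bbDr b b' c : bb c (b + b') = bb c b + bb c b'.
Proof. by rewrite bb_skew bbDl opprD -!(bb_skew c). Qed.
Lemma bbZl f b c : bb (f *: b) c = f *: bb b c - anchor rh c f *: b.
Proof.
by rewrite bb_skew [bb c _]brk_leibniz -/bb (bb_skew b c) opprD scalerN addrC.
Qed.

Lemma deg2N b : deg2 Q (- b) = - deg2 Q b :> G.
Proof.
apply/eqP; rewrite -addr_eq0 -deg2D addNr; apply/eqP.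
by apply: (addrI (deg2 Q 0)); rewrite -deg2D !addr0.
Qed.

Lemma deg1_scale f t x : (deg1 B (f *: t) : G) x = f x *: (deg1 B t : G) x.
Proof. by rewrite -deg1Z deg0_mul. Qed.

Lemma deg2_scale f b x : (deg2 Q (f *: b) : G) x = f x *: (deg2 Q b : G) x.
Proof. by rewrite -deg2Z deg0_mul. Qed.

Lemma curvP f b b' c : (curv_fun w (f *: b + b') c : G) =
  fun x => f x *: (curv_fun w b c : G) x + (curv_fun w b' c : G) x.
Proof.
apply: gfun_ext3 => x s z.
rewrite -[RHS]/(f x * (curv_fun w b c : G) x s z + (curv_fun w b' c : G) x s z).
case: s => [|q [|q' [|q'' s]]]; rewrite /= ?mulr0 ?addr0 //.
rewrite -[LHS]/((form_at w (f x *: b x + b' x) (c x) q : dual Q x) q') form_linear.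
by rewrite !(add_lfunE, scale_lfunE).
Qed.

Lemma curv0 c : (curv_fun w 0 c : G) = 0.
Proof.
have := curvP 1 0 0 c; rewrite scaler0 addr0 => E; apply: gfun_ext3 => x s z.
have := congr1 (fun k : G => k x s z) E => /=.
rewrite -[X in _ = X]/(1 * (curv_fun w 0 c : G) x s z + (curv_fun w 0 c : G) x s z) mul1r.
by rewrite -[X in X = _ -> _]addr0 => /addrI <-.
Qed.

Lemma curv_alt b b' : (curv_fun w b b' : G) = - (curv_fun w b' b : G).
Proof.
apply: gfun_ext3 => x s z; rewrite gfun_oppE.
case: s => [|q [|q' [|q'' s]]] /=; rewrite ?oppr0 //.
by rewrite form_alt !opp_lfunE.
Qed.

Lemma curv0r c : (curv_fun w c 0 : G) = 0.
Proof. by rewrite curv_alt curv0 oppr0. Qed.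

Lemma curvPr f b b' c x : (curv_fun w c (f *: b + b') : G) x =
  f x *: (curv_fun w c b : G) x + (curv_fun w c b' : G) x.
Proof.
apply/funext => s; apply/funext => z.
rewrite curv_alt curvP (curv_alt c b) (curv_alt c b').
rewrite -[LHS]/(- (f x * (curv_fun w b c : G) x s z + (curv_fun w b' c : G) x s z)).
rewrite -[RHS]/(f x * (- (curv_fun w b c : G) x s z) + - (curv_fun w b' c : G) x s z).
by rewrite opprD mulrN.
Qed.

Let w_skew : forall x (u v : B x) (p q : Q x),
  form_at w u v q p = - form_at w u v p q.
Proof. by case: sD. Qed.

Let lgc b b' : lgen 2 (curv_fun w b b' : G) := lgen_curv w_skew b b'.

Section At.
Variable x : M.
Local Notation F := (gfib Q B x).

Definition frame_anchor (j : 'I_(vrank B)) : Cinf M -> R :=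
  anchor_at rh (frame B x j x).

Lemma frame_anchor_tangent j : tangent x (frame_anchor j).
Proof. exact: anchor_tangent. Qed.
Local Notation tv := frame_anchor_tangent.

Lemma anchor_expand (u : B x) f :
  anchor_at rh u f = \sum_j frame_anchor j f * coframe B x j x u.
Proof.
rewrite {1}[u]frame_expand.
have AD a (u1 u2 : B x) : anchor_at rh (a *: u1 + u2) f = a * anchor_at rh u1 f + anchor_at rh u2 f.
  by rewrite anchor_linear.
have A0 : anchor_at rh (0 : B x) f = 0.
  by have := AD (-1) 0 0; rewrite scaler0 addr0 mulN1r addNr.
have AS (I : finType) (c : I -> R) (e : I -> B x) :
    anchor_at rh (\sum_i c i *: e i) f = \sum_i c i * anchor_at rh (e i) f.
  rewrite (big_morph (fun u => anchor_at rh u f) (id1 := 0) (op1 := +%R)) //.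
    by apply: eq_bigr => i _; have := AD (c i) (e i) 0; rewrite !addr0 A0 addr0.
  by move=> u1 u2; have := AD 1 u1 u2; rewrite scale1r mul1r.
by rewrite AS; apply: eq_bigr => j _; rewrite mulrC.
Qed.

(* {t, g} and {b, g} at x. *)
Definition der1 t g : F :=
  der frame_anchor (fun=> 0)
    (fun i => scalar_form (coframe Q x i x (bmap_at dl x (t x))))
    (fun j => - (deg1 B (n0 (frame B x j) t) : G) x) g.

Definition der2 b g : F :=
  der frame_anchor (fun j => scalar_form (coframe B x j x (b x)))
    (fun i => (deg1 B (n0 b (coframe Q x i)) : G) x)
    (fun j => (deg2 Q (bb b (frame B x j)) : G) x - (curv_fun w b (frame B x j) : G) x) g.

Lemma scalarD r r' : scalar_form (r + r') = scalar_form r + scalar_form r' :> F.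
Proof.
apply/funext => s; apply/funext => z; case: s => // q s.
by rewrite -[RHS]/(0 + 0) addr0.
Qed.

Lemma scalarZ r r' : scalar_form (r * r') = r *: scalar_form r' :> F.
Proof.
apply/funext => s; apply/funext => z; case: s => // q s.
by rewrite -[RHS]/(r * 0) mulr0.
Qed.

Lemma scalar_sum (I : finType) (r : I -> R) :
  scalar_form (\sum_i r i) = \sum_i scalar_form (r i) :> F.
Proof.
apply: (big_morph (fun r : R => scalar_form r : F)); first exact: scalarD.
by apply/funext => s; apply/funext => z; case: s.
Qed.

(** The Leibniz rule for {f t, g}: the correction is t times {f, g}, which is minus the sum of
    (rho(e_j) f) dg/de_j. *)
Lemma der1P f t t' g : der1 (f *: t + t') g =
  f x *: der1 t g + der1 t' g -
  \sum_j frame_anchor j f *: (wedge ((deg1 B t : G) x) (vert (coframe B x j x) g) : F).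
Proof.
rewrite -sumrN /der1.
transitivity (f x *: der1 t g + der frame_anchor (fun=> 0)
    (fun i => scalar_form (coframe Q x i x (bmap_at dl x (t' x))))
    (fun j => - (deg1 B (n0 (frame B x j) t') : G) x -
       frame_anchor j f *: (deg1 B t : G) x) g).
  rewrite -der_coef; congr (der _ _ _ _ _); apply/funext => j.
  - by rewrite scaler0 addr0.
  - rewrite -[sec_at (f *: t + t') x]/(f x *: t x + t' x) !linearP.
    by rewrite scalarD scalarZ.
  - rewrite n0Dr deg1D -[n0]/(nabla0 D) nabla_leibniz deg1D !(deg1_scale, opprD, scalerN).
    by rewrite [RHS]addrA [RHS]addrC [RHS]addrA.
rewrite -addrA; congr (_ + _).
rewrite /der -!addrA; congr (_ + (_ + _)); rewrite -big_split /=; apply: eq_bigr => j _.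
by rewrite wedgeDl !wedgeNl wedgeZl.
Qed.

Lemma der2P f b b' g : der2 (f *: b + b') g =
  f x *: der2 b g + der2 b' g -
  \sum_j frame_anchor j f *: (wedge ((deg2 Q b : G) x) (vert (coframe B x j x) g) : F).
Proof.
rewrite -sumrN /der2.
transitivity (f x *: der2 b g + der frame_anchor
    (fun j => scalar_form (coframe B x j x (b' x)))
    (fun i => (deg1 B (n0 b' (coframe Q x i)) : G) x)
    (fun j => (deg2 Q (bb b' (frame B x j)) : G) x - (curv_fun w b' (frame B x j) : G) x -
       frame_anchor j f *: (deg2 Q b : G) x) g).
  rewrite -der_coef; congr (der _ _ _ _ _); apply/funext => j.
  - rewrite -[sec_at (f *: b + b') x]/(f x *: b x + b' x) !linearP.
    by rewrite scalarD scalarZ.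
  - by rewrite n0Dl n0Zl deg1D -deg1_scale.
  - rewrite bbDl bbZl !deg2D deg2N curvP.
    rewrite -[LHS]/((deg2 Q (f *: bb b (frame B x j)) : G) x -
      (deg2 Q (anchor rh (frame B x j) f *: b) : G) x + (deg2 Q (bb b' (frame B x j)) : G) x -
      (f x *: (curv_fun w b (frame B x j) : G) x + (curv_fun w b' (frame B x j) : G) x)).
    rewrite !deg2_scale -[anchor _ _ _ x]/(frame_anchor j f).
    by rewrite scalerBr; exact: addr5_perm.
rewrite -addrA; congr (_ + _).
rewrite /der -!addrA; congr (_ + (_ + _)); rewrite -big_split /=; apply: eq_bigr => j _.
by rewrite wedgeDl !wedgeNl wedgeZl.
Qed.

Lemma homog_deg1 t : homog true ((deg1 B t : G) x).
Proof. exact: (locgen_homog (lgen_deg1 B t x)). Qed.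

Lemma homog_deg2 b : homog false ((deg2 Q b : G) x).
Proof. exact: (locgen_homog (lgen_deg2 Q b x)). Qed.

Lemma homog_curv b b' : homog false ((curv_fun w b b' : G) x).
Proof. exact: (locgen_homog (lgc b b' x)). Qed.

Lemma der1_mul t d e g h : locgen x d g -> locgen x e h ->
  der1 t (g ** h) = (wedge (der1 t g) (h x) : F) +
    (-1) ^+ odz d *: (wedge (g x) (der1 t h) : F).
Proof.
move=> dg eh; apply: (der_mul tv (b := true)) dg eh => j; first exact: homog0.
- exact: homog_scalar.
- by apply: homogN; exact: homog_deg1.
Qed.

Lemma der1_homog t d g : locgen x d g -> homog (~~ odz d) (der1 t g).
Proof.
move=> dg; apply: (der_homog tv (b := true)) dg => j; first exact: homog0.
- exact: homog_scalar.
- by apply: homogN; exact: homog_deg1.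
Qed.

Lemma der2_mul b d e g h : locgen x d g -> locgen x e h ->
  der2 b (g ** h) = (wedge (der2 b g) (h x) : F) + (wedge (g x) (der2 b h) : F).
Proof.
move=> dg eh; rewrite -[X in _ + X]scale1r.
apply: (der_mul tv (b := false)) dg eh => j; first exact: homog_scalar.
- exact: homog_deg1.
- by apply: homogD; [exact: homog_deg2|apply: homogN; exact: homog_curv].
Qed.

Lemma der2_homog b d g : locgen x d g -> homog (odz d) (der2 b g).
Proof.
move=> dg; apply: (der_homog tv (b := false)) dg => j; first exact: homog_scalar.
- exact: homog_deg1.
- by apply: homogD; [exact: homog_deg2|apply: homogN; exact: homog_curv].
Qed.

Lemma symbol0 f : symbol frame_anchor (fun=> 0 : F) f = 0.
Proof. by rewrite /symbol big1 // => j _; rewrite scaler0. Qed.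

Lemma der1_deg0 t f : der1 t (deg0 Q B f) = 0.
Proof. by rewrite /der1 der_deg0 ?symbol0 //; exact: tv. Qed.

Lemma der1_deg1 t t' : der1 t (deg1 B t' : G) = scalar_form (t' x (bmap_at dl x (t x))).
Proof.
rewrite /der1 (@der_deg1 _ _ _ _ _ _ tv _ _ _
  (fun t' => scalar_form (t' x (bmap_at dl x (t x))))) //.
- by move=> s s'; rewrite -[sec_at (s + s') x]/(s x + s' x) add_lfunE scalarD.
- move=> f s; rewrite symbol0 wedge_0l addr0.
  by rewrite -[sec_at (f *: s) x]/(f x *: s x) scale_lfunE scalarZ.
Qed.

Lemma der1_deg2 t b : der1 t (deg2 Q b : G) = - (deg1 B (n0 b t) : G) x.
Proof.
rewrite /der1 (@der_deg2 _ _ _ _ _ _ tv _ _ _ (fun b => - (deg1 B (n0 b t) : G) x)) //.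
- by move=> s s'; rewrite n0Dl deg1D -[LHS]/(- (_ + _)) opprD.
- by move=> f s; rewrite symbol0 wedge_0l addr0 n0Zl deg1_scale scalerN.
Qed.

Lemma symbol2 b f : symbol frame_anchor (fun j => scalar_form (coframe B x j x (b x)) : F) f =
  scalar_form (anchor rh b f x).
Proof.
rewrite anchorE anchor_expand scalar_sum; apply: eq_bigr => j _.
by rewrite scalarZ.
Qed.

Lemma der2_deg0 b f : der2 b (deg0 Q B f) = scalar_form (anchor rh b f x).
Proof. by rewrite /der2 der_deg0 ?symbol2 //; exact: tv. Qed.

Lemma der2_deg1 b t : der2 b (deg1 B t : G) = (deg1 B (n0 b t) : G) x.
Proof.
rewrite /der2 (@der_deg1 _ _ _ _ _ _ tv _ _ _ (fun t => (deg1 B (n0 b t) : G) x)) //.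
- by move=> s s'; rewrite n0Dr deg1D.
- move=> f s; rewrite symbol2 wedge_scalarl.
  by rewrite -[n0]/(nabla0 D) nabla_leibniz addrC deg1D -!deg1_scale.
Qed.

Lemma der2_deg2 b b' : der2 b (deg2 Q b' : G) =
  (deg2 Q (bb b b') : G) x - (curv_fun w b b' : G) x.
Proof.
rewrite /der2 (@der_deg2 _ _ _ _ _ _ tv _ _ _
  (fun b' => (deg2 Q (bb b b') : G) x - (curv_fun w b b' : G) x)) //.
- move=> s s'; rewrite bbDr deg2D; have := curvPr 1 s s' b x; rewrite scale1r => ->.
  by rewrite scale1r opprD addrACA.
- move=> f s; rewrite symbol2 wedge_scalarl [bb b _]brk_leibniz -/bb deg2D.
  have := curvPr f s 0 b x; rewrite addr0 curv0r => ->.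
  rewrite -[LHS]/((deg2 Q (anchor rh b f *: s) : G) x + (deg2 Q (f *: bb b s) : G) x
    - (f x *: (curv_fun w b s : G) x + 0)).
  by rewrite !deg2_scale addr0 scalerBr -addrA addrC.
Qed.

Lemma der1D t t' g : der1 (t + t') g = der1 t g + der1 t' g.
Proof.
have := der1P 1 t t' g; rewrite big1 ?subr0.
  by rewrite Cinf1E !scale1r.
by move=> j _; rewrite (tangent1 (tv j)) scale0r.
Qed.

Lemma der1Z f t g : der1 (f *: t) g = f x *: der1 t g -
  \sum_j frame_anchor j f *: (wedge ((deg1 B t : G) x) (vert (coframe B x j x) g) : F).
Proof.
have d0 : der1 0 g = 0 by apply: (addrI (der1 0 g)); rewrite -der1D !addr0.
by have := der1P f t 0 g; rewrite d0 !addr0.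
Qed.

Lemma der2D b b' g : der2 (b + b') g = der2 b g + der2 b' g.
Proof.
have := der2P 1 b b' g; rewrite big1 ?subr0.
  by rewrite Cinf1E !scale1r.
by move=> j _; rewrite (tangent1 (tv j)) scale0r.
Qed.

Lemma der2Z f b g : der2 (f *: b) g = f x *: der2 b g -
  \sum_j frame_anchor j f *: (wedge ((deg2 Q b : G) x) (vert (coframe B x j x) g) : F).
Proof.
have d0 : der2 0 g = 0 by apply: (addrI (der2 0 g)); rewrite -der2D !addr0.
by have := der2P f b 0 g; rewrite d0 !addr0.
Qed.

(* The derivation that takes h = f, q^i, e_j to {g, f}, {g, q^i}, {g, e_j}; the last two
   are known from [der1] and [der2] by skew-symmetry. *)
Definition br_at d g h : F :=
  der frame_anchor (fun j => vert (coframe B x j x) g)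
    (fun i => - (-1) ^+ odz d *: der1 (coframe Q x i) g)
    (fun j => - der2 (frame B x j) g) h.

Lemma br_at_mulr d e e' g h h' : locgen x d g -> locgen x e h -> locgen x e' h' ->
  br_at d g (h ** h') = (wedge (br_at d g h) (h' x) : F) +
    (-1) ^+ (odz d && odz e) *: (wedge (h x) (br_at d g h') : F).
Proof.
move=> dg eh eh'; apply: (der_mul tv (b := odz d)) eh eh' => j.
- exact: vert_homog.
- by apply: homogZ; exact: der1_homog.
- by apply: homogN; exact: der2_homog.
Qed.

(** The coefficients of the formula are [vert], [der1] and [der2] of the first argument, hence
    derivations in it. This is proved independently of skew-symmetry, which can therefore be reduced
    to generators afterwards. *)
Lemma br_at_mull d d' e g g' h : locgen x d g -> locgen x d' g' -> locgen x e h ->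
  br_at (d + d') (g ** g') h = (wedge (g x) (br_at d' g' h) : F) +
    (-1) ^+ (odz d' && odz e) *: (wedge (br_at d g h) (g' x) : F).
Proof.
move=> dg dg' eh; have hg := locgen_homog dg; have hg' := locgen_homog dg'.
rewrite /br_at /der !(wedgeDl, wedgeDr) !(wedge_suml, wedge_sumr) !scalerDr -addr3ACA.
have even_case (u u' k : F) : homog (odz e) k ->
    wedge ((wedge u (g' x) : F) + wedge (g x) u') k =
    (wedge (g x) (wedge u' k) : F) + (-1) ^+ (odz d' && odz e) *: (wedge (wedge u k) (g' x) : F) :> F.
  move=> hk; rewrite wedgeDl -!wedgeA (wedgeC hg' hk) wedgeZr addrC.
  by rewrite wedgeA.
congr (_ + _ + _); rewrite scaler_sumr -big_split; apply: eq_bigr => j _ /=.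
- by rewrite (vertM _ dg dg') even_case //; exact: (hor_homog (tv j) eh).
- have hk : homog (~~ odz e) (contraction (frame Q x j x) (h x)).
    by apply: homog_contraction; exact: locgen_homog.
  rewrite (der1_mul _ dg dg') odzD.
  set k := contraction _ _ in hk *; set u := der1 _ g; set u' := der1 _ g'.
  have E1 : wedge (wedge u (g' x) : F) k =
      (-1) ^+ (odz d' && ~~ odz e) *: (wedge (wedge u k : F) (g' x) : F) :> F.
    by rewrite -wedgeA (wedgeC hg' hk) wedgeZr wedgeA.
  have E2 : wedge (wedge (g x) u' : F) k = wedge (g x) (wedge u' k) :> F by rewrite wedgeA.
  rewrite wedgeZl wedgeDl wedgeZl E1 E2 !wedgeZl wedgeZr scalerDr !scalerA addrC.
  congr (_ *: _ + _ *: _).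
    by case: (odz d) (odz d') (odz e) => [] [] [] /=; ring.
  by case: (odz d) (odz d') => [] [] /=; ring.
- rewrite (der2_mul _ dg dg') opprD -wedgeNl -wedgeNr even_case //.
  exact: vert_homog.
Qed.

Lemma br_at_deg0 d g f : locgen x d g ->
  br_at d g (deg0 Q B f) = \sum_j frame_anchor j f *: vert (coframe B x j x) g.
Proof. by move=> dg; rewrite /br_at der_deg0 //; exact: tv. Qed.

Lemma br_at_deg1 d g t : locgen x d g ->
  br_at d g (deg1 B t : G) = - (-1) ^+ odz d *: der1 t g.
Proof.
move=> dg; rewrite /br_at (@der_deg1 _ _ _ _ _ _ tv _ _ _
  (fun t => - (-1) ^+ odz d *: der1 t g)) //.
- by move=> s s'; rewrite der1D scalerDr.
(* The correction in [der1Z] is, after commuting the odd factor s past the derivative of g, the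
   symbol of the derivation {g, .}. *)
- move=> f s; rewrite der1Z scalerBr scalerA mulrC -scalerA; congr (_ + _).
  rewrite scaler_sumr -sumrN /symbol wedge_suml; apply: eq_bigr => j _.
  rewrite wedgeZl scalerA mulNr scaleNr opprK mulrC -scalerA; congr (_ *: _).
  by rewrite (wedgeC (vert_homog _ dg) (homog_deg1 s)) andbT.
Qed.

Lemma br_at_deg2 d g b : locgen x d g -> br_at d g (deg2 Q b : G) = - der2 b g.
Proof.
move=> dg; rewrite /br_at (@der_deg2 _ _ _ _ _ _ tv _ _ _ (fun b => - der2 b g)) //.
- by move=> s s'; rewrite der2D opprD.
- move=> f s; rewrite der2Z opprB scalerN addrC; congr (_ + _).
  rewrite /symbol wedge_suml; apply: eq_bigr => j _; rewrite wedgeZl; congr (_ *: _).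
  by rewrite (wedgeC (vert_homog _ dg) (homog_deg2 s)) andbF scale1r.
Qed.

Lemma br_at_linr d e a g h h' : locgen x e h -> locgen x e h' ->
  br_at d g (a *: h + h') = a *: br_at d g h + br_at d g h'.
Proof. by move=> eh eh'; exact: (der_linear tv _ _ _ a eh eh'). Qed.

Lemma br_at_linl d e a g g' h : locgen x d g -> locgen x d g' -> locgen x e h ->
  br_at d (a *: g + g') h = a *: br_at d g h + br_at d g' h.
Proof.
move=> dg dg' eh; rewrite /br_at -der_coef; congr (der _ _ _ _ _); apply/funext => j.
- exact: (vertP _ _ dg dg').
- rewrite /der1 (der_linear tv _ _ _ a dg dg') scalerDr !scalerA.
  by congr (_ *: _ + _); rewrite mulrC.
- by rewrite /der2 (der_linear tv _ _ _ a dg dg') opprD scalerN.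
Qed.

Lemma br_at_near d e g g' h h' : locgen x d g -> locgen x e h ->
  (\forall y \near x, g y = g' y) -> (\forall y \near x, h y = h' y) ->
  br_at d g h = br_at d g' h'.
Proof.
move=> dg eh gg hh; rewrite /br_at (der_near tv _ _ _ eh hh).
congr (der _ _ _ _ _); apply/funext => j.
- exact: (vert_near _ (nbhs_singleton gg)).
- by rewrite /der1 (der_near tv _ _ _ dg gg).
- by rewrite /der2 (der_near tv _ _ _ dg gg).
Qed.

End At.

Definition br d g h : G := fun x => @br_at x d g h.
Arguments br : clear implicits.

Lemma br_mulr d e e' g h h' : lgen d g -> lgen e h -> lgen e' h' ->
  br d g (h ** h') = br d g h ** h' + (-1) ^ (d * e) *: (h ** br d g h').
Proof.
move=> dg eh eh'; apply: gfun_ext => x.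
by rewrite signz odzM; exact: (@br_at_mulr x d e e' g h h' (dg x) (eh x) (eh' x)).
Qed.

Lemma br_mull d d' e g g' h : lgen d g -> lgen d' g' -> lgen e h ->
  br (d + d') (g ** g') h = g ** br d' g' h + (-1) ^ (d' * e) *: (br d g h ** g').
Proof.
move=> dg dg' eh; apply: gfun_ext => x.
by rewrite signz odzM; exact: (@br_at_mull x d d' e g g' h (dg x) (dg' x) (eh x)).
Qed.

Lemma br_linr d e a g h h' : lgen e h -> lgen e h' ->
  br d g (a *: h + h') = a *: br d g h + br d g h'.
Proof.
by move=> eh eh'; apply: gfun_ext => x; exact: (@br_at_linr x d e a g h h' (eh x) (eh' x)).
Qed.

Lemma br_linl d e a g g' h : lgen d g -> lgen d g' -> lgen e h ->
  br d (a *: g + g') h = a *: br d g h + br d g' h.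
Proof.
by move=> dg dg' eh; apply: gfun_ext => x; exact: (@br_at_linl x d e a g g' h (dg x) (dg' x) (eh x)).
Qed.

Let lg0 := @lgen_deg0 R M Q B.
Let lg1 := @lgen_deg1 R M Q B.
Let lg2 := @lgen_deg2 R M Q B.

Lemma br00 f f' : br 0 (deg0 Q B f) (deg0 Q B f') = 0.
Proof.
apply: gfun_ext => x; rewrite [LHS](br_at_deg0 _ (lg0 f x)) big1 // => j _.
by rewrite vert_deg0 scaler0.
Qed.

Lemma br01 f t : br 0 (deg0 Q B f) (deg1 B t) = 0.
Proof.
by apply: gfun_ext => x; rewrite [LHS](br_at_deg1 _ (lg0 f x)) der1_deg0 scaler0.
Qed.

Lemma br02 f b : br 0 (deg0 Q B f) (deg2 Q b) = - deg0 Q B (anchor rh b f).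
Proof.
by apply: gfun_ext => x; rewrite [LHS](br_at_deg2 _ (lg0 f x)) der2_deg0.
Qed.

Lemma br10 t f : br 1 (deg1 B t) (deg0 Q B f) = 0.
Proof.
apply: gfun_ext => x; rewrite [LHS](br_at_deg0 _ (lg1 t x)) big1 // => j _.
by rewrite vert_deg1 scaler0.
Qed.

Lemma br11 t t' : br 1 (deg1 B t) (deg1 B t') = deg0 Q B (pairing t' (bmap dl t)).
Proof.
apply: gfun_ext => x; rewrite [LHS](br_at_deg1 _ (lg1 t x)) der1_deg1.
(* The formula computes {t, t'} through {t', t}, which gives t(del t'); symmetry of del turns it
   into t'(del t). *)
have [sym _ _] := sD; rewrite sym.
by rewrite (_ : - (-1) ^+ odz 1 = 1 :> R) ?scale1r // /odz expr1 opprK.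
Qed.

Lemma br12 t b : br 1 (deg1 B t) (deg2 Q b) = - deg1 B (n0 b t) :> G.
Proof.
by apply: gfun_ext => x; rewrite [LHS](br_at_deg2 _ (lg1 t x)) der2_deg1.
Qed.

Lemma br20 b f : br 2 (deg2 Q b) (deg0 Q B f) = deg0 Q B (anchor rh b f).
Proof.
apply: gfun_ext => x; rewrite [LHS](br_at_deg0 _ (lg2 b x)).
rewrite -[RHS](symbol2 x b f); apply: eq_bigr => j _.
by rewrite vert_deg2.
Qed.

Lemma br21 b t : br 2 (deg2 Q b) (deg1 B t) = deg1 B (n0 b t).
Proof.
apply: gfun_ext => x; rewrite [LHS](br_at_deg1 _ (lg2 b x)) der1_deg2.
by rewrite (_ : - (-1) ^+ odz 2 = -1 :> R) // scaleN1r opprK.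
Qed.

Lemma br22 b b' : br 2 (deg2 Q b) (deg2 Q b') =
  deg2 Q (bb b b') - (curv_fun w b b' : G).
Proof.
rewrite (bb_skew b b') (curv_alt b b') deg2N; apply: gfun_ext => x.
by rewrite [LHS](br_at_deg2 _ (lg2 b x)) der2_deg2 opprD.
Qed.

(** The companion of [lgen_ind] for smoothness and degree: an operator of degree k that is local and
    linear needs to be controlled only on generators and products. *)
Lemma lgen_closed (T : int -> G -> G) (k : int) :
  (forall d g h x, lgen d g -> lgen d h -> (\forall y \near x, g y = h y) ->
    (T d g : G) x = (T d h : G) x) ->
  (forall d a g h, lgen d g -> lgen d h -> T d (a *: g + h) = a *: T d g + T d h) ->
  (forall d e g h, lgen d g -> lgen e h -> lgen (d + k) (T d g) ->
    lgen (e + k) (T e h) -> lgen (d + e + k) (T (d + e) (g ** h))) ->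
  (forall d g, is_gen d g -> lgen (d + k) (T d g)) ->
  forall d g, lgen d g -> lgen (d + k) (T d g).
Proof.
move=> Tloc Tlin Tmul Tgen d g dg x.
have lz e : lgen e (0 : G) by move=> y; exact: locgen0.
have Tz e : T e 0 = 0.
  by have := Tlin e (-1) 0 0 (lz e) (lz e); rewrite scaler0 addr0 scaleN1r addNr.
have [h dh gh] := dg x; have lh := genz_lgen dh.
have nT : \forall y \near x, (T d h : G) y = (T d g : G) y.
  have /near_join := gh; apply: filterS => y gh'.
  by apply: Tloc => //; apply: filterS gh' => u ->.
apply: locgen_eq nT _.
suff H : lgen (d + k) (T d h) by exact: H.
case: d dh {dg gh lh} => [n|n]; last by move=> ->; rewrite Tz; exact: lz.
rewrite /genz => gn; elim: n h / gn => [f|t|b|n|n a g1 h l1 IHg l2 IHh|m n g1 h l1 IHg l2 IHh].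
- by apply: Tgen; constructor.
- by apply: Tgen; constructor.
- by apply: Tgen; constructor.
- by rewrite Tz; exact: lz.
- rewrite Tlin; [|exact: genz_lgen|exact: genz_lgen].
  by move=> y; apply: locgenP; [exact: IHg|exact: IHh].
- by rewrite PoszD; apply: Tmul => //; [exact: genz_lgen|exact: genz_lgen].
Qed.

Let near_refl x g : \forall y \near x, g y = g y.
Proof. exact: nearW. Qed.

Lemma br_near d e g g' h h' x : lgen d g -> lgen e h ->
  (\forall y \near x, g y = g' y) -> (\forall y \near x, h y = h' y) ->
  br d g h x = br d g' h' x.
Proof. by move=> dg eh gg hh; exact: (@br_at_near x d e g g' h h' (dg x) (eh x) gg hh). Qed.

(** On generators the bracket is a frame-free smooth expression. The Leibniz rules carry this over
    to each argument in turn, the bracket being an operator of degree e - 2 in the first and d - 2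
    in the second. *)
Lemma lgen_br d e g h : lgen d g -> lgen e h -> lgen (d + e - 2) (br d g h).
Proof.
have lz k : lgen k (0 : G) by move=> y; exact: locgen0.
have Hgen d' e' g' h' : is_gen d' g' -> is_gen e' h' -> lgen (d' + (e' - 2)) (br d' g' h').
  case=> [f|t|b] [f'|t'|b'].
  - by rewrite br00.
  - by rewrite br01.
  - by rewrite br02; exact/lgenN/lg0.
  - by rewrite br10.
  - by rewrite br11; exact: lg0.
  - by rewrite br12; exact/lgenN/lg1.
  - by rewrite br20; exact: lg0.
  - by rewrite br21; exact: lg1.
  - by rewrite br22; apply: lgenB; [exact: lg2|exact: lgc].
have H1 d' e' g' h' : lgen d' g' -> is_gen e' h' -> lgen (d' + (e' - 2)) (br d' g' h').
  move=> dg' /[dup] eh' /is_gen_lgen le.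
  move: d' g' dg'; apply: (lgen_closed (T := fun d g => br d g h')).
  - by move=> d' g1 g2 x l1 l2 gg; exact (br_near l1 le gg (near_refl x h')).
  - by move=> d' a g1 g2 l1 l2; exact: (br_linl _ l1 l2 le).
  - move=> d1 d2 g1 g2 l1 l2 L1 L2; rewrite (br_mull l1 l2 le).
    apply: lgenD; first by rewrite -addrA; exact: lgenM.
    by rewrite addrAC; apply: lgenZ; exact: lgenM.
  - by move=> d' g' l; exact: Hgen.
move=> dg eh; rewrite (_ : d + e - 2 = e + (d - 2)); last by ring.
move: e h eh; apply: (lgen_closed (T := fun e h => br d g h)).
- by move=> e h1 h2 x l1 l2 hh; exact (br_near dg l1 (near_refl x g) hh).
- by move=> e a h1 h2 l1 l2; exact: (br_linr _ _ _ l1 l2).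
- move=> e1 e2 h1 h2 l1 l2 L1 L2; rewrite (br_mulr dg l1 l2).
  apply: lgenD; first by rewrite addrAC; exact: lgenM.
  by rewrite -addrA; apply: lgenZ; exact: lgenM.
- move=> e h l; rewrite (_ : e + (d - 2) = d + (e - 2)); last by ring.
  exact: H1.
Qed.

(** The defect of skew-symmetry is local and linear in each argument, and the two Leibniz rules make
    it vanish on products once it vanishes on the factors, so the table on generators decides. *)
Lemma br_skew d e g h : lgen d g -> lgen e h ->
  br d g h = - ((-1) ^ (d * e)) *: br e h g.
Proof.
have bb_sk := bb_skew.
have s12 : (-1) ^ (1 * 2) = 1 :> R by rewrite signz odzM.
have s21 : (-1) ^ (2 * 1) = 1 :> R by rewrite signz odzM.
have s22 : (-1) ^ (2 * 2) = 1 :> R by rewrite signz odzM.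
have Hgen d' e' g' h' : is_gen d' g' -> is_gen e' h' ->
    br d' g' h' + (-1) ^ (d' * e') *: br e' h' g' = 0.
  case=> [f|t|b] [f'|t'|b'].
  - by rewrite !br00 scaler0 addr0.
  - by rewrite br01 br10 scaler0 addr0.
  - by rewrite br02 br20 scale1r addNr.
  - by rewrite br01 br10 scaler0 addr0.
  - rewrite !br11 (_ : (-1) ^ (1 * 1) = -1 :> R) // scaleN1r.
    have [sym _ _] := sD.
    rewrite (_ : pairing t (bmap dl t') = pairing t' (bmap dl t)) ?subrr //.
    by apply: Cinf_ext => x; exact: sym.
  - by rewrite br12 br21 s12 scale1r addNr.
  - by rewrite br02 br20 scale1r addrN.
  - by rewrite br12 br21 s21 scale1r addrN.
  - rewrite !br22 s22 scale1r.
    by rewrite (bb_sk b b') (curv_alt b b') deg2N opprK addrACA addNr subrr addr0.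
have H1 d' e' g' h' : lgen d' g' -> is_gen e' h' ->
    br d' g' h' + (-1) ^ (d' * e') *: br e' h' g' = 0.
  move=> dg' /[dup] eh' /is_gen_lgen le.
  move: d' g' dg'; apply: (lgen_ind (T := fun d g => br d g h' + (-1) ^ (d * e') *: br e' h' g)).
  - move=> d' g1 g2 x l1 l2 gg.
    congr (_ + _ *: _); first exact (br_near l1 le gg (near_refl x h')).
    exact (br_near le l1 (near_refl x h') gg).
  - move=> d' a g1 g2 l1 l2; rewrite (br_linl _ l1 l2 le) (br_linr _ _ _ l1 l2).
    by apply: gfun_ext3 => x s z; rewrite !gfunE; ring.
  - move=> d1 d2 g1 g2 l1 l2 E1 E2; rewrite (br_mull l1 l2 le) (br_mulr le l1 l2).
    rewrite (_ : br e' h' g2 = - (-1) ^ (d2 * e') *: br d2 g2 h'); last first.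
      move/eqP: E2; rewrite addrC addr_eq0 => /eqP/(congr1 ( *:%R ((-1) ^ (d2 * e')))).
      by rewrite scalerA signz -expr2 sqrr_sign scale1r scalerN scaleNr.
    rewrite (_ : br e' h' g1 = - (-1) ^ (d1 * e') *: br d1 g1 h'); last first.
      move/eqP: E1; rewrite addrC addr_eq0 => /eqP/(congr1 ( *:%R ((-1) ^ (d1 * e')))).
      by rewrite scalerA signz -expr2 sqrr_sign scale1r scalerN scaleNr.
    apply: gfun_ext3 => x s z; rewrite !(mulgZl, mulgZr) !gfunE !signz !(odzM, odzD).
    by case: (odz d1) (odz d2) (odz e') => [] [] [] /=; ring.
  - by move=> f; apply: Hgen => //; constructor.
  - by move=> f; apply: Hgen => //; constructor.
  - by move=> f; apply: Hgen => //; constructor.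
move=> dg eh; apply/eqP; rewrite scaleNr -addr_eq0; apply/eqP.
move: e h eh; apply: (lgen_ind (T := fun e h => br d g h + (-1) ^ (d * e) *: br e h g)).
- move=> e h1 h2 x l1 l2 gg.
  congr (_ + _ *: _); first exact (br_near dg l1 (near_refl x g) gg).
  exact (br_near l1 dg gg (near_refl x g)).
- move=> e a h1 h2 l1 l2; rewrite (br_linl _ l1 l2 dg) (br_linr _ _ _ l1 l2).
  by apply: gfun_ext3 => x s z; rewrite !gfunE; ring.
- move=> e1 e2 h1 h2 l1 l2 E1 E2; rewrite (br_mull l1 l2 dg) (br_mulr dg l1 l2).
  move/eqP: E1; rewrite addr_eq0 => /eqP ->; move/eqP: E2; rewrite addr_eq0 => /eqP ->.
  apply: gfun_ext3 => x s z; rewrite !(mulgZl, mulgZr, mulgNl, mulgNr) !gfunE !signz !(odzM, odzD).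
  by case: (odz d) (odz e1) (odz e2) => [] [] [] /=; ring.
- by move=> f; apply: H1 => //; constructor.
- by move=> f; apply: H1 => //; constructor.
- by move=> f; apply: H1 => //; constructor.
Qed.

Lemma representation_gbracket : exists K : gbracket Q B,
  [/\ forall t t', bk K 1 1 (deg1 B t) (deg1 B t') = deg0 Q B (pairing t' (bmap dl t)),
      forall b f, bk K 2 0 (deg2 Q b) (deg0 Q B f) = deg0 Q B (anchor rh b f),
      forall b t, bk K 2 1 (deg2 Q b) (deg1 B t) = deg1 B (n0 b t)
    & forall b b', bk K 2 2 (deg2 Q b) (deg2 Q b') =
        deg2 Q (bb b b') - (curv_fun w b b' : G)].
Proof.
unshelve eexists (GBracket (bk := fun d e g h => br d g h) _ _ _ _ _).
- by move=> d e g h; exact: lgen_br.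
- by move=> d e g g' h h' x dg _ eh _; exact: br_near.
- by move=> d e a g g' h; exact: br_linl.
- by move=> d e g h; exact: br_skew.
- by move=> d1 d2 d3 g1 g2 g3; exact: br_mulr.
split=> /=; [exact: br11|exact: br20|exact: br21|exact: br22].
Qed.

End BracketOfRepresentation.

(** * From a self-dual 2-representation to a Poisson bracket *)

Section DerivedFrom.
Variables (R : realType) (M : manifold R) (Q B : vbundle M).
Local Notation G := (dfun (gfib Q B)).

Definition bracket_table (br : int -> int -> G -> G -> G) (D : self_dual_two_rep Q B) :=
  [/\ forall t t', br 1 1 (deg1 B t) (deg1 B t') =
        deg0 Q B (pairing t' (bmap (del (sd_rep D)) t)),
      forall b f, br 2 0 (deg2 Q b) (deg0 Q B f) =
        deg0 Q B (anchor (rho (sd_algebroid D)) b f),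
      forall b t, br 2 1 (deg2 Q b) (deg1 B t) = deg1 B (nabla0 (sd_rep D) b t)
    & forall b b', br 2 2 (deg2 Q b) (deg2 Q b') =
        deg2 Q (brk (sd_algebroid D) b b') - (curv_fun (curv (sd_rep D)) b b' : G)].

Lemma derived_fromE (P : poisson Q B) (D : self_dual_two_rep Q B) :
  derived_from P D <-> bracket_table (pbg P) D.
Proof.
have val0 f : val (Defs.fun0 Q B f) = glob (deg0 Q B f) by [].
have val1 t : val (Defs.fun1 B t) = glob (deg1 B t : G) by [].
have val2 b : val (Defs.fun2 Q b) = glob (deg2 Q b : G) by [].
have globB (g h : G) : glob (g - h) = glob g - glob h :> gsec Q B (opens_full M) by [].
split.
- move=> [H1 H2 H3 H4]; split => [t t'|b f|b t|b b'];
    apply: (@glob_inj R M Q B); rewrite /pbg glob_zero_ext -?(fun0E, fun1E, fun2E).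
  + exact: H1.
  + exact: H2.
  + exact: H3.
  + by rewrite H4 globB.
- move=> [H1 H2 H3 H4]; split => [t t'|b f|b t|b b'].
  + by rewrite val0 -H1 /pbg glob_zero_ext -!fun1E.
  + by rewrite val0 -H2 /pbg glob_zero_ext -fun0E -fun2E.
  + by rewrite val1 -H3 /pbg glob_zero_ext -fun1E -fun2E.
  + by rewrite val2 -globB -H4 /pbg glob_zero_ext -!fun2E.
Qed.

Lemma lgen_jacobiator (K : gbracket Q B) d1 d2 d3 g1 g2 g3 : lgen d1 g1 ->
  lgen d2 g2 -> lgen d3 g3 -> lgen (d1 + d2 + d3 - 4) (jacobiator K d1 d2 d3 g1 g2 g3).
Proof.
move=> l1 l2 l3; have lb := bk_lgen K.
apply: lgenB; first apply: lgenB.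
- rewrite (_ : _ - 4 = d1 + (d2 + d3 - 2) - 2); last by ring.
  by apply: (lb) => //; exact: lb.
- rewrite (_ : _ - 4 = (d1 + d2 - 2) + d3 - 2); last by ring.
  by apply: (lb) => //; exact: lb.
- rewrite (_ : _ - 4 = d2 + (d1 + d3 - 2) - 2); last by ring.
  by apply: lgenZ; apply: (lb) => //; exact: lb.
Qed.

(** The Jacobiator lowers the total degree by 4, so it vanishes when this is less than 4. The other
    degree patterns are (2,2,0), (2,1,1), (2,2,1) and (2,2,2); each repeats a degree, so all its
    orderings are cyclic rotations. *)
Lemma jacobi_sorted_generators (K : gbracket Q B) :
  (forall a b f, jacobiator K 2 2 0 (deg2 Q a) (deg2 Q b) (deg0 Q B f) = 0) ->
  (forall b t t', jacobiator K 2 1 1 (deg2 Q b) (deg1 B t) (deg1 B t') = 0) ->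
  (forall a b t, jacobiator K 2 2 1 (deg2 Q a) (deg2 Q b) (deg1 B t) = 0) ->
  (forall a b c, jacobiator K 2 2 2 (deg2 Q a) (deg2 Q b) (deg2 Q c) = 0) ->
  forall d1 d2 d3 g1 g2 g3, lgen d1 g1 -> lgen d2 g2 -> lgen d3 g3 ->
    jacobiator K d1 d2 d3 g1 g2 g3 = 0.
Proof.
move=> H220 H211 H221 H222; apply: jacobi_from_generators.
have rot d1 d2 d3 g1 g2 g3 : is_gen d1 g1 -> is_gen d2 g2 -> is_gen d3 g3 ->
    jacobiator K d2 d3 d1 g2 g3 g1 = 0 -> jacobiator K d1 d2 d3 g1 g2 g3 = 0.
  move=> /is_gen_lgen l1 /is_gen_lgen l2 /is_gen_lgen l3 E.
  by rewrite (jacobiator_rot K l2 l3 l1) E scaler0.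
have neg d1 d2 d3 g1 g2 g3 : is_gen d1 g1 -> is_gen d2 g2 -> is_gen d3 g3 ->
    d1 + d2 + d3 < 4 -> jacobiator K d1 d2 d3 g1 g2 g3 = 0.
  move=> /is_gen_lgen l1 /is_gen_lgen l2 /is_gen_lgen l3.
  rewrite -subr_lt0; have := lgen_jacobiator K l1 l2 l3.
  by case: (_ - 4) => // n lJ _; exact: lgen_neg lJ.
have g0 f : is_gen 0 (deg0 Q B f) by constructor.
have g1 t : is_gen 1 (deg1 B t : G) by constructor.
have g2 b : is_gen 2 (deg2 Q b : G) by constructor.
move=> d1 d2 d3 h1 h2 h3.
case=> ?; case=> ?; case=> ?; try by apply: neg.
all: try exact: H220.
all: try exact: H211.
all: try exact: H221.
all: try exact: H222.
all: try by apply: rot.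
all: by apply: (rot) => //; apply: rot.
Qed.

Lemma representation_poisson (D : self_dual_two_rep Q B) :
  exists P : poisson Q B, derived_from P D.
Proof.
case: D => L D sD.
have [K [H11 H20 H21 H22]] := representation_gbracket sD.
have [sym duality skew] := sD.
have [P PK] : exists P : poisson Q B,
    forall d e g h, lgen d g -> lgen e h -> pbg P d e g h = bk K d e g h.
  apply: gbracket_poisson; apply: jacobi_sorted_generators.
  - move=> a b f; rewrite (jacobiator220 H20 H22 skew) (rho_brk L).
    by rewrite subKr subrr deg0_0.
  (* Duality differentiates t'(del t) factor by factor, and nabla1 of del t is del of nabla0 t. *)
  - move=> b t t'; rewrite (jacobiator211 H11 H20 H21) duality -del_nabla.
    by rewrite addrK subrr deg0_0.
  - move=> a b t; rewrite (jacobiator221 H11 H21 H22 skew).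
    rewrite -(curv_nabla0 D) /curvature (addrC (nabla0 D (brk L a b) t)).
    by rewrite subrK subKr subrr deg1_0.
  - move=> a b c; have [J0 J2 Js] := jacobiator222 H21 H22 duality skew a b c.
    apply: gfun_ext3 => x s z; case: s => [|q [|q' [|q'' s]]]; try by rewrite Js.
      by rewrite J0 (brk_jacobi L) addrAC addrK subrr linear0.
    have := J2 x (extend q) (extend q') z; rewrite !extend_at => ->.
    have -> : d_form (brk L) (nabla0 D) (nabla1 D) (curv D) a b c (extend q) = 0.
      exact: (curv_closed D).
    by rewrite -[pairing _ _ _]/((0 : dual Q x) (extend q' x)) zero_lfunE oppr0.
exists P; apply/derived_fromE; split=> [t t'|b f|b t|b b'] /=; rewrite PK //.
all: by [exact: lgen_deg0|exact: lgen_deg1|exact: lgen_deg2].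
Qed.

End DerivedFrom.

(** * The 2-representation of a bracket *)

Section LocalSmoothness.
Variables (R : realType) (M : manifold R).

Lemma smooth_sec_local (E : vbundle M) (s : dfun (fib E)) :
  (forall x : M, exists u : Gamma E, \forall y \near x, s y = u y) -> s \in smooth_sec E.
Proof.
move=> H; apply/smooth_secP => t tE i; apply: smoothM_local => x tx.
have [u] := H x; rewrite /prop_near1 nbhsE => -[V [oV Vx] su].
have oU := openI oV (@tdom_open _ _ _ _ t).
exists (V `&` tdom t); split => //.
have /smooth_secP/(_ t tE i) := sec_smooth u.
move=> /(smoothM_sub (@subIsetr _ V (tdom t))).
by apply: smoothM_ext oU _ => y [Vy _]; rewrite su.
Qed.

Lemma smooth_fun_local (phi : M -> R) :
  (forall x : M, exists f : Cinf M, \forall y \near x, phi y = f y) -> phi \in @smooth_fun R M.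
Proof.
move=> H; apply/smooth_funP; apply: smoothM_local => x _.
have [f] := H x; rewrite /prop_near1 nbhsE => -[V [oV Vx] pf].
exists V; split => //.
have := smoothM_sub (@subsetT _ V) (elimT (smooth_funP _) (Cinf_smooth f)).
by apply: smoothM_ext oV _ => y Vy; rewrite pf.
Qed.

End LocalSmoothness.

Section PairingTheory.
Variables (R : realType) (M : manifold R) (E : vbundle M).
Implicit Types (t : Gamma (dual E)) (s : Gamma E) (f g : Cinf M).

Lemma CinfDE f g x : (f + g) x = f x + g x. Proof. by []. Qed.
Lemma CinfNE f x : (- f) x = - f x. Proof. by []. Qed.
Lemma CinfME f g x : (f * g) x = f x * g x. Proof. by []. Qed.

Lemma pairingDl t t' s : pairing (t + t') s = pairing t s + pairing t' s.
Proof. by apply: Cinf_ext => x; exact: add_lfunE. Qed.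
Lemma pairingDr t s s' : pairing t (s + s') = pairing t s + pairing t s'.
Proof. by apply: Cinf_ext => x; exact: linearD. Qed.
Lemma pairingZl f t s : pairing (f *: t) s = f * pairing t s.
Proof. by apply: Cinf_ext => x; exact: scale_lfunE. Qed.
Lemma pairingZr f t s : pairing t (f *: s) = f * pairing t s.
Proof. by apply: Cinf_ext => x; exact: linearZ. Qed.
Lemma pairingNl t s : pairing (- t) s = - pairing t s.
Proof. by apply: Cinf_ext => x; exact: opp_lfunE. Qed.
Lemma pairingNr t s : pairing t (- s) = - pairing t s.
Proof. by apply: Cinf_ext => x; exact: linearN. Qed.

Lemma pairing_ext_r s s' : (forall t, pairing t s = pairing t s') -> s = s'.
Proof.
move=> H; apply: sec_ext => x; rewrite [LHS]frame_expand [RHS]frame_expand.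
apply: eq_bigr => i _; congr (_ *: _).
exact: (congr1 (fun f : Cinf M => f x) (H (coframe E x i))).
Qed.

Lemma pairing_ext_l t t' : (forall s, pairing t s = pairing t' s) -> t = t'.
Proof.
move=> H; apply: sec_ext => x; apply/lfunP => v.
by have := congr1 (fun f : Cinf M => f x) (H (extend v)); rewrite /= !extend_at.
Qed.

(** Identifies the bidual with E. The value at x is written in the frame at x but characterized by
    all pairings, so near x it agrees with the smooth section written in that one frame. *)
Lemma dual_section (N : Gamma (dual E) -> Cinf M) :
  (forall t t', N (t + t') = N t + N t') -> (forall f t, N (f *: t) = f * N t) ->
  exists s, forall t, pairing t s = N t.
Proof.
move=> ND NZ.
pose s0 : dfun (fib E) := fun x => \sum_i N (coframe E x i) x *: frame E x i x.
have s0E x t : t x (s0 x) = N t x.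
  rewrite /s0 linear_sum.
  rewrite (@tensorial_sum _ _ _ R^o x (fun t => N t x : R^o) _ _ _ t _ _ (cosection_near x t)).
  - by apply: eq_bigr => i _; rewrite linearZ [RHS]mulrC.
  - by move=> u v; rewrite ND.
  - by move=> f u; rewrite NZ.
suff sm : s0 \in smooth_sec E.
  by exists (Sec sm) => t; apply: Cinf_ext => x; exact: s0E.
apply: smooth_sec_local => x; exists (\sum_i N (coframe E x i) *: frame E x i).
apply: filterS (frame_near E x) => y [H _].
by rewrite sec_sumE {1}(H (s0 y)); apply: eq_bigr => i _; rewrite s0E.
Qed.

Lemma codual_section (N : Gamma E -> Cinf M) :
  (forall s s', N (s + s') = N s + N s') -> (forall f s, N (f *: s) = f * N s) ->
  exists t, forall s, pairing t s = N s.
Proof.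
move=> ND NZ.
pose t0 : dfun (fib (dual E)) := fun x => \sum_i N (frame E x i) x *: coframe E x i x.
have t0E x s : (t0 x : dual E x) (s x) = N s x.
  rewrite /t0 sum_lfunE.
  rewrite (@tensorial_sum _ _ _ R^o x (fun u => N u x : R^o) _ _ _ s _ _ (section_near x s)).
  - by apply: eq_bigr => i _; rewrite scale_lfunE [RHS]mulrC.
  - by move=> u v; rewrite ND.
  - by move=> f u; rewrite NZ.
suff sm : t0 \in smooth_sec (dual E).
  by exists (Sec sm) => t; apply: Cinf_ext => x; exact: t0E.
apply: smooth_sec_local => x; exists (\sum_i N (frame E x i) *: coframe E x i).
apply: filterS (frame_near E x) => y [H _].
rewrite sec_sumE {1}(coframe_expand_of H (t0 y)).
by apply: eq_bigr => i _; rewrite t0E.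
Qed.

End PairingTheory.

Section Tensors.
Variables (R : realType) (M : manifold R).

(** By tensoriality [Phi s x] depends only on [s x], so the fibre map may be computed on [extend]
    and does not depend on its frame. *)
Lemma tensorial_bundle_map (E F : vbundle M) (Phi : Gamma E -> Gamma F) :
  (forall s s', Phi (s + s') = Phi s + Phi s') ->
  (forall f s, Phi (f *: s) = f *: Phi s) ->
  exists phi : bundle_map E F, forall s, bmap phi s = Phi s.
Proof.
move=> PD PZ.
have H x : exists h : 'Hom(E x, F x), forall v, h v = Phi (extend v) x.
  have [h hE] : exists h : 'Hom(E x, F x), h =1 (fun v => Phi (extend v) x).
    apply: linear_lfun => a u v; rewrite extendP PD PZ.
    by rewrite -[LHS]/(a *: Phi (extend u) x + Phi (extend v) x).
  by exists h.
pose h x := projT1 (cid (H x)).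
have hE x (s : Gamma E) : h x (s x) = Phi s x.
  rewrite (projT2 (cid (H x))).
  apply: (@tensoriality _ _ _ _ x (fun s => Phi s x)).
  - by move=> u v; rewrite PD.
  - by move=> f u; rewrite PZ.
  - exact: extend_at.
have sm (s : Gamma E) : ((fun x => h x (s x)) : dfun (fib F)) \in smooth_sec F.
  rewrite (_ : (fun x => _) = sec_val (Phi s)); first exact: sec_smooth.
  by apply: functional_extensionality_dep => x; rewrite hE.
by exists (BundleMap sm) => s; apply: sec_ext => x; exact: hE.
Qed.

Lemma tensorial_form (A E F : vbundle M)
    (Om : Gamma A -> Gamma A -> Gamma E -> Gamma F) :
  (forall a a' b e, Om (a + a') b e = Om a b e + Om a' b e) ->
  (forall f a b e, Om (f *: a) b e = f *: Om a b e) ->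
  (forall a b e, Om a b e = - Om b a e) ->
  (forall a b e e', Om a b (e + e') = Om a b e + Om a b e') ->
  (forall f a b e, Om a b (f *: e) = f *: Om a b e) ->
  exists w : hom_form2 A E F, forall a b e, Defs.form w a b e = Om a b e.
Proof.
move=> OD OZ Oalt OeD OeZ.
have ODr a b b' e : Om a (b + b') e = Om a b e + Om a b' e.
  by rewrite Oalt OD opprD -!(Oalt a).
have OZr f a b e : Om a (f *: b) e = f *: Om a b e.
  by rewrite Oalt OZ -scalerN -(Oalt a).
have H x (u v : A x) : exists h : 'Hom(E x, F x),
    forall e, h e = Om (extend u) (extend v) (extend e) x.
  have [h hE] : exists h : 'Hom(E x, F x),
      h =1 (fun e => Om (extend u) (extend v) (extend e) x).
    apply: linear_lfun => a e e'; rewrite extendP OeD OeZ.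
    by rewrite -[LHS]/(a *: Om (extend u) (extend v) (extend e) x + Om (extend u) (extend v) (extend e') x).
  by exists h.
pose h x u v := projT1 (cid (H x u v)).
have hP x u v (e : E x) : h x u v e = Om (extend u) (extend v) (extend e) x.
  exact: (projT2 (cid (H x u v))).
have hE x (a b : Gamma A) (e : Gamma E) : h x (a x) (b x) (e x) = Om a b e x.
  rewrite hP.
  transitivity (Om a (extend (b x)) (extend (e x)) x).
    apply: (@tensoriality _ _ _ _ x (fun a => Om a (extend (b x)) (extend (e x)) x)).
    - by move=> u v; rewrite OD.
    - by move=> f u; rewrite OZ.
    - exact: extend_at.
  transitivity (Om a b (extend (e x)) x).
    apply: (@tensoriality _ _ _ _ x (fun b => Om a b (extend (e x)) x)).
    - by move=> u v; rewrite ODr.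
    - by move=> f u; rewrite OZr.
    - exact: extend_at.
  apply: (@tensoriality _ _ _ _ x (fun e => Om a b e x)).
  - by move=> u v; rewrite OeD.
  - by move=> f u; rewrite OeZ.
  - exact: extend_at.
have hlin x v : linear (fun u => h x u v).
  move=> a u u'; apply/lfunP => e; rewrite add_lfunE scale_lfunE !hP.
  by rewrite extendP OD OZ.
have halt x u v : h x u v = - h x v u.
  by apply/lfunP => e; rewrite opp_lfunE !hP Oalt.
have sm (a b : Gamma A) (e : Gamma E) :
    ((fun x => h x (a x) (b x) (e x)) : dfun (fib F)) \in smooth_sec F.
  rewrite (_ : (fun x => _) = sec_val (Om a b e)); first exact: sec_smooth.
  by apply: functional_extensionality_dep => x; rewrite hE.
exists (@HomForm2 R M A E F h hlin halt sm) => a b e.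
by apply: sec_ext => x; exact: hE.
Qed.

Lemma tensorial_anchor (A : vbundle M) (al : Gamma A -> Cinf M -> Cinf M) :
  (forall a a' f, al (a + a') f = al a f + al a' f) ->
  (forall g a f, al (g *: a) f = g * al a f) ->
  (forall a r f g, al a (Cinf_cst M r * f + g) = Cinf_cst M r * al a f + al a g) ->
  (forall a f g, al a (f * g) = al a f * g + f * al a g) ->
  exists rh : anchor_map A, forall a f, anchor rh a f = al a f.
Proof.
move=> aD aZ aL aM.
pose h x (v : A x) (f : Cinf M) : R := al (extend v) f x.
have hE x (a : Gamma A) f : h x (a x) f = al a f x.
  apply: (@tensoriality _ _ _ R^o x (fun a => al a f x : R^o)).
  - by move=> u v; rewrite aD.
  - by move=> g u; rewrite aZ.
  - exact: extend_at.
have hlin x : linear (h x).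
  move=> a u v; apply/funext => f; rewrite /h extendP aD aZ.
  by rewrite -[RHS]/(a * al (extend u) f x + al (extend v) f x).
have htan x v : tangent x (h x v).
  by split=> *; rewrite /h ?aL ?aM.
have sm (a : Gamma A) f : (fun x => h x (a x) f) \in @smooth_fun R M.
  rewrite (_ : (fun x => _) = al a f :> (M -> R)); first exact: Cinf_smooth.
  by apply/funext => x; rewrite hE.
exists (@AnchorMap R M A h hlin htan sm) => a f.
by apply: Cinf_ext => x; exact: hE.
Qed.

End Tensors.

(** * Global functions of degree 0, 1 and 2 *)

Section LowDegree.
Variables (R : realType) (M : manifold R) (Q B : vbundle M).
Local Notation G := (dfun (gfib Q B)).
Implicit Types (g : G) (x : M).

Lemma lgen0_deg0 g : lgen 0 g -> exists f, g = deg0 Q B f.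
Proof.
move=> lg; have H x : exists f, \forall y \near x, g y = deg0 Q B f y.
  have [h hg gh] := lg x; have [f hf] := generated_low hg.
  by exists f; rewrite -hf.
have sm : (fun x => g x [::] 0 : R) \in @smooth_fun R M.
  apply: smooth_fun_local => x; have [f fg] := H x; exists f.
  by apply: filterS fg => y ->.
exists (SmoothFun sm); apply: gfun_ext => x; have [f /nbhs_singleton fg] := H x.
apply/funext => s; apply/funext => z.
by rewrite fg; case: s => //; rewrite /deg0 /= fg.
Qed.

Lemma lgen1_deg1 g : lgen 1 g -> exists t, g = deg1 B t.
Proof.
move=> lg; have H x : exists t, \forall y \near x, g y = (deg1 B t : G) y.
  have [h hg gh] := lg x; have [t ht] := generated_low hg.
  by exists t; rewrite -ht.
(* A separate section is chosen for each point. The diagonal y -> T y y is smooth near x because g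
   determines it, and g comes from a single section there. *)
pose T x := projT1 (cid (H x)).
have TP x : g x = (deg1 B (T x) : G) x by exact: nbhs_singleton (projT2 (cid (H x))).
have sm : ((fun x => T x x) : dfun (fib (dual Q))) \in smooth_sec (dual Q).
  apply: smooth_sec_local => x; have [t tg] := H x; exists t.
  apply: filterS tg => y; rewrite TP => E; apply/lfunP => q.
  exact: (congr1 (fun k => k [:: q] 0) E).
by exists (Sec sm); apply: gfun_ext => x; rewrite TP.
Qed.

Lemma pairs_form_linear l x a (p q q' : Q x) z :
  (pairs_form l : G) x [:: a *: p + q; q'] z =
  a * (pairs_form l : G) x [:: p; q'] z + (pairs_form l : G) x [:: q; q'] z.
Proof.
elim: l => [|u l IH]; first by rewrite /pairs_form big_nil !gfunE mulr0 addr0.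
rewrite !pairs_form_cons !gfun_addE IH !deg1M_cons !deg1E !linearP /=.
by rewrite /GRing.scale /=; ring.
Qed.

Lemma pairs_form_alt l x (q q' : Q x) z z' :
  (pairs_form l : G) x [:: q'; q] z = - (pairs_form l : G) x [:: q; q'] z'.
Proof.
elim: l => [|u l IH]; first by rewrite /pairs_form big_nil !gfunE oppr0.
by rewrite !pairs_form_cons !gfun_addE IH !deg1M_cons !deg1E; ring.
Qed.

Lemma lgen2_near g x : lgen 2 g -> exists b l,
  \forall y \near x, g y = (deg2 Q b + pairs_form l : G) y.
Proof.
move=> lg; have [h hg gh] := lg x; have [b [l hE]] := generated_low hg.
by exists b, l; rewrite /pairs_form -hE.
Qed.

(** Of the local normal form only the section of B is determined by g and glues. The list of pairs
    is not unique, so the two-form part is handled through its values in the lemmas that follow. *)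
Lemma lgen2_section g : lgen 2 g -> exists b : Gamma B,
  forall x z, g x [::] z = z (b x).
Proof.
move=> lg; pose b0 x := projT1 (cid (lgen2_near x lg)).
have b0P x z : g x [::] z = z (b0 x x).
  have [l /nbhs_singleton ->] := projT2 (cid (lgen2_near x lg)).
  by rewrite gfun_addE pairs_form_supp // addr0.
have sm : ((fun x => b0 x x) : dfun (fib B)) \in smooth_sec B.
  apply: smooth_sec_local => x; have [b [l gb]] := lgen2_near x lg; exists b.
  apply: filterS gb => y gb; rewrite [LHS]frame_expand [RHS]frame_expand.
  apply: eq_bigr => i _; congr (_ *: _).
  by rewrite -b0P gb gfun_addE pairs_form_supp // addr0.
by exists (Sec sm).
Qed.

Lemma lgen2_supp g x s z : lgen 2 g -> size s != 0 -> size s != 2 -> g x s z = 0.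
Proof.
move=> lg s0 s2; have [b [l /nbhs_singleton ->]] := lgen2_near x lg.
by rewrite gfun_addE pairs_form_supp // addr0; case: s s0 {s2}.
Qed.

Lemma lgen2_form_linear g x a (p q q' : Q x) z : lgen 2 g ->
  g x [:: a *: p + q; q'] z = a * g x [:: p; q'] z + g x [:: q; q'] z.
Proof.
move=> lg; have [b [l /nbhs_singleton ->]] := lgen2_near x lg.
rewrite !gfun_addE pairs_form_linear.
by rewrite [X in X + _ = _]/0 [X in _ = _ * (X + _) + _]/0 [X in _ = _ + (X + _)]/0 !add0r.
Qed.

Lemma lgen2_form_alt g x (q q' : Q x) z z' : lgen 2 g ->
  g x [:: q'; q] z = - g x [:: q; q'] z'.
Proof.
move=> lg; have [b [l /nbhs_singleton ->]] := lgen2_near x lg.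
rewrite !gfun_addE (pairs_form_alt _ _ _ _ z').
by rewrite [X in X + _ = _]/0 [X in _ = - (X + _)]/0 !add0r.
Qed.

Lemma lgen2_form_smooth g (q q' : Gamma Q) : lgen 2 g ->
  (fun x => g x [:: q x; q' x] 0 : R) \in @smooth_fun R M.
Proof.
move=> lg; apply: smooth_fun_local => x; have [b [l gb]] := lgen2_near x lg.
have [F FE] := pairs_form2 B l q q'; exists F; apply: filterS gb => y ->.
by rewrite gfun_addE -FE [X in X + _]/0 add0r.
Qed.

End LowDegree.

(** * The operations on sections extracted from a bracket *)

Section DataOfBracket.
Variables (R : realType) (M : manifold R) (Q B : vbundle M).
Local Notation G := (dfun (gfib Q B)).
Local Infix "**" := mulg (at level 40).
Local Notation hform := Defs.form.
Variable K : gbracket Q B.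
Implicit Types (t : Gamma (dual Q)) (q : Gamma Q) (b : Gamma B) (f : Cinf M).

Let lg0 := @lgen_deg0 R M Q B.
Let lg1 := @lgen_deg1 R M Q B.
Let lg2 := @lgen_deg2 R M Q B.
Local Hint Resolve lg0 lg1 lg2 : core.

Lemma bk_deg0_mull d e f g h : lgen d g -> lgen e h ->
  bk K d e (deg0 Q B f ** g) h =
  deg0 Q B f ** bk K d e g h + (-1) ^ (d * e) *: (bk K 0 e (deg0 Q B f) h ** g).
Proof.
move=> dg eh; have l : lgen d (deg0 Q B f ** g).
  by rewrite -(add0r d); exact: lgenM.
rewrite bk_skew // -[X in bk K e X h (_ ** _)](add0r d) bk_leibniz // (bk_skew K dg eh).
rewrite (bk_skew K eh (lg0 f)) mulgZl mulgZr.
apply: gfun_ext3 => x s z; rewrite !gfunE !signz !odzM.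
by case: (odz d) (odz e) => [] [] /=; ring.
Qed.

Lemma bk_deg0_mulr d e f g h : lgen d g -> lgen e h ->
  bk K d e g (deg0 Q B f ** h) =
  bk K d 0 g (deg0 Q B f) ** h + deg0 Q B f ** bk K d e g h.
Proof.
move=> dg eh; rewrite -[X in bk K d X g (_ ** _)](add0r e) bk_leibniz //.
by rewrite signz odzM andbF scale1r.
Qed.

Let table0 b f : exists a, bk K 2 0 (deg2 Q b) (deg0 Q B f) = deg0 Q B a.
Proof. by apply: lgen0_deg0; exact: (bk_lgen K (lg2 b) (lg0 f)). Qed.
Let table1 b t : exists a, bk K 2 1 (deg2 Q b) (deg1 B t) = deg1 B a.
Proof. by apply: lgen1_deg1; exact: (bk_lgen K (lg2 b) (lg1 t)). Qed.
Let table11 t t' : exists a, bk K 1 1 (deg1 B t) (deg1 B t') = deg0 Q B a.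
Proof. by apply: lgen0_deg0; exact: (bk_lgen K (lg1 t) (lg1 t')). Qed.
Let lgen22 b b' : lgen 2 (bk K 2 2 (deg2 Q b) (deg2 Q b')).
Proof. exact: (bk_lgen K (lg2 b) (lg2 b')). Qed.
Let table22 b b' := lgen2_section (lgen22 b b').

Let al b f := projT1 (cid (table0 b f)).
Let n0 b t := projT1 (cid (table1 b t)).
Let sq t t' := projT1 (cid (table11 t t')).
Let bb b b' := projT1 (cid (table22 b b')).

Let alE b f : bk K 2 0 (deg2 Q b) (deg0 Q B f) = deg0 Q B (al b f).
Proof. exact: projT2 (cid (table0 b f)). Qed.
Let n0E b t : bk K 2 1 (deg2 Q b) (deg1 B t) = deg1 B (n0 b t).
Proof. exact: projT2 (cid (table1 b t)). Qed.
Let sqE t t' : bk K 1 1 (deg1 B t) (deg1 B t') = deg0 Q B (sq t t').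
Proof. exact: projT2 (cid (table11 t t')). Qed.
Let bbE b b' x z : bk K 2 2 (deg2 Q b) (deg2 Q b') x [::] z = z (bb b b' x).
Proof. exact: (projT2 (cid (table22 b b')) x z). Qed.

Let alD b b' f : al (b + b') f = al b f + al b' f.
Proof. by apply: (@deg0_inj R M Q B); rewrite deg0D -!alE deg2D bkDl. Qed.
Let alZ f b f' : al (f *: b) f' = f * al b f'.
Proof.
apply: (@deg0_inj R M Q B); rewrite -deg0M -!alE -deg2Z bk_deg0_mull //.
(* {f, f'} has degree -2 and vanishes, which makes the anchor linear over functions. *)
by rewrite (@bk_neg _ _ _ _ K 0 0) // mulg0l scaler0 addr0.
Qed.
Let alDr b f f' : al b (f + f') = al b f + al b f'.
Proof. by apply: (@deg0_inj R M Q B); rewrite deg0D -!alE deg0D bkDr. Qed.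
Let alM b f f' : al b (f * f') = al b f * f' + f * al b f'.
Proof.
apply: (@deg0_inj R M Q B); rewrite deg0D -!deg0M -!alE -deg0M.
by rewrite bk_deg0_mulr.
Qed.
Let al_cstZ b r f : al b (Cinf_cst M r * f) = Cinf_cst M r * al b f.
Proof.
by apply: (@deg0_inj R M Q B); rewrite -deg0M -!alE -deg0M -!scale_deg0 bkZr.
Qed.

Let n0Dl b b' t : n0 (b + b') t = n0 b t + n0 b' t.
Proof. by apply: (@deg1_inj R M Q B); rewrite deg1D -!n0E deg2D bkDl. Qed.
Let n0Dr b t t' : n0 b (t + t') = n0 b t + n0 b t'.
Proof. by apply: (@deg1_inj R M Q B); rewrite deg1D -!n0E deg1D bkDr. Qed.
Let n0Zl f b t : n0 (f *: b) t = f *: n0 b t.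
Proof.
apply: (@deg1_inj R M Q B); rewrite -deg1Z -!n0E -deg2Z bk_deg0_mull //.
by rewrite (@bk_neg _ _ _ _ K 0 1) // mulg0l scaler0 addr0.
Qed.
Let n0Zr f b t : n0 b (f *: t) = al b f *: t + f *: n0 b t.
Proof.
apply: (@deg1_inj R M Q B); rewrite deg1D -!deg1Z -!n0E -alE -deg1Z.
by rewrite bk_deg0_mulr.
Qed.

Let sqD t t' u : sq (t + t') u = sq t u + sq t' u.
Proof. by apply: (@deg0_inj R M Q B); rewrite deg0D -!sqE deg1D bkDl. Qed.
Let sqC t t' : sq t t' = sq t' t.
Proof.
apply: (@deg0_inj R M Q B); rewrite -!sqE bk_skew //.
by rewrite signz odzM expr1 opprK scale1r.
Qed.
Let sqZ f t u : sq (f *: t) u = f * sq t u.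
Proof.
apply: (@deg0_inj R M Q B); rewrite -deg0M -!sqE -deg1Z bk_deg0_mull //.
by rewrite (@bk_neg _ _ _ _ K 0 1) // mulg0l scaler0 addr0.
Qed.

Let bb_ext b b' : (forall x (z : dual B x), z (b x) = z (b' x)) -> b = b'.
Proof.
move=> H; apply: sec_ext => x; rewrite [LHS]frame_expand [RHS]frame_expand.
by apply: eq_bigr => i _; rewrite H.
Qed.

Let bk02 f b : bk K 0 2 (deg0 Q B f) (deg2 Q b) = - deg0 Q B (al b f).
Proof. by rewrite bk_skew // alE signz odzM scaleN1r. Qed.

Let bbD b b' c : bb (b + b') c = bb b c + bb b' c.
Proof.
apply: bb_ext => x z; rewrite -bbE deg2D bkDl //.
by rewrite -[RHS]/(z (bb b c x + bb b' c x)) linearD /= -!bbE.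
Qed.
Let bbC b b' : bb b b' = - bb b' b.
Proof.
apply: bb_ext => x z; rewrite -bbE bk_skew //.
rewrite -[RHS]/(z (- bb b' b x)) linearN /= -bbE.
by rewrite signz odzM expr0 scaleN1r.
Qed.
Let bbZ f b c : bb c (f *: b) = al c f *: b + f *: bb c b.
Proof.
apply: bb_ext => x z; rewrite -bbE -deg2Z bk_deg0_mulr // alE.
rewrite -[RHS]/(z (al c f x *: b x + f x *: bb c b x)) linearP linearZ /=.
by rewrite -(@bbE c b x z) !deg0_mul.
Qed.

(** The minus sign is that of the curvature term in {b, b'}. *)
Let om0 b b' q q' : exists F : Cinf M, forall x z,
  F x = - bk K 2 2 (deg2 Q b) (deg2 Q b') x [:: q x; q' x] z.
Proof.
exists (- SmoothFun (lgen2_form_smooth q q' (lgen22 b b'))) => x z.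
rewrite CinfNE; congr (- _) => /=.
(* Swapping the two vectors twice, with different covectors on the two sides, shows that the value
   does not depend on z. *)
by rewrite -[LHS]opprK -(lgen2_form_alt _ _ z) // -(lgen2_form_alt _ _ z) // opprK.
Qed.

Let om b b' q q' := projT1 (cid (om0 b b' q q')).
Let omE b b' q q' x z :
  om b b' q q' x = - bk K 2 2 (deg2 Q b) (deg2 Q b') x [:: q x; q' x] z.
Proof. exact: (projT2 (cid (om0 b b' q q')) x z). Qed.

Let om_alt b b' q q' : om b b' q' q = - om b b' q q'.
Proof.
by apply: Cinf_ext => x; rewrite CinfNE !(omE _ _ _ _ 0) (lgen2_form_alt _ _ 0 0).
Qed.

Let om_linear b b' f p q q' : om b b' (f *: p + q) q' = f * om b b' p q' + om b b' q q'.
Proof.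
apply: Cinf_ext => x; rewrite CinfDE CinfME !(omE _ _ _ _ 0).
rewrite -[(f *: p + q) x]/(f x *: p x + q x) lgen2_form_linear //.
by rewrite opprD mulrN.
Qed.

Let om_skew b b' q q' : om b b' q q' = - om b' b q q'.
Proof.
apply: Cinf_ext => x; rewrite CinfNE !(omE _ _ _ _ 0) bk_skew //.
by rewrite signz odzM expr0 scaleN1r gfun_oppE.
Qed.

Let omDb a b c q q' : om (a + b) c q q' = om a c q q' + om b c q q'.
Proof.
apply: Cinf_ext => x; rewrite CinfDE !(omE _ _ _ _ 0) deg2D bkDl //.
by rewrite gfun_addE opprD.
Qed.

Let omZb f a b q q' : om (f *: a) b q q' = f * om a b q q'.
Proof.
apply: Cinf_ext => x; rewrite CinfME !(omE _ _ _ _ 0) -deg2Z bk_deg0_mull // bk02.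
rewrite mulgNl deg0_mul gfun_addE gfun_scaleE gfun_oppE deg0_mul.
by rewrite -[X in _ * - X]/(al b f x * 0) mulr0 oppr0 mulr0 addr0 -mulrN.
Qed.

Let Om0 b b' q : exists t, forall q', pairing t q' = om b b' q q'.
Proof.
apply: codual_section => [p p'|f p].
  have := om_linear b b' 1 p p' q; rewrite scale1r mul1r => E.
  by rewrite !(om_alt _ _ _ q) E opprD.
have := om_linear b b' f p 0 q; have := om_linear b b' 1 0 0 q.
rewrite scaler0 addr0 mul1r -{1}[om b b' 0 q]addr0 => /addrI <-; rewrite !addr0 => E.
  by rewrite !(om_alt _ _ _ q) E mulrN.
Qed.
Let Om b b' q := projT1 (cid (Om0 b b' q)).
Let OmE b b' q q' : pairing (Om b b' q) q' = om b b' q q'.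
Proof. exact: projT2 (cid (Om0 b b' q)) q'. Qed.

Let form_ex : exists w : hom_form2 B Q (dual Q), forall b b' q, hform w b b' q = Om b b' q.
Proof.
have ext t t' : (forall q, pairing t q = pairing t' q) -> t = t' by exact: pairing_ext_l.
apply: tensorial_form => [a a' b e|f a b e|a b e|a b e e'|f a b e]; apply: ext => q.
- by rewrite pairingDl !OmE omDb.
- by rewrite pairingZl !OmE omZb.
- by rewrite pairingNl !OmE om_skew.
- by rewrite pairingDl !OmE; have := om_linear a b 1 e e' q; rewrite scale1r mul1r.
- have := om_linear a b f e 0 q; have := om_linear a b 1 0 0 q.
  rewrite scaler0 addr0 mul1r -{1}[om a b 0 q]addr0 => /addrI <-; rewrite !addr0 => E.
  by rewrite pairingZl !OmE.
Qed.

Let sg0 t : exists q, forall t', pairing t' q = sq t t'.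
Proof.
by apply: dual_section => [u u'|f u]; rewrite sqC ?sqD ?sqZ ?(sqC t).
Qed.

Let map_ex : exists dl : bundle_map (dual Q) Q, forall t t', pairing t' (bmap dl t) = sq t t'.
Proof.
pose sg t := projT1 (cid (sg0 t)).
have sgE t t' : pairing t' (sg t) = sq t t' by exact: projT2 (cid (sg0 t)) t'.
have [dl dlE] : exists dl : bundle_map (dual Q) Q, forall t, bmap dl t = sg t.
  apply: tensorial_bundle_map => [t t'|f t]; apply: pairing_ext_r => u.
    by rewrite pairingDr !sgE sqD.
  by rewrite pairingZr !sgE sqZ.
by exists dl => t t'; rewrite dlE sgE.
Qed.

Let al_linear b (r : R) f g : al b (Cinf_cst M r * f + g) = Cinf_cst M r * al b f + al b g.
Proof. by rewrite alDr al_cstZ. Qed.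

(** The connection dual to n0. The right-hand side is linear over functions in t because the two
    terms that differentiate the coefficient cancel. *)
Let n1_ex b q : exists s, forall t, pairing t s = al b (pairing t q) - pairing (n0 b t) q.
Proof.
apply: dual_section => [t t'|f t].
  by rewrite pairingDl alDr n0Dr pairingDl opprD addrACA.
rewrite pairingZl alM n0Zr pairingDl !pairingZl.
by apply: Cinf_ext => x; rewrite !(CinfDE, CinfNE, CinfME); ring.
Qed.
Let n1 b q := projT1 (cid (n1_ex b q)).
Let n1E b q t : pairing t (n1 b q) = al b (pairing t q) - pairing (n0 b t) q.
Proof. exact: projT2 (cid (n1_ex b q)) t. Qed.

Hypothesis jac : forall d1 d2 d3 g1 g2 g3, lgen d1 g1 -> lgen d2 g2 -> lgen d3 g3 ->
  jacobiator K d1 d2 d3 g1 g2 g3 = 0.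

Lemma bracket_representation : exists D : self_dual_two_rep Q B, bracket_table (bk K) D.
Proof.
have [rh rhE] := tensorial_anchor alD alZ al_linear alM.
have [w wE] := form_ex.
have [dl dlE] := map_ex.
have wom b b' q q' : pairing (hform w b b' q) q' = om b b' q q' by rewrite wE OmE.
have H11 t t' : bk K 1 1 (deg1 B t) (deg1 B t') = deg0 Q B (pairing t' (bmap dl t)).
  by rewrite sqE dlE.
have H20 b f : bk K 2 0 (deg2 Q b) (deg0 Q B f) = deg0 Q B (anchor rh b f).
  by rewrite alE rhE.
have H22 b b' : bk K 2 2 (deg2 Q b) (deg2 Q b') = deg2 Q (bb b b') - (curv_fun w b b' : G).
  apply: gfun_ext3 => x s z; rewrite gfun_addE gfun_oppE.
  case: s => [|q [|q' [|q'' s]]].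
  - by rewrite bbE [X in _ - X]/0 subr0.
  - by rewrite lgen2_supp // [X in _ - X]/0 [X in X - _]/0 subr0.
  - have := omE b b' (extend q) (extend q') z => /(congr1 -%R).
    rewrite !extend_at opprK => <-; rewrite -wom [X in X - _]/0 add0r.
    rewrite -[pairing _ _ _]/((form_at w (b x) (b' x) (extend q x) : dual Q x) (extend q' x)).
    by rewrite !extend_at.
  - by rewrite lgen2_supp // [X in _ - X]/0 [X in X - _]/0 subr0.
have skew x (u v : B x) (p q : Q x) : form_at w u v q p = - form_at w u v p q.
  have E (p' q' : Q x) : form_at w u v p' q' = om (extend u) (extend v) (extend p') (extend q') x.
    rewrite -wom -[RHS]/((form_at w (extend u x) (extend v x) (extend p' x) : dual Q x) (extend q' x)).
    by rewrite !extend_at.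
  by rewrite !E om_alt.
have sym x (s t : dual Q x) : t (bmap_at dl x s) = s (bmap_at dl x t).
  have E (s' t' : dual Q x) : t' (bmap_at dl x s') =
      sq (extend (E := dual Q) s') (extend (E := dual Q) t') x.
    rewrite -dlE -[RHS]/((extend (E := dual Q) t' x : dual Q x) (bmap_at dl x (extend (E := dual Q) s' x))).
    by rewrite !extend_at.
  by rewrite !E sqC.
have duality a t q : anchor rh a (pairing t q) = pairing (n0 a t) q + pairing t (n1 a q).
  by rewrite rhE n1E addrC subrK.
have E220 a b f : anchor rh (bb a b) f =
    anchor rh a (anchor rh b f) - anchor rh b (anchor rh a f).
  have := jac (lg2 a) (lg2 b) (lg0 f); rewrite (jacobiator220 H20 H22 skew).
  rewrite -deg0_0 => /(@deg0_inj R M Q B)/eqP.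
  by rewrite addrAC subr_eq0 => /eqP ->.
have E211 b t t' : anchor rh b (pairing t' (bmap dl t)) =
    pairing t' (bmap dl (n0 b t)) + pairing (n0 b t') (bmap dl t).
  have := jac (lg2 b) (lg1 t) (lg1 t'); rewrite (jacobiator211 H11 H20 n0E).
  rewrite -deg0_0 => /(@deg0_inj R M Q B)/eqP.
  by rewrite -addrA -opprD subr_eq0 => /eqP.
have E221 a b t : n0 a (n0 b t) - n0 b (n0 a t) - n0 (bb a b) t =
    hform w a b (bmap dl t).
  have := jac (lg2 a) (lg2 b) (lg1 t); rewrite (jacobiator221 H11 n0E H22 skew).
  rewrite -deg1_0 => /(@deg1_inj R M Q B)/eqP.
  by rewrite addrAC subr_eq0 => /eqP ->; rewrite addrC addKr.
have E222 a b c : bb a (bb b c) = bb (bb a b) c + bb b (bb a c) /\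
    forall q, d_form bb n0 n1 w a b c q = 0.
  have [J0 J2 _] := jacobiator222 n0E H22 duality skew a b c.
  have JZ := jac (lg2 a) (lg2 b) (lg2 c); split.
    apply/eqP; rewrite -subr_eq0 opprD addrA; apply/eqP.
    apply: bb_ext => x z; rewrite -J0 JZ.
    by rewrite -[RHS]/(z 0) linear0.
  move=> q; apply: pairing_ext_l => q'; apply: Cinf_ext => x.
  rewrite -[LHS]opprK -(J2 x q q' 0) JZ.
  by rewrite -[pairing 0 q' x]/((0 : dual Q x) (q' x)) zero_lfunE oppr0.
(* Skew-symmetry transfers the Leibniz rule to the first argument, and the anchor kills
   constants. *)
have bb_lin r a b c : bb (Cinf_cst M r *: a + b) c = Cinf_cst M r *: bb a c + bb b c.
  rewrite bbD; congr (_ + _); rewrite bbC bbZ [bb a c]bbC scalerN opprD.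
  rewrite (_ : al c (Cinf_cst M r) = 0) ?scale0r ?oppr0 ?add0r //.
  rewrite -rhE; apply: Cinf_ext => x.
  exact: (tangent_cst (anchor_tangent rh (c x))).
pose L := @LieAlgebroid R M B rh bb bb_lin bbC (fun a b c => (E222 a b c).1)
  (fun a f b => etrans (bbZ f b a) (congr1 (fun g => g *: b + f *: bb a b) (esym (rhE a f))))
  E220.
have n0_lin_l f a b e : n0 (f *: a + b) e = f *: n0 a e + n0 b e.
  by rewrite n0Dl n0Zl.
have n0_leib a f e : n0 a (f *: e) = anchor (rho L) a f *: e + f *: n0 a e.
  by rewrite n0Zr /= rhE.
have al_cst c r : al c (Cinf_cst M r) = 0.
  rewrite -rhE; apply: Cinf_ext => x.
  exact: (tangent_cst (anchor_tangent rh (c x))).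
have n0_lin_r r a e e' : n0 a (Cinf_cst M r *: e + e') = Cinf_cst M r *: n0 a e + n0 a e'.
  by rewrite n0Dr n0Zr al_cst scale0r add0r.
pose C0 := @Connection R M B L (dual Q) n0 n0_lin_l n0_lin_r n0_leib.
have n1_lin_l f a b e : n1 (f *: a + b) e = f *: n1 a e + n1 b e.
  apply: pairing_ext_r => t; rewrite pairingDr pairingZr !n1E alD alZ n0Dl n0Zl.
  rewrite pairingDl pairingZl.
  by apply: Cinf_ext => x; rewrite !(CinfDE, CinfNE, CinfME); ring.
have n1_lin_r r a e e' : n1 a (Cinf_cst M r *: e + e') = Cinf_cst M r *: n1 a e + n1 a e'.
  apply: pairing_ext_r => t; rewrite pairingDr pairingZr !n1E !pairingDr !pairingZr al_linear.
  by apply: Cinf_ext => x; rewrite !(CinfDE, CinfNE, CinfME); ring.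
have n1_leib a f e : n1 a (f *: e) = anchor (rho L) a f *: e + f *: n1 a e.
  apply: pairing_ext_r => t; rewrite pairingDr !pairingZr !n1E !pairingZr alM /= rhE.
  by apply: Cinf_ext => x; rewrite !(CinfDE, CinfNE, CinfME); ring.
pose C1 := @Connection R M B L Q n1 n1_lin_l n1_lin_r n1_leib.
have dln a e : bmap dl (C0 a e) = C1 a (bmap dl e).
  apply: pairing_ext_r => t; rewrite /= n1E -rhE E211.
  by rewrite addrK.
have cv0 a b e : curvature C0 a b e = hform w a b (bmap dl e) by exact: E221.
(* Dual connections have curvatures that are negative transposes of each other. Since del is
   symmetric and R(a, b) skew, the transpose of the identity [cv0] is the claim. *)
have cv1 a b e : curvature C1 a b e = bmap dl (hform w a b e).
  apply: pairing_ext_r => t; rewrite dlE sqC -dlE.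
  have -> : pairing (hform w a b e) (bmap dl t) = - pairing (hform w a b (bmap dl t)) e.
    by rewrite !wom om_alt.
  rewrite -E221 /curvature /= !(pairingDr, pairingNr, pairingDl, pairingNl) !n1E.
  have := E220 a b (pairing t e); rewrite !rhE => ->.
  have alN c f : al c (- f) = - al c f.
    have a0 : al c 0 = 0 by apply: (addrI (al c 0)); rewrite -alDr !addr0.
    by apply/eqP; rewrite -addr_eq0 -alDr addNr a0.
  rewrite !alDr !alN.
  by apply: Cinf_ext => x; rewrite !(CinfDE, CinfNE, CinfME); ring.
have ccl a b c e : d_nabla_hom C1 C0 w a b c e = 0 by exact: (E222 a b c).2.
pose D := @TwoRep R M B L (dual Q) Q dl C0 C1 w dln cv0 cv1 ccl.
have sD : self_dual D by split.
by exists (SelfDualTwoRep sD).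
Qed.

End DataOfBracket.

(** * Uniqueness on both sides of the correspondence *)

Section RepresentationExt.
Variables (R : realType) (M : manifold R).

Lemma bundle_map_ext (E F : vbundle M) (phi psi : bundle_map E F) :
  (forall s, bmap phi s = bmap psi s) -> phi = psi.
Proof.
move=> H; have : bmap_at phi = bmap_at psi.
  apply: functional_extensionality_dep => x; apply/lfunP => v.
  rewrite -(extend_at v).
  exact: (congr1 (fun s : Gamma F => s x) (H (extend v))).
case: phi psi {H} => [p sp] [q sq] /= E1; subst q.
by congr BundleMap; exact: Prop_irrelevance.
Qed.

Lemma hom_form2_ext (A E F : vbundle M) (w w' : hom_form2 A E F) :
  (forall a b e, Defs.form w a b e = Defs.form w' a b e) -> w = w'.
Proof.
move=> H; have : @form_at _ _ _ _ _ w = @form_at _ _ _ _ _ w'.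
  apply: functional_extensionality_dep => x; apply/funext => u; apply/funext => v.
  apply/lfunP => e; rewrite -(extend_at u) -(extend_at v) -(extend_at e).
  exact: (congr1 (fun s : Gamma F => s x) (H (extend u) (extend v) (extend e))).
case: w w' {H} => [p p1 p2 p3] [q q1 q2 q3] /= E1; subst q.
by congr HomForm2; exact: Prop_irrelevance.
Qed.

Lemma anchor_map_ext (A : vbundle M) (r r' : anchor_map A) :
  (forall a f, anchor r a f = anchor r' a f) -> r = r'.
Proof.
move=> H; have : @anchor_at _ _ _ r = @anchor_at _ _ _ r'.
  apply: functional_extensionality_dep => x; apply/funext => v; apply/funext => f.
  rewrite -(extend_at v).
  exact: (congr1 (fun g : Cinf M => g x) (H (extend v) f)).
case: r r' {H} => [p p1 p2 p3] [q q1 q2 q3] /= E1; subst q.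
by congr AnchorMap; exact: Prop_irrelevance.
Qed.

Lemma lie_algebroid_ext (A : vbundle M) (L L' : lie_algebroid A) :
  (forall a f, anchor (rho L) a f = anchor (rho L') a f) ->
  (forall a b, brk L a b = brk L' a b) -> L = L'.
Proof.
move=> /anchor_map_ext H1 H2; have : brk L = brk L'.
  by apply/funext => a; apply/funext => b.
case: L L' H1 {H2} => [r k p1 p2 p3 p4 p5] [r' k' q1 q2 q3 q4 q5] /= E1 E2.
by subst r' k'; congr LieAlgebroid; exact: Prop_irrelevance.
Qed.

Lemma connection_ext (A : vbundle M) (L : lie_algebroid A) (E : vbundle M)
    (D D' : connection L E) : (forall a e, D a e = D' a e) -> D = D'.
Proof.
move=> H; have : nabla D = nabla D' by apply/funext => a; apply/funext => e.
case: D D' {H} => [p p1 p2 p3] [q q1 q2 q3] /= E1; subst q.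
by congr Connection; exact: Prop_irrelevance.
Qed.

Lemma two_rep_ext (A : vbundle M) (L : lie_algebroid A) (E0 E1 : vbundle M)
    (D D' : two_rep L E0 E1) :
  del D = del D' -> nabla0 D = nabla0 D' -> nabla1 D = nabla1 D' ->
  curv D = curv D' -> D = D'.
Proof.
case: D D' => [d c0 c1 w p1 p2 p3 p4] [d' c0' c1' w' q1 q2 q3 q4] /=.
by move=> E1' E2' E3' E4'; subst d' c0' c1' w'; congr TwoRep; exact: Prop_irrelevance.
Qed.

End RepresentationExt.

Section Correspondence.
Variables (R : realType) (M : manifold R) (Q B : vbundle M).
Local Notation G := (dfun (gfib Q B)).

(** The value on two sections of B mixes bracket and curvature; evaluation on the empty list and on
    pairs of vectors separates them. *)
Lemma bracket_table_inj (br : int -> int -> G -> G -> G) (D D' : self_dual_two_rep Q B) :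
  bracket_table br D -> bracket_table br D' -> D = D'.
Proof.
case: D D' => [L D sD] [L' D' sD'] [H11 H20 H21 H22] [K11 K20 K21 K22] /=.
have E22 b b' : deg2 Q (brk L b b') - (curv_fun (curv D) b b' : G) =
    deg2 Q (brk L' b b') - (curv_fun (curv D') b b' : G) by rewrite -H22 -K22.
have EL : L = L'.
  apply: lie_algebroid_ext => [a f|a b].
    by apply: (@deg0_inj R M Q B); rewrite -H20 -K20.
  apply: (@deg2_inj R M Q B); apply: gfun_ext3 => x s z; case: s => // .
  have /(congr1 (fun g : G => g x [::] z)) := E22 a b.
  by rewrite !gfun_addE !gfun_oppE [X in _ - X = _]/0 [X in _ = _ - X]/0 !subr0.
subst L'.
have Ew : curv D = curv D'.
  apply: hom_form2_ext => a b q; apply: pairing_ext_l => q'; apply: Cinf_ext => x.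
  have /(congr1 (fun g : G => g x [:: q x; q' x] 0)) := E22 a b.
  by rewrite !gfun_addE !gfun_oppE => /addrI/oppr_inj.
have Ed : del D = del D'.
  apply: bundle_map_ext => t; apply: pairing_ext_r => t'.
  by apply: (@deg0_inj R M Q B); rewrite -H11 -K11.
have E0 : nabla0 D = nabla0 D'.
  by apply: connection_ext => a t; apply: (@deg1_inj R M Q B); rewrite -H21 -K21.
have E1 : nabla1 D = nabla1 D'.
  (* The table does not mention nabla1; duality recovers it from nabla0. *)
  apply: connection_ext => a q; apply: pairing_ext_r => t.
  have [_ /(_ a t q) d _] := sD; have [_ /(_ a t q) d' _] := sD'.
  by move: d; rewrite d' E0 => /addrI.
have ED := two_rep_ext Ed E0 E1 Ew; subst D'.
by congr SelfDualTwoRep; exact: Prop_irrelevance.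
Qed.

(** The table leaves out pairs of total degree below 2, where the bracket vanishes, and the pairs
    (0,2) and (1,2), which follow by skew-symmetry. *)
Lemma derived_from_inj_l (P P' : poisson Q B) (D : self_dual_two_rep Q B) :
  derived_from P D -> derived_from P' D -> P = P'.
Proof.
move=> /derived_fromE H /derived_fromE H'; apply: poisson_ext.
have [K EK] := poisson_gbracket P; have [K' EK'] := poisson_gbracket P'.
rewrite -EK -EK' in H H' *.
have [H11 H20 H21 H22] := H; have [K11 K20 K21 K22] := H'.
apply: bracket_unique => d1 d2 g1 g2 i1 i2.
have [l1 l2] := (is_gen_lgen i1, is_gen_lgen i2).
case: i1 l1 => [f|t|b] l1; case: i2 l2 => [f'|t'|b'] l2; try by rewrite !bk_neg.
- by rewrite [LHS]bk_skew // [RHS]bk_skew // H20 K20.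
- by rewrite H11 K11.
- by rewrite [LHS]bk_skew // [RHS]bk_skew // H21 K21.
- by rewrite H20 K20.
- by rewrite H21 K21.
- by rewrite H22 K22.
Qed.

Lemma poisson_representation (P : poisson Q B) :
  exists D : self_dual_two_rep Q B, derived_from P D.
Proof.
have [K EK] := poisson_gbracket P.
have [D KD] := bracket_representation (pbg_jacobi EK).
by exists D; apply/derived_fromE; rewrite -EK.
Qed.

End Correspondence.

Theorem theorem4p3 (R : realType) (M : manifold R) (Q B : vbundle M) :
  exists F : poisson Q B -> self_dual_two_rep Q B,
    bijective F /\ forall P : poisson Q B, derived_from P (F P).
Proof.
have [F FP] := choice (@poisson_representation R M Q B).
have [H HD] := choice (@representation_poisson R M Q B).
exists F; split => //; exists H => [P|D].
  exact: derived_from_inj_l (HD (F P)) (FP P).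
have := FP (H D); have := HD D => /derived_fromE h /derived_fromE h'.
exact: bracket_table_inj h' h.
Qed.
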